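(* Consider a team-against-team zero-sum game: a standard Borel state space $\Omega_0$; Team 1 (minimizer) with $N_1$ players and Team 2 (maximizer) with $N_2$ players; standard Borel measurement spaces $\mathbb{Y}^j_i$ and compact standard Borel action spaces $\mathbb{U}^j_i$ ($i=1,2$, $1\le j\le N_i$); an information structure $\mu$, i.e. a probability measure on $\Omega_0\times\prod_{j=1}^{N_1}\mathbb{Y}^j_1\times\prod_{j=1}^{N_2}\mathbb{Y}^j_2$; and a cost $c:\Omega_0\times\prod_j\mathbb{U}^j_1\times\prod_j\mathbb{U}^j_2\to\mathbb{R}$. Let $\mu_i$ denote the marginal of $\mu$ on $\Omega_0\times\prod_{j=1}^{N_i}\mathbb{Y}^j_i$. Assume: (i) each team $i$ uses team policies with common randomness within the team, i.e. $u^k_i=\gamma^k_i(y^k_i,z_i)$ with $z_i\in[0,1]^{N_i}$ random, independent of everything else and independent across teams (equivalently, Team $i$'s strategic measures range over $L_C(\mu_i)$); (ii) for each $i=1,2$, there exist probability measures $\mu_{0,i}$ on $\Omega_0$ and $\bar Q^j_i$ on $\mathbb{Y}^j_i$ such that $\mu_i\ll\mu_{0,i}\otimes\bigotimes_{j=1}^{N_i}\bar Q^j_i$; (iii) $c$ is measurable, bounded, and continuous in the players' actions for every $\omega_0\in\Omega_0$. Then the game admits a saddle-point equilibrium: there exist such randomized team policies $\bar\gamma^*_1,\bar\gamma^*_2$ with $\inf_{\bar\gamma_1}V(\mu,\bar\gamma_1,\bar\gamma^*_2)=V(\mu,\bar\gamma^*_1,\bar\gamma^*_2)=\sup_{\bar\gamma_2}V(\mu,\bar\gamma^*_1,\bar\gamma_2)$,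 where $V(\mu,\bar\gamma_1,\bar\gamma_2)=E^{\mu,\bar\gamma_1,\bar\gamma_2}[c(\omega_0,u^1_1,\dots,u^{N_1}_1,u^1_2,\dots,u^{N_2}_2)]$ and the infimum/supremum range over the policies described in (i).
   Context: For a team with information structure $\mu_i$ on $\Omega_0\times\prod_k\mathbb{Y}^k$, $L_C(\mu_i)$ denotes the set of probability measures on $\Omega_0\times\prod_k(\mathbb{Y}^k\times\mathbb{U}^k)$ of the form $P(B)=\int_{B\times\mathcal{W}}\eta(dz)\mu_i(d\omega_0,d\bar y)\prod_k\Pi^k(du^k|y^k,z)$ with $\mathcal{W}=[0,1]^{N_i}$, $\eta\in\mathcal{P}(\mathcal{W})$ and stochastic kernels $\Pi^k$ from $\mathbb{Y}^k\times\mathcal{W}$ to $\mathbb{U}^k$. *)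

(* Defs.v *)
From HB Require Import structures.
From mathcomp Require Import all_boot all_order all_algebra.
From mathcomp Require Import all_classical all_reals all_analysis.

Unset Printing Implicit Defensive.
Import Order.TTheory GRing.Theory Num.Theory.
Import numFieldNormedType.Exports.
Local Open Scope classical_set_scope.
Local Open Scope ring_scope.

Definition dprodM {I : Type} {d : I -> measure_display}
  (Y : forall i, measurableType (d i)) := forall i, Y i.

Section dprodM_instance.
Context {I : Type} {d : I -> measure_display} (Y : forall i, measurableType (d i)).

HB.instance Definition _ := gen_eqMixin (dprodM Y).
HB.instance Definition _ := gen_choiceMixin (dprodM Y).
HB.instance Definition _ := isPointed.Build (dprodM Y) (fun i => point).

Definition dprod_cyl : set (set (dprodM Y)) :=
  [set B | exists i (A : set (Y i)),
     measurable A /\ B = (fun f : dprodM Y => f i) @^-1` A].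

HB.instance Definition _ := @isMeasurable.Build default_measure_display
  (dprodM Y) <<s dprod_cyl >> (@sigma_algebra0 _ setT dprod_cyl)
  (@sigma_algebraC (dprodM Y) dprod_cyl)
  (@sigma_algebra_bigcup _ setT dprod_cyl).
End dprodM_instance.

Definition borel (T : ptopologicalType) := g_sigma_algebraType (@open T).

(** * Standard Borel spaces: measurable spaces isomorphic (as measurable
    spaces) to a Borel subset of a Polish space, i.e. of a complete separable
    metric space, with its Borel sigma-algebra. *)
Definition separable_space (M : topologicalType) :=
  exists D : set M, countable D /\ closure D = [set: M].

Definition standard_borel (R : realType) {d} (T : measurableType d) :=
  exists (M : completePseudoMetricType R) (f : T -> M),
    [/\ hausdorff_space M, separable_space M, injective f,
        (forall B : set M, <<s (@open M) >> B -> measurable (f @^-1` B)) &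
        (forall A : set T, measurable A -> <<s (@open M) >> (f @` A))].

Definition is_product_measure {R : realType} {d0} {O : measurableType d0}
  {N : nat} {dY : 'I_N -> measure_display} {Y : forall j, measurableType (dY j)}
  (nu : set (O * dprodM Y) -> \bar R) (mu0 : set O -> \bar R)
  (Q : forall j, set (Y j) -> \bar R) :=
  forall (A0 : set O) (A : forall j, set (Y j)),
    measurable A0 -> (forall j, measurable (A j)) ->
    nu (A0 `*` [set y : dprodM Y | forall j, A j (y j)]) =
      (mu0 A0 * \prod_(j < N) Q j (A j))%E.

Definition Wsp (R : realType) (N : nat) :=
  @dprodM 'I_N (fun _ => _) (fun _ : 'I_N => (R : measurableType _)).

Definition unit_cube (R : realType) (N : nat) : set (Wsp R N) :=
  [set z | forall j, 0 <= z j <= 1].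

(** * Team policies with common randomness within the team:
    u^k = gamma^k (y^k, z), z ~ eta on [0,1]^N, independent of everything. *)
Record team_policy (R : realType) (N : nat) (dY : 'I_N -> measure_display)
    (Y : forall j, measurableType (dY j)) (U : 'I_N -> ptopologicalType) := {
  tp_eta : probability (Wsp R N) R ;
  tp_eta_cube : tp_eta (unit_cube R N) = 1%E ;
  tp_gamma : forall k, Y k -> Wsp R N -> U k ;
  tp_gamma_meas : forall k,
    measurable_fun [set: Y k * Wsp R N]
      (fun p => (tp_gamma k p.1 p.2 : borel (U k)))
}.

(** * Expected cost V(mu, g1, g2) = E[c(w0, u_1, u_2)] under the joint law
    (eta1 x eta2) x mu of (z1, z2, (w0, y1, y2)). *)
Definition game_value {R : realType} {d0} {O : measurableType d0}
  {N1 N2 : nat}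
  {dY1 : 'I_N1 -> measure_display} {Y1 : forall j, measurableType (dY1 j)}
  {dY2 : 'I_N2 -> measure_display} {Y2 : forall j, measurableType (dY2 j)}
  {U1 : 'I_N1 -> ptopologicalType} {U2 : 'I_N2 -> ptopologicalType}
  (mu : probability (O * (dprodM Y1 * dprodM Y2))%type R)
  (c : (O * (dprodM (fun j => borel (U1 j)) * dprodM (fun j => borel (U2 j))))%type -> R)
  (g1 : @team_policy R N1 dY1 Y1 U1) (g2 : @team_policy R N2 dY2 Y2 U2) : \bar R :=
  (\int[(@tp_eta R N1 dY1 Y1 U1 g1 \x @tp_eta R N2 dY2 Y2 U2 g2) \x mu]_p
     (c (p.2.1,
         ((fun k => @tp_gamma R N1 dY1 Y1 U1 g1 k (p.2.2.1 k) p.1.1) : dprodM (fun j => borel (U1 j)),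
          (fun k => @tp_gamma R N2 dY2 Y2 U2 g2 k (p.2.2.2 k) p.1.2) : dprodM (fun j => borel (U2 j)))))%:E)%E.

(* Main.v *)
Require Import Defs.
From HB Require Import structures.
From mathcomp Require Import finmap.
From mathcomp Require Import all_boot all_order all_algebra.
From mathcomp Require Import ring lra.
From mathcomp Require Import all_classical all_reals all_analysis.
From mathcomp Require Import measurable_realfun.
Import Order.TTheory GRing.Theory Num.Theory.
Import numFieldNormedType.Exports.
Local Open Scope classical_set_scope.
Local Open Scope ring_scope.

Set Implicit Arguments.
Unset Strict Implicit.
Unset Printing Implicit Defensive.

(* Pure strategies are lifted to the Cantor space, which surjects onto every
   compact metrizable action space and over which a Borel section exists.  The
   value of the game is the least payoff v that the minimizing team can
   guarantee, up to any error, against finitely many pure opponents with a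
   finite mixture of pure strategies; by the finite minimax theorem, below v the
   maximizing team has a finite mixture that is good against all pure
   strategies.  Both families of finite mixtures are then passed to the limit
   along an ultrafilter.  In the limit a team's mixture becomes a law on tuples
   of Young measures, one per player.  Such a law is encoded by countably many
   moments and realized by sampling a binary tree with the common random number
   t, in such a way that the moments converge for every t.  For each player the
   limit of the graph measures on Y x [0,1] is dominated by Q x unif, so it has a
   density there, which is sampled with a private uniform variable extracted from
   the common one.  Independence of the observations under the product measure
   identifies the limit of the joint law; absolute continuity of the team
   marginal and uniform continuity of the cost in the actions transfer it to the
   expected costs. *)

(** * Finite mixtures and a minimax alternative *)

(** The obstacle is that a limit of mixtures must again be implementable: given the common random
    number, every player has to act independently of the others on the basis of its own measurement.
    The moments of one player determine its Young measure, but a limit of averages of products is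
    not the product of the limits of the averages. The tree sampling, a hands-on Skorokhod
    representation, removes this: for each fixed [t] it follows actual strategies along one branch,
    and along a branch products of moments do converge to products.

    The two limits are taken separately, each against a fixed pure opponent. Seen from one team, the
    state and the measurements of the opponent then enter only as a bounded weight on the law of its
    own measurements, so the marginal of that team is the measure to control. The two one-sided
    limits meet at the same number [v], so the finite minimax alternative suffices and no topology
    is put on the set of strategies. *)

Section FiniteMixtures.
Context {R : realType} {S : Type}.
Implicit Types (p : seq (R * S)) (f g : S -> R).

Definition mixture p : Prop :=
  all (fun x => 0 <= x.1) p /\ \sum_(x <- p) x.1 = 1.

Definition mean p f : R := \sum_(x <- p) x.1 * f x.2.

Lemma mean_cst p (a : R) : mixture p -> mean p (fun=> a) = a.
Proof. by case=> _ p1; rewrite /mean -mulr_suml p1 mul1r. Qed.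

Lemma le_mean p f g : mixture p -> (forall s, f s <= g s) -> mean p f <= mean p g.
Proof.
case=> + _ fg; rewrite /mean; elim: p => [|x p IH]; rewrite ?big_nil ?big_cons//=.
by case/andP => x0 p0; rewrite lerD ?ler_wpM2l// IH.
Qed.

Lemma mean_sum (I : Type) (r : seq I) (P : pred I) p (f : I -> S -> R) :
  mean p (fun s => \sum_(i <- r | P i) f i s) = \sum_(i <- r | P i) mean p (f i).
Proof.
rewrite /mean exchange_big/=; apply: eq_bigr => x _.
by rewrite mulr_sumr.
Qed.

Lemma meanD p f g : mean p (fun s => f s + g s) = mean p f + mean p g.
Proof. by rewrite /mean -big_split/=; apply: eq_bigr => x _; rewrite mulrDr. Qed.

Lemma meanB p f g : mean p (fun s => f s - g s) = mean p f - mean p g.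
Proof. by rewrite /mean -sumrB; apply: eq_bigr => x _; rewrite mulrBr. Qed.

Lemma meanZ p (a : R) f : mean p (fun s => a * f s) = a * mean p f.
Proof. by rewrite /mean mulr_sumr; apply: eq_bigr => x _; rewrite mulrCA. Qed.

Lemma eq_mean p f g : f =1 g -> mean p f = mean p g.
Proof. by move=> fg; apply: eq_bigr => x _; rewrite fg. Qed.

Lemma norm_mean_le p f (M : R) : mixture p -> (forall s, `|f s| <= M) -> `|mean p f| <= M.
Proof.
move=> mp fM; rewrite ler_norml; apply/andP; split.
  by rewrite -(mean_cst (- M) mp) le_mean// => s; have := fM s; rewrite ler_norml => /andP[].
by rewrite -(mean_cst M mp) le_mean// => s; have := fM s; rewrite ler_norml => /andP[].
Qed.

Lemma mixture1 s : mixture [:: (1, s)].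
Proof. by split; rewrite /= ?ler01// big_seq1. Qed.

Lemma mean1 s f : mean [:: (1, s)] f = f s.
Proof. by rewrite /mean big_seq1 mul1r. Qed.

Definition toward (l : R) s p : seq (R * S) :=
  (l, s) :: [seq ((1 - l) * x.1, x.2) | x <- p].

Lemma mixture_toward l s p : 0 <= l <= 1 -> mixture p -> mixture (toward l s p).
Proof.
move=> /andP[l0 l1] [p0 p1]; split.
  rewrite /= l0/= all_map; move: p0; apply: sub_all => x /= x0.
  by rewrite mulr_ge0// subr_ge0.
by rewrite big_cons big_map/= -mulr_sumr p1 mulr1 addrC subrK.
Qed.

Lemma mean_toward l s p f : mean (toward l s p) f = mean p f + l * (f s - mean p f).
Proof.
rewrite /mean big_cons big_map/=.
rewrite (eq_bigr (fun x => (1 - l) * (x.1 * f x.2))); last by move=> x _; rewrite mulrA.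
by rewrite -mulr_sumr; ring.
Qed.

End FiniteMixtures.

(** Replaces a compactness argument: the payoff vectors attained by finite mixtures form a convex
    set that need not be closed, so an exact minimizer may not exist. *)
Lemma near_minimizer (R : realType) (T : Type) (P : T -> Prop) (phi : T -> R) (tau : R) :
  (exists x, P x) -> (forall x, P x -> 0 <= phi x) -> 0 < tau ->
  exists2 x, P x & forall y, P y -> phi x <= phi y + tau.
Proof.
move=> [x0 Px0] phi0 tau0.
have hi : has_inf (phi @` [set x | P x]).
  by split; [exists (phi x0), x0|exists 0 => _ [y Py <-]; exact: phi0].
have [_ [x Px <-] xlt] := inf_adherent tau0 hi.
exists x => // y Py; apply: (le_trans (ltW xlt)); rewrite lerD2r.
by apply: ge_inf; [case: hi|exists y].
Qed.

Section Minimax.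
Context {R : realType}.

Let pos (x : R) := Num.max x 0.

Let pos_ge0 x : 0 <= pos x. Proof. by rewrite /pos le_max lexx orbT. Qed.

(** The square of the positive part has derivative [2 * pos], which is 2-Lipschitz; this is the
    resulting second-order upper bound. *)
Let pos_sqD a b : pos (a + b) ^+ 2 <= pos a ^+ 2 + 2 * pos a * b + b ^+ 2.
Proof.
rewrite /pos; case: (leP (a + b) 0) => ab; case: (leP a 0) => a0; nra.
Qed.

Let posM x : pos x * x = pos x ^+ 2.
Proof. by rewrite /pos; case: (leP x 0) => x0; rewrite ?mul0r ?expr0n//= expr2. Qed.

(* If no mixture works, approximately minimize the squared distance
   [\sum_j (x_j - v)_+ ^ 2] over the convex set of attainable payoff vectors:
   first-order optimality says that the normalized vector [(x_j - v)_+] is a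
   mixture of the second player guaranteeing [v]. *)
Lemma finite_alternative (S1 S2 : Type) (s0 : S1) (J : S1 -> S2 -> R) (M : R)
    (n : nat) (b : 'I_n -> S2) (v e : R) :
  (forall s1 s2, `|J s1 s2| <= M) -> 0 < e ->
  (exists2 p : seq (R * S1), mixture p & forall j, mean p (J^~ (b j)) <= v + e) \/
  (exists2 q : seq (R * S2), mixture q & forall s1, v <= mean q (J s1)).
Proof.
move=> JM e0.
case: (pselect (exists2 p : seq (R * S1), mixture p &
  forall j, mean p (J^~ (b j)) <= v + e)) => [|nop]; [by left|right].
have far p : mixture p -> exists j, v + e < mean p (J^~ (b j)).
  move=> mp; apply: contrapT => nj; apply: nop; exists p => // j.
  by rewrite leNgt; apply/negP => vj; apply: nj; exists j.
pose x p j := mean p (J^~ (b j)).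
pose phi p := \sum_j pos (x p j - v) ^+ 2.
pose D : R := \sum_(j < n) (2 * M) ^+ 2.
have D0 : 0 <= D by apply: sumr_ge0 => j _; exact: sqr_ge0.
(* The step length [l] is also used, squared, as the slack of the near-minimization. After division
   by [l], the second-order term and the slack add up to [l * (D + 1)], at most [e ^+ 2], hence at
   most [phi p]. *)
pose l : R := Num.min 1 (e ^+ 2 / (1 + D)).
have D1 : 0 < 1 + D by rewrite ltr_wpDr.
have l0 : 0 < l by rewrite lt_min ltr01 divr_gt0// exprn_gt0.
have l1 : l <= 1 by rewrite ge_min lexx.
have lD : l * (1 + D) <= e ^+ 2 by rewrite -ler_pdivlMr// ge_min lexx orbT.
have [p mp pmin] : exists2 p, mixture p & forall p', mixture p' -> phi p <= phi p' + l ^+ 2.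
  apply: near_minimizer; last by rewrite exprn_gt0.
    by exists [:: (1, s0)]; exact: mixture1.
  by move=> p _; apply: sumr_ge0 => j _; exact: sqr_ge0.
have [j0 xj0] := far _ mp.
have phie : e ^+ 2 <= phi p.
  rewrite /phi (bigD1 j0)//= ler_wpDr//.
    by apply: sumr_ge0 => j _; exact: sqr_ge0.
  rewrite lerXn2r ?nnegrE// ?(ltW e0)// /pos le_max.
  by rewrite lerBrDl ltW.
pose Z := \sum_j pos (x p j - v).
have Z0 : 0 < Z.
  rewrite /Z (bigD1 j0)//= ltr_wpDr//; first by apply: sumr_ge0 => j _.
  rewrite /pos lt_max; apply/orP; left; rewrite subr_gt0.
  by apply: le_lt_trans xj0; rewrite lerDl ltW.
exists [seq (pos (x p j - v) / Z, b j) | j <- index_enum 'I_n].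
  split; first by rewrite all_map; apply/allP => j _ /=; rewrite divr_ge0// ltW.
  by rewrite big_map/= -mulr_suml divff// gt_eqF.
move=> s1; rewrite /mean big_map/=.
suff H : v * Z <= \sum_(j < n) pos (x p j - v) * J s1 (b j).
  under eq_bigr do rewrite mulrAC.
  by rewrite -mulr_suml ler_pdivlMr.
pose d j := J s1 (b j) - x p j.
have dM j : d j ^+ 2 <= (2 * M) ^+ 2.
  have : `|d j| <= 2 * M.
    rewrite (le_trans (ler_normB _ _))// [2]/(1 + 1) mulrDl mul1r lerD//.
    by apply: norm_mean_le => // s; exact: JM.
  by rewrite -[d j ^+ 2]real_normK ?num_real// => dj; rewrite lerXn2r// nnegrE (le_trans _ dj).
(* First-order optimality: near-minimality of [p] is tested on the mixture moved by [l] toward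
   [s1]. *)
have step : phi p <= phi p + 2 * l * (\sum_j pos (x p j - v) * d j) + l ^+ 2 * D + l ^+ 2.
  apply: (le_trans (pmin (toward l s1 p) _)).
    by apply: mixture_toward => //; rewrite (ltW l0).
  rewrite lerD2r /phi /D !mulr_sumr -!big_split/=; apply: ler_sum => j _.
  rewrite /x mean_toward -/(x p j) -/(d j) [x p j + _ - v]addrAC.
  apply: (le_trans (pos_sqD _ _)).
  rewrite exprMn lerD// ?ler_wpM2l ?sqr_ge0//.
  by rewrite le_eqVlt; apply/orP; left; apply/eqP; ring.
have dE : \sum_j pos (x p j - v) * d j =
    \sum_(j < n) pos (x p j - v) * J s1 (b j) - v * Z - phi p.
  rewrite /Z /phi mulr_sumr -!sumrB; apply: eq_bigr => j _.
  by rewrite -posM /d; ring.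
rewrite dE in step.
set W := \sum_(j < n) _ in step *.
have : 0 <= 2 * (W - v * Z - phi p) + l * (D + 1).
  rewrite -(pmulr_rge0 _ l0) -(lerD2l (phi p)) addr0; apply: (le_trans step).
  by rewrite le_eqVlt; apply/orP; left; apply/eqP; ring.
have := sqr_ge0 e; move: lD phie; clearbody W Z; lra.
Qed.

End Minimax.

(** * Limits of dominated measures along an ultrafilter *)

Lemma ultra_fmap (T U : Type) (f : T -> U) (F : set_system T) :
  UltraFilter F -> UltraFilter (f @ F).
Proof.
move=> FU; split=> [|G GP FG]; first exact: fmap_proper_filter.
rewrite eqEsubset; split=> // A GA.
have [//|FA] := in_ultra_setVsetC (f @^-1` A) FU.
have /FG GnA : (f @ F) (~` A) by [].
by have [x []] := filter_ex (filterI GA GnA).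
Qed.

Lemma bounded_ultra_cvg (R : realType) (I : Type) (F : set_system I) (f : I -> R) (M : R) :
  UltraFilter F -> (forall i, `|f i| <= M) -> cvg (f @ F).
Proof.
move=> FU fM.
have := @segment_compact R (- M) M; rewrite compact_ultra => /(_ (f @ F) (ultra_fmap f FU)).
move=> H; have [|l [_ fl]] := H; last by apply/cvg_ex; exists l.
by apply: (@filterE _ F) => i /=; rewrite in_itv/= -ler_norml.
Qed.

Lemma eq_fmap_cvg (R : realType) (I : Type) (F : set_system I) (f g : I -> R) (l : R) :
  f @ F --> l -> f =1 g -> g @ F --> l.
Proof. by move=> + /funext <-. Qed.

Section DominatedUltralimit.
Context {d} {T : measurableType d} {R : realType} {I : Type}.
Variables (F : set_system I) (FU : UltraFilter F).
Variables (mu : {finite_measure set T -> \bar R}) (m : I -> set T -> R).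
Hypothesis m_ge0 : forall i A, measurable A -> 0 <= m i A.
Hypothesis m_le : forall i A, measurable A -> m i A <= fine (mu A).
Hypothesis mU : forall i A B, measurable A -> measurable B -> A `&` B = set0 ->
  m i (A `|` B) = m i A + m i B.

Let l (A : set T) : R := lim ((fun i => m i A) @ F).

Let cvg_l A : measurable A -> (fun i => m i A) @ F --> l A.
Proof.
move=> mA; apply: (bounded_ultra_cvg (M := fine (mu A))) => i.
by rewrite ger0_norm ?m_ge0// m_le.
Qed.

Let l_ge0 A : measurable A -> 0 <= l A.
Proof.
move=> mA; apply: (cvgr_to_ge (cvg_l mA)).
by apply: filterE => i; exact: m_ge0.
Qed.

Let l_le A : measurable A -> l A <= fine (mu A).
Proof.
move=> mA; apply: (cvgr_to_le (cvg_l mA)).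
by apply: filterE => i; exact: m_le.
Qed.

Let lU A B : measurable A -> measurable B -> A `&` B = set0 -> l (A `|` B) = l A + l B.
Proof.
move=> mA mB AB; have mAB : measurable (A `|` B) by exact: measurableU.
have H := cvgD (cvg_l mA) (cvg_l mB).
apply: (cvg_unique (@Rhausdorff R) (cvg_l mAB)); apply: eq_fmap_cvg; [exact: H|move=> i].
by rewrite mU.
Qed.

(** The value 0 off the measurable sets makes nonnegativity hold for every set, as a measure
    requires. *)
Definition ultralimit (A : set T) : \bar R := if `[< measurable A >] then (l A)%:E else 0%E.

Let ulE A : measurable A -> ultralimit A = (l A)%:E.
Proof. by move=> mA; rewrite /ultralimit; case: asboolP. Qed.

Let l0 : l set0 = 0.
Proof.
have /eqP := lU measurable0 measurable0 (setI0 set0).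
by rewrite setU0 -subr_eq0 opprD addrA subrr sub0r oppr_eq0 => /eqP.
Qed.

Let ultralimit0 : ultralimit set0 = 0%E. Proof. by rewrite ulE// l0. Qed.

Let ultralimit_ge0 A : (0 <= ultralimit A)%E.
Proof. by rewrite /ultralimit; case: asboolP => // mA; rewrite lee_fin l_ge0. Qed.

(** Finite additivity survives any limit; domination gives countable additivity, because the mass of
    the tail [U] minus [V n] is at most its [mu]-mass, which tends to 0. *)
Let ultralimit_sigma_additive : semi_sigma_additive ultralimit.
Proof.
move=> B mB tB mUB.
pose V n := \big[setU/set0]_(i < n) B i.
have mV n : measurable (V n) by exact: bigsetU_measurable.
pose U := \bigcup_n B n.
have VU n : V n `<=` U by move=> x; rewrite /V -bigcup_mkord => -[k _ Bk]; exists k.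
have muV : (fun n => fine (mu (V n))) @ \oo --> fine (mu U).
  apply: fine_cvg; rewrite fineK ?fin_num_measure//.
  have := @measure_semi_sigma_additive _ _ _ mu B mB tB mUB.
  under eq_fun do rewrite big_mkord.
  move=> H; apply: cvg_trans H; apply: near_eq_cvg; apply: nearW => n.
  rewrite measure_semi_additive_ord_I//.
    exact: sub_trivIset tB.
  exact: mV.
have diff A C : measurable A -> measurable C -> A `<=` C -> l C = l A + l (C `\` A).
  move=> mA mC AC; rewrite -lU//; first by rewrite setDUK.
    exact: measurableD.
  by rewrite setDE setICA setICr setI0.
have sumE : forall n, (\sum_(0 <= i < n) ultralimit (B i) = (l (V n))%:E)%E.
  move=> n; rewrite big_mkord /V; elim: n => [|n IH]; first by rewrite !big_ord0 l0.
  rewrite !big_ord_recr/= IH ulE// lU//.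
    exact: bigsetU_measurable.
  rewrite -subset0 => x []; rewrite -bigcup_mkord => -[k /= kn Bk] Bn.
  have /trivIsetP/(_ k n Logic.I Logic.I) := tB.
  have kn' : k != n by rewrite neq_ltn kn.
  by move=> /(_ kn') H; have : (B k `&` B n) x by []; rewrite H.
under eq_fun do rewrite sumE.
rewrite ulE//; apply: cvg_EFin; first exact: nearW.
apply: (squeeze_cvgr (f := fun n => l U - (fine (mu U) - fine (mu (V n)))) (h := fun=> l U)).
- apply: nearW => n; have mUV : measurable (U `\` V n) by exact: measurableD.
  rewrite (diff _ _ (mV n) mUB (VU n)) lerDl l_ge0// andbT.
  rewrite lerBlDr lerD2l (le_trans (l_le mUV))// -fineB ?fin_num_measure//.
  rewrite fine_le ?fin_num_measure ?fin_numB ?fin_num_measure//.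
  rewrite measureD// ?setIidr//; first by rewrite -ge0_fin_numE ?fin_num_measure.
- rewrite -[X in _ --> X]subr0; apply: cvgB; first exact: cvg_cst.
  rewrite -(subrr (fine (mu U))); apply: cvgB => //; exact: cvg_cst.
- exact: cvg_cst.
Qed.

HB.instance Definition _ := isMeasure.Build d T R ultralimit
  ultralimit0 ultralimit_ge0 ultralimit_sigma_additive.

Let ultralimit_fin : fin_num_fun ultralimit.
Proof. by move=> A mA; rewrite ulE. Qed.

HB.instance Definition _ := @Measure_isFinite.Build d T R ultralimit ultralimit_fin.

Lemma dominated_ultralimit : exists L : {finite_measure set T -> \bar R},
  forall A, measurable A ->
    (fun i => m i A) @ F --> fine (L A) /\ (L A <= mu A)%E.
Proof.
exists ultralimit => A mA; rewrite /= ulE//=; split; first exact: cvg_l.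
by rewrite -[mu A]fineK ?fin_num_measure// lee_fin l_le.
Qed.

End DominatedUltralimit.

(** * The Cantor space *)

Section DependentProducts.
Context {I : Type} {dY : I -> measure_display} {Y : forall i, measurableType (dY i)}.

Lemma measurable_dproj i : measurable_fun [set: dprodM Y] (fun y : dprodM Y => y i).
Proof.
move=> _ A mA; rewrite setTI; apply: sub_sigma_algebra.
by exists i, A.
Qed.

Lemma measurable_fun_dprod d (T : measurableType d) (f : T -> dprodM Y) :
  (forall i, measurable_fun [set: T] (fun x => f x i)) -> measurable_fun [set: T] f.
Proof.
move=> mf; apply: (@measurability _ _ _ _ _ _ (dprod_cyl Y)) => //.
move=> _ [_ [i [A [mA ->]]] <-].
by apply: mf.
Qed.

End DependentProducts.

Definition image_measure {d1 d2} {T1 : measurableType d1} {T2 : measurableType d2}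
  {R : realType} (m : {measure set T1 -> \bar R}) (f : T1 -> T2)
  (mf : measurable_fun [set: T1] f) : {measure set T2 -> \bar R} :=
  measure_function_pushforward__canonical__measure_function_Measure m mf.

Notation cantor := (dprodM (fun _ : nat => (bool : measurableType _))).

Section Words.

(** Words carry their latest bit at the head, so the children of a node [w] of the binary tree are
    [false :: w] and [true :: w]. [extend] reads a word back in the opposite order and pads it with
    [false]. *)
Fixpoint prefix (x : nat -> bool) (n : nat) : seq bool :=
  if n is m.+1 then x m :: prefix x m else [::].

Definition extend (w : seq bool) : cantor := fun i => nth false (rev w) i.

Lemma size_prefix x n : size (prefix x n) = n.
Proof. by elim: n => //= n ->. Qed.

Lemma eq_prefix x y n : (forall i, (i < n)%N -> x i = y i) -> prefix x n = prefix y n.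
Proof.
elim: n => //= n IH xy; rewrite xy// IH// => i iltn; apply: xy.
exact: ltnW.
Qed.

Lemma prefix_eq x y n : prefix x n = prefix y n -> forall i, (i < n)%N -> x i = y i.
Proof.
elim: n => //= n IH [xyn /IH xy] i; rewrite ltnS leq_eqVlt => /orP[/eqP->//|].
exact: xy.
Qed.

Lemma prefix_le x y m n : (m <= n)%N -> prefix x n = prefix y n -> prefix x m = prefix y m.
Proof.
move=> mn /prefix_eq xy; apply: eq_prefix => i im; apply: xy.
exact: leq_trans mn.
Qed.

Lemma prefix_extend w : prefix (extend w) (size w) = w.
Proof.
elim: w => //= b w IH; rewrite {1}/extend/= nth_rev//= subSS subnn/=; congr cons.
rewrite -[RHS]IH; apply: eq_prefix => i iw.
by rewrite /extend rev_cons nth_rcons size_rev iw.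
Qed.

Lemma extend_prefix x n i : (i < n)%N -> extend (prefix x n) i = x i.
Proof.
by have := prefix_extend (prefix x n); rewrite size_prefix => /prefix_eq; apply.
Qed.

Definition cylinder (w : seq bool) : set cantor := [set x | prefix x (size w) = w].

Lemma cylinder0 : cylinder [::] = setT.
Proof. by apply/seteqP; split. Qed.

Lemma cylinder_cons w : cylinder w = cylinder (false :: w) `|` cylinder (true :: w).
Proof.
apply/seteqP; split=> x; rewrite /cylinder/=; last by case=> -[].
by case: (x (size w)) => ->; [right|left].
Qed.

Lemma cylinder_cons0 w : cylinder (false :: w) `&` cylinder (true :: w) = set0.
Proof.
by apply/seteqP; split=> // x [] [xw _]; rewrite /cylinder/= xw.
Qed.

Lemma measurable_cylinder w : measurable (cylinder w).
Proof.
elim: w => [|b w IH]; first by rewrite cylinder0.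
rewrite (_ : cylinder _ = (fun x : cantor => x (size w)) @^-1` [set b] `&` cylinder w).
  by apply: measurableI => //; rewrite -[X in measurable X]setTI; exact: measurable_dproj.
by apply/seteqP; split=> x; rewrite /cylinder/= => -[-> ->].
Qed.

(** Two nodes of the tree are comparable or have disjoint subtrees. Together with the empty set the
    cylinders thus form a pi-system, which is what [cantor_measure_unique] rests on. *)
Lemma cylinderI w w' : cylinder w `&` cylinder w' = set0 \/
  exists v, cylinder w `&` cylinder w' = cylinder v.
Proof.
wlog ww : w w' / (size w <= size w')%N.
  move=> H; have [/H//|/ltnW /H] := leqP (size w) (size w').
  by rewrite setIC.
have [E|nE] := pselect (prefix (extend w') (size w) = w).
  right; exists w'; apply/seteqP; split=> [x []//|x xw']; split=> //.
  rewrite /cylinder/= -[RHS]E; apply: prefix_le ww _.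
  by rewrite xw' prefix_extend.
left; apply/seteqP; split=> // x [xw xw']; apply: nE.
by rewrite -[RHS]xw; apply: prefix_le ww _; rewrite xw' prefix_extend.
Qed.

Lemma measurable_cantorE :
  @measurable _ cantor = <<s [set A | A = set0 \/ exists w, A = cylinder w] >>.
Proof.
apply/seteqP; split=> A.
  apply: smallest_sub; first exact: smallest_sigma_algebra.
  move=> _ [i [B [_ ->]]].
  have tr (b : bool) : <<s [set A | A = set0 \/ exists w, A = cylinder w] >>
      ((fun x : cantor => x i) @^-1` [set b]).
    (* Coordinate [i] equals [b] exactly on the union of the cylinders [b :: w] with [w] of size
       [i]; an injection of words into [nat] turns it into a countable union. *)
    rewrite (_ : _ @^-1` _ = \bigcup_w (if size w == i then cylinder (b :: w) else set0)).
      have [f injf] : exists f : seq bool -> nat, injective f.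
        by exists pickle; exact: pcan_inj pickleK.
      rewrite (_ : \bigcup_w _ = \bigcup_n \bigcup_(w in [set w | f w = n])
          (if size w == i then cylinder (b :: w) else set0)); last first.
        by apply/seteqP; split=> [x [w _ xw]|x [n _ [w _ xw]]]; [exists (f w) => //; exists w|exists w].
      apply: sigma_algebra_bigcup => n.
      have [[w wn]|nw] := pselect (exists w, f w = n); last first.
        rewrite bigcup0; first exact: sigma_algebra0.
        by move=> w /= wn; exfalso; apply: nw; exists w.
      rewrite (_ : [set _ | _] = [set w]) ?bigcup_set1; last first.
        by apply/seteqP; split=> [v /=|v ->//]; rewrite -wn => /injf.
      by apply: sub_sigma_algebra; case: ifP => _; [right; exists (b :: w)|left].
    apply/seteqP; split=> [x /= xi|x [w _]].
      by exists (prefix x i) => //; rewrite size_prefix eqxx /cylinder/= size_prefix xi.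
    by case: ifP => // /eqP wi; rewrite /cylinder/= wi => -[].
  rewrite (_ : _ @^-1` B =
    (if `[< B true >] then (fun x : cantor => x i) @^-1` [set true] else set0) `|`
    (if `[< B false >] then (fun x : cantor => x i) @^-1` [set false] else set0)).
    apply: (@measurableU _ (g_sigma_algebraType
      [set A : set cantor | A = set0 \/ exists w, A = cylinder w])); case: asboolP => _; by [exact: tr|exact: sigma_algebra0].
  apply/seteqP; split=> x /=.
    by case E : (x i) => xB; [left|right]; case: asboolP.
  by case; case: asboolP => //= + ->.
apply: smallest_sub; first exact: sigma_algebra_measurable.
by move=> _ [->|[w ->]]; [exact: measurable0|exact: measurable_cylinder].
Qed.

Lemma cantor_measure_unique (R : realType) (m1 m2 : {measure set cantor -> \bar R}) :
  (m1 setT < +oo)%E -> (forall w, m1 (cylinder w) = m2 (cylinder w)) ->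
  forall A, measurable A -> m1 A = m2 A.
Proof.
move=> moo m12 A mA.
apply: (measure_unique _ (fun=> setT) measurable_cantorE) => //.
- move=> _ _ [->|[w ->]] [->|[w' ->]]; rewrite ?set0I ?setI0; try by left.
  by have [->|[v ->]] := cylinderI w w'; [left|right; exists v].
- by move=> _; right; exists [::]; rewrite cylinder0.
- by rewrite bigcup_const.
- by move=> _ [->|[w ->//]]; rewrite !measure0.
Qed.

Lemma measurable_prefix d (T : measurableType d) (f : T -> cantor) n w :
  measurable_fun [set: T] f -> measurable [set x | prefix (f x) n = w].
Proof.
move=> mf; have [wn|wn] := eqVneq (size w) n.
  by have := mf measurableT _ (measurable_cylinder w); rewrite setTI -wn.
rewrite (_ : [set _ | _] = set0)//; apply/seteqP; split=> // x /= xw.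
by move: wn; rewrite -xw size_prefix eqxx.
Qed.

End Words.

(** * Sampling a binary tree *)

Section Uniform.
Context (R : realType).

(* The library's uniform law lives on [measurableTypeR R], whose display differs
   from that of [R]; both carry the same measurable sets. *)
Definition unif : set R -> \bar R := @uniform_prob R 0 1 ltr01.

HB.instance Definition _ := isMeasure.Build _ R R unif
  (@measure0 _ _ _ (uniform_prob ltr01)) (@measure_ge0 _ _ _ (uniform_prob ltr01))
  (@measure_semi_sigma_additive _ _ _ (uniform_prob ltr01)).

HB.instance Definition _ := @Measure_isProbability.Build _ R R unif
  (@probability_setT _ _ _ (uniform_prob ltr01)).

Lemma unifE (A : set R) : measurable A -> unif A = lebesgue_measure (A `&` `[0, 1]).
Proof.
move=> mA; rewrite /unif /uniform_prob integral_uniform_pdf.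
rewrite (eq_integral (cst 1%E)); last first.
  move=> x /set_mem[_ /=]; rewrite in_itv/= => x01.
  by rewrite /uniform_pdf x01 subr0 invr1.
by rewrite integral_cst ?mul1e//; exact: measurableI.
Qed.

Lemma unif_itv (a b : R) : 0 <= a -> a <= b -> b <= 1 -> unif `[a, b[ = (b - a)%:E.
Proof.
move=> a0 ab b1; rewrite unifE//.
rewrite (_ : _ `&` _ = `[a, b[%classic); last first.
  apply/seteqP; split=> x /=; rewrite !in_itv/=; first by case.
  by move=> /andP[ax xb]; rewrite ax xb (le_trans a0 ax) (le_trans (ltW xb) b1).
rewrite lebesgue_measure_itv/= lte_fin; case: ltP => // ba.
have -> : b = a by apply/eqP; rewrite eq_le ba ab.
by rewrite subrr.
Qed.

(** The sampling intervals are half-open while [unif] is carried by the closed unit interval; this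
    discards the null endpoint. *)
Lemma unif_setI01 (A : set R) : measurable A -> unif A = unif (A `&` `[0, 1[).
Proof.
move=> mA; rewrite -(setUIDK A `[0, 1[%classic) measureU//=.
- rewrite setUIDK setIC; suff -> : unif (A `\` `[0, 1[) = 0%E by rewrite adde0 setIC.
  apply/eqP; rewrite -measure_le0.
  have /= U01 : unif `[0, 1[ = 1%E by rewrite unif_itv// subr0.
  apply: (@le_trans _ _ (unif (~` `[0, 1[))).
    apply: le_measure.
    - by rewrite inE; exact: measurableD.
    - by rewrite inE; exact: measurableC.
    - by move=> x [].
  have := @probability_setC _ _ _ (unif : probability R R) `[0, 1[%classic (measurable_itv _).
  by rewrite /= U01 subee// => ->.
- exact: measurableI.
- exact: measurableD.
- by rewrite setDE setIACA setICr setI0.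
Qed.

End Uniform.

Arguments unif {R}.

Section TreeSampling.
Context {R : realType}.
Implicit Types (q : seq bool -> R) (w : seq bool).

Definition tree_mass q :=
  [/\ q [::] = 1, forall w, 0 <= q w & forall w, q w = q (false :: w) + q (true :: w)].

(** Each node receives an interval of length [q w], the children splitting that of their parent from
    left to right; this is its left endpoint. [sample q t] follows the nodes whose intervals contain
    [t], an inverse distribution function for the lexicographic order. *)
Fixpoint leftpt q w : R :=
  if w is b :: w' then if b then leftpt q w' + q (false :: w') else leftpt q w' else 0.

Fixpoint sample_path q (t : R) n : seq bool :=
  if n is m.+1 then
    let w := sample_path q t m in (leftpt q w + q (false :: w) <= t) :: w
  else [::].

Definition sample q t : cantor := fun n => head false (sample_path q t n.+1).

Lemma prefix_sample q t n : prefix (sample q t) n = sample_path q t n.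
Proof. by elim: n => //= n ->. Qed.

Lemma leftpt_ge0 q w : tree_mass q -> 0 <= leftpt q w.
Proof. by case=> _ q0 _; elim: w => //= -[] w IH //; rewrite addr_ge0. Qed.

Lemma leftpt_le1 q w : tree_mass q -> leftpt q w + q w <= 1.
Proof.
case=> q1 q0 qD; elim: w => /= [|b w]; first by rewrite add0r q1.
rewrite qD addrA; case: b => // H; apply: le_trans H.
by rewrite lerDl.
Qed.

Lemma prefix_sampleP q t w : tree_mass q -> 0 <= t < 1 ->
  (prefix (sample q t) (size w) == w) = (leftpt q w <= t < leftpt q w + q w).
Proof.
move=> [q1 q0 qD] /andP[t0 t1]; rewrite prefix_sample; elim: w => /= [|b w IH].
  by rewrite eqxx t0 add0r q1 t1.
rewrite eqseq_cons; have [E|E] := eqVneq (sample_path q t (size w)) w; last first.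
  rewrite andbF; apply/esym/negbTE; apply/negP => /andP[bt tb].
  move: IH; rewrite (negbTE E) => /esym/negP; apply; apply/andP.
  case: b bt tb => bt tb; rewrite qD addrA.
    by rewrite tb (le_trans _ bt)// lerDl.
  by rewrite bt (lt_le_trans tb)// lerDl.
move: IH; rewrite E eqxx => /esym/andP[wt tw]; rewrite andbT.
case: b; rewrite ?eqb_id.
  by move: tw; rewrite qD addrA => ->; rewrite andbT.
by rewrite eqbF_neg -ltNge wt.
Qed.

Section Measurability.
Context {d} {T : measurableType d} (q : T -> seq bool -> R).
Hypothesis mq : forall w, measurable_fun [set: T] (fun x => q x w).

Lemma measurable_leftpt w : measurable_fun [set: T] (fun x => leftpt (q x) w).
Proof.
elim: w => [|[] w IH]; [exact: measurable_cst| |exact: IH].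
exact: measurable_funD.
Qed.

Lemma measurable_sample_path n w :
  measurable [set p : T * R | sample_path (q p.1) p.2 n = w].
Proof.
elim: n w => [|n IH] w /=.
  case: w => [|b w]; first by rewrite (_ : [set _ | _] = setT)//; apply/seteqP; split.
  by rewrite (_ : [set _ | _] = set0)//; apply/seteqP; split.
case: w => [|b w]; first by rewrite (_ : [set _ | _] = set0)//; apply/seteqP; split.
rewrite (_ : [set _ | _] = [set p : T * R | sample_path (q p.1) p.2 n = w] `&`
  (fun p : T * R => leftpt (q p.1) w + q p.1 (false :: w) <= p.2) @^-1` [set b]).
  apply: measurableI => //; rewrite -[X in measurable X]setTI.
  have /= H : measurable_fun [set: T * R]
      (fun p : T * R => leftpt (q p.1) w + q p.1 (false :: w) <= p.2).
    apply: measurable_fun_ler; last exact: measurable_snd.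
    apply: measurable_funD.
      exact: (measurableT_comp (measurable_leftpt w) measurable_fst).
    exact: (measurableT_comp (mq _) measurable_fst).
  exact: H.
by apply/seteqP; split=> p /=; [case=> + pw; rewrite pw|case=> -> ->].
Qed.

(** Measurability holds jointly in the parameter and the random number because a finite path is
    decided by finitely many comparisons. This is what turns a kernel into a measurable randomized
    strategy. *)
Lemma measurable_sample :
  measurable_fun [set: T * R] (fun p : T * R => sample (q p.1) p.2).
Proof.
apply: measurable_fun_dprod => n; apply: (measurable_fun_bool true).
rewrite setTI (_ : _ @^-1` _ =
  \bigcup_w [set p : T * R | sample_path (q p.1) p.2 n.+1 = true :: w]); last first.
  apply/seteqP; split=> [p /= pn|p [w _ /=]].
    exists (sample_path (q p.1) p.2 n) => //=; rewrite -pn.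
    by rewrite /sample/=.
  by rewrite /sample /= => -[-> _].
apply: countable_bigcupT_measurable => [|w]; first exact: countableP.
exact: measurable_sample_path.
Qed.

End Measurability.

Lemma measurable_sample1 q : measurable_fun [set: R] (sample q).
Proof.
have H := @measurable_sample _ R (fun=> q) (fun w => measurable_cst _).
exact: (measurableT_comp H (measurable_fun_pair (measurable_cst (0 : R)) (@measurable_id _ R setT))).
Qed.

Lemma unif_sample q w : tree_mass q ->
  unif [set t | prefix (sample q t) (size w) = w] = (q w)%:E.
Proof.
move=> tq; rewrite unif_setI01; last first.
  exact: (measurable_prefix _ _ (measurable_sample1 q)).
rewrite (_ : _ `&` _ = `[leftpt q w, leftpt q w + q w[%classic).
  have [_ q0 _] := tq.
  by rewrite unif_itv ?leftpt_ge0 ?leftpt_le1 ?lerDl// addrAC subrr add0r.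
apply/seteqP; split=> t /=; rewrite !in_itv/=.
  by case=> /eqP + t01; rewrite prefix_sampleP.
move=> /andP[lt tl].
have t01 : 0 <= t < 1.
  by rewrite (le_trans (leftpt_ge0 w tq) lt) (lt_le_trans tl (leftpt_le1 w tq)).
by split=> //; apply/eqP; rewrite prefix_sampleP// lt tl.
Qed.

(** The masses of the cylinders under the law of [X] satisfy the tree relations; sampling them
    reproduces this law on a pi-system, hence everywhere. *)
Lemma realize_cantor d (T : measurableType d) (P : probability T R) (X : T -> cantor) :
  measurable_fun [set: T] X ->
  exists2 Z : R -> cantor, measurable_fun [set: R] Z &
    forall A, measurable A -> unif (Z @^-1` A) = P (X @^-1` A).
Proof.
move=> mX; pose q w := fine (P (X @^-1` cylinder w)).
have mXw w : measurable (X @^-1` cylinder w).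
  by rewrite -[X in measurable X]setTI; apply: mX => //; exact: measurable_cylinder.
have tq : tree_mass q.
  split=> [|w|w]; first by rewrite /q cylinder0 preimage_setT probability_setT.
    by rewrite /q fine_ge0.
  rewrite /q cylinder_cons preimage_setU measureU ?fineD ?fin_num_measure//.
  by rewrite -preimage_setI cylinder_cons0 preimage_set0.
exists (sample q); first exact: measurable_sample1.
move=> A mA.
apply: (@cantor_measure_unique _ (image_measure (unif) (measurable_sample1 q))
  (image_measure P mX)) => //.
  by rewrite /= /pushforward preimage_setT probability_setT ltry.
move=> w; rewrite /= /pushforward -[LHS]/(unif [set t | prefix (sample q t) (size w) = w]).
by rewrite unif_sample// /q fineK// fin_num_measure.
Qed.

End TreeSampling.

(** * Independent uniform variables *)

Lemma emeasurable_prod d (T : measurableType d) (R : realType) (I : Type) (s : seq I)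
    (P : pred I) (f : I -> T -> \bar R) :
  (forall i, measurable_fun [set: T] (f i)) ->
  measurable_fun [set: T] (fun x => \prod_(i <- s | P i) f i x)%E.
Proof.
move=> mf; elim: s => [|i s IH].
  by under eq_fun do rewrite big_nil; exact: measurable_cst.
under eq_fun do rewrite big_cons; case: (P i) => //.
exact: emeasurable_funM.
Qed.

Section IndependentUniforms.
Context {R : realType}.

(** [rho] enumerates the rationals. [code] interleaves the upper Dedekind cuts of the two components
    over even and odd coordinates, and [decode] recovers each real as the infimum of its cut, so a
    pair of reals passes measurably through the Cantor space and back. *)
Let rho (i : nat) : R := ratr (odflt 0 (unpickle i)).

Let code (p : R * R) : cantor :=
  fun n => if odd n then p.2 < rho n./2 else p.1 < rho n./2.

Let measurable_code : measurable_fun [set: R * R] code.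
Proof.
apply: measurable_fun_dprod => n; rewrite /code; case: (odd n).
- by apply: measurable_fun_ltr => //; exact: measurable_snd.
- by apply: measurable_fun_ltr => //; exact: measurable_fst.
Qed.

Let decode (b : bool) (x : cantor) : R :=
  fine (einfs (fun i => if x (b + i.*2)%N then (rho i)%:E else +oo%E) 0%N).

Let measurable_decode b : measurable_fun [set: cantor] (decode b).
Proof.
apply: (measurableT_comp (@fine_measurable _ setT measurableT)).
apply: measurable_fun_einfs => i; apply: measurable_fun_ifT; try exact: measurable_cst.
exact: measurable_dproj.
Qed.

Let inf_rho (x : R) : einfs (fun i => if x < rho i then (rho i)%:E else +oo%E) 0%N = x%:E.
Proof.
rewrite /einfs; apply/eqP; rewrite eq_le; apply/andP; split; last first.
  apply: le_ereal_inf_tmp => _ [i _ <-]; case: ifP => [xi|_]; last exact: leey.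
  by rewrite lee_fin ltW.
apply/lee_addgt0Pr => e e0.
have [q] := rat_in_itvoo (ltr_pwDr e0 (lexx x)).
rewrite in_itv/= => /andP[xq qe].
apply: (@le_trans _ _ (ratr q)%:E); last by rewrite -EFinD lee_fin ltW.
apply: ereal_inf_lbound; exists (pickle q) => //.
by rewrite /rho pickleK/= xq.
Qed.

Let codeK p : (decode false (code p), decode true (code p)) = p.
Proof.
case: p => x y; rewrite /decode/code; congr pair.
  transitivity (fine (einfs (fun i => if x < rho i then (rho i)%:E else +oo%E) 0%N)).
    by congr (fine (einfs _ _)); apply/funext => i; rewrite add0n odd_double doubleK.
  by rewrite inf_rho.
transitivity (fine (einfs (fun i => if y < rho i then (rho i)%:E else +oo%E) 0%N)).
  by congr (fine (einfs _ _)); apply/funext => i; rewrite /= odd_double uphalf_double.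
by rewrite inf_rho.
Qed.

Lemma split_uniform : exists2 phi : R -> R * R, measurable_fun [set: R] phi &
  forall A, measurable A -> unif (phi @^-1` A) = (unif \x unif)%E A.
Proof.
have [Z mZ Zlaw] := realize_cantor (unif \x unif)%E measurable_code.
have mdec : measurable_fun [set: cantor] (fun x => (decode false x, decode true x)).
  by apply: measurable_fun_pair; exact: measurable_decode.
exists (fun t => (decode false (Z t), decode true (Z t))).
  exact: (measurableT_comp mdec mZ).
move=> A mA; have := mdec measurableT _ mA; rewrite setTI => /Zlaw H.
have AE : code @^-1` ((fun x => (decode false x, decode true x)) @^-1` A) = A.
  by apply/seteqP; split=> p /=; rewrite codeK.
by rewrite AE in H; exact: H.
Qed.

(** Iterating the splitting map strips off one uniform variable [xi k] at a time, and after [N]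
    turns the remainder [tau N] is still uniform and independent of them. Independence is stated in
    the form used later: given the common number, the integral of a product over the players
    factorizes. *)
Lemma independent_uniforms : exists (tau : nat -> R -> R) (xi : nat -> R -> R),
  [/\ forall N, measurable_fun [set: R] (tau N),
      forall k, measurable_fun [set: R] (xi k) &
      forall N (g : nat -> R -> R -> \bar R),
        (forall k t x, 0 <= g k t x)%E ->
        (forall k, measurable_fun [set: R * R] (fun p => g k p.1 p.2)) ->
        (\int[unif]_z \prod_(k < N) g k (tau N z) (xi k z) =
         \int[unif]_t \prod_(k < N) \int[unif]_x g k t x)%E].
Proof.
have [phi mphi philaw] := split_uniform.
pose next z := (phi z).2.
pose tau N z := iter N next z.
pose xi k z := (phi (iter k next z)).1.
have tauS N z : tau N.+1 z = tau N (phi z).2 by rewrite /tau iterSr.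
have xiS k z : xi k.+1 z = xi k (phi z).2 by rewrite /xi iterSr.
have mnext : measurable_fun [set: R] next by exact: (measurableT_comp measurable_snd mphi).
have mtau N : measurable_fun [set: R] (tau N).
  by elim: N => [|N IH]; [exact: measurable_id|exact: (measurableT_comp mnext IH)].
have mxi k : measurable_fun [set: R] (xi k).
  by apply: (measurableT_comp measurable_fst); exact: (measurableT_comp mphi (mtau k)).
have int_phi (f : R * R -> \bar R) : (forall p, 0 <= f p)%E -> measurable_fun setT f ->
    (\int[unif]_z f (phi z) = \int[unif]_y \int[unif]_x f (x, y))%E.
  move=> f0 mf; rewrite -fubini_tonelli// -fubini_tonelli1//.
  transitivity (\int[image_measure unif mphi]_p f p)%E.
    by rewrite ge0_integral_pushforward.
  by apply: eq_measure_integral => A mA _; exact: philaw.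
exists tau, xi; split=> // N g g0 mg.
(* The weight [h] of the remainder makes the induction go through: each step integrates out the
   first private variable and absorbs the result into the weight. *)
suff H : forall (h : R -> \bar R), (forall t, 0 <= h t)%E -> measurable_fun setT h ->
    (\int[unif]_z (h (tau N z) * \prod_(k < N) g k (tau N z) (xi k z)) =
     \int[unif]_t (h t * \prod_(k < N) \int[unif]_x g k t x))%E.
  have := H (cst 1%E) (fun=> lee01) (measurable_cst _).
  by under eq_integral do rewrite mul1e; under [in RHS]eq_integral do rewrite mul1e.
elim: N g g0 mg => [|N IH] g g0 mg h h0 mh.
  by under eq_integral do rewrite big_ord0; under [in RHS]eq_integral do rewrite big_ord0.
have mG k : measurable_fun [set: R] (fun t => \int[unif]_x g k t x)%E.
  exact: (measurable_fun_fubini_tonelli_F (m2 := unif) _ (mg k)).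
pose h' t := (h t * \int[unif]_x g 0%N t x)%E.
have h'0 t : (0 <= h' t)%E by rewrite mule_ge0// integral_ge0.
have mh' : measurable_fun setT h' by exact: emeasurable_funM.
transitivity (\int[unif]_y (h' (tau N y) *
    \prod_(k < N) g k.+1 (tau N y) (xi k y)))%E; last first.
  rewrite (IH (fun k => g k.+1))//.
  by apply: eq_integral => t _; rewrite /h' big_ord_recl/= muleA.
pose f p := (h (tau N p.2) * (g 0%N (tau N p.2) p.1 *
    \prod_(k < N) g k.+1 (tau N p.2) (xi k p.2)))%E.
have mgt k : measurable_fun [set: R * R] (fun p : R * R => g k (tau N p.2) p.1).
  exact: (measurableT_comp (mg k) (measurable_fun_pair
    (measurableT_comp (mtau N) (@measurable_snd _ _ R R)) measurable_fst)).
have mprod : measurable_fun [set: R]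
    (fun y => \prod_(k < N) g k.+1 (tau N y) (xi k y))%E.
  apply: emeasurable_prod => k.
  exact: (measurableT_comp (mg k.+1) (measurable_fun_pair (mtau N) (mxi k))).
have prod0 y : (0 <= \prod_(k < N) g k.+1 (tau N y) (xi k y))%E by exact: prode_ge0.
transitivity (\int[unif]_z f (phi z))%E.
  apply: eq_integral => z _; rewrite big_ord_recl tauS /f.
  congr (_ * (_ * _))%E; apply: eq_bigr => k _.
  by rewrite lift0 xiS.
rewrite int_phi//; last 2 first.
- by move=> p; rewrite /f !mule_ge0.
- apply: emeasurable_funM.
    by apply: (measurableT_comp mh); exact: (measurableT_comp (mtau N) measurable_snd).
  by apply: emeasurable_funM => //; exact: (measurableT_comp mprod measurable_snd).
apply: eq_integral => y _; rewrite /f/= /h'.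
have mg0 : measurable_fun [set: R] (fun x => g 0%N (tau N y) x).
  exact: (measurableT_comp (mg 0%N) (measurable_fun_pair (measurable_cst _) (@measurable_id _ R setT))).
rewrite ge0_integralZl//.
- by rewrite ge0_integralZr// muleA.
- by apply: emeasurable_funM.
- by move=> x _; rewrite mule_ge0.
Qed.

End IndependentUniforms.

(** * Convergent realizations of mixtures *)

Section BoundedIntegrals.
Context {d} {T : measurableType d} {R : realType} {P : {finite_measure set T -> \bar R}}.
Implicit Types (f g : T -> R) (M e : R).

Lemma bounded_integrable f M : measurable_fun setT f -> (forall x, `|f x| <= M) ->
  P.-integrable setT (EFin \o f).
Proof.
move=> mf fM; apply: measurable_bounded_integrable => //.
  by rewrite ltey_eq fin_num_measure.
by exists M; split=> [|x Mx y _]; [exact: num_real|exact: le_trans (fM _) (ltW Mx)].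
Qed.

Lemma integral_EFin f M : measurable_fun setT f -> (forall x, `|f x| <= M) ->
  (\int[P]_x (f x)%:E)%E = (\int[P]_x f x)%:E.
Proof. by move=> mf fM; rewrite fineK//; exact/integrable_fin_num/bounded_integrable/fM. Qed.

Lemma norm_Rintegral_le f M : measurable_fun setT f -> (forall x, `|f x| <= M) ->
  `|\int[P]_x f x| <= M * fine (P setT).
Proof.
move=> mf fM; have intf := bounded_integrable mf fM.
apply: (le_trans (le_normr_Rintegral _ intf)) => //.
rewrite -Rintegral_cst//; apply: le_Rintegral => //.
  by apply: (bounded_integrable (M := M)) => [|x]; [exact: measurableT_comp|rewrite normr_id].
by apply: (bounded_integrable (M := `|M|)).
Qed.

Lemma dist_Rintegral_le f g Mf Mg e : measurable_fun setT f -> measurable_fun setT g ->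
  (forall x, `|f x| <= Mf) -> (forall x, `|g x| <= Mg) -> (forall x, `|f x - g x| <= e) ->
  `|\int[P]_x f x - \int[P]_x g x| <= e * fine (P setT).
Proof.
move=> mf mg fM gM fge.
rewrite -RintegralB//; [|exact: bounded_integrable fM|exact: bounded_integrable gM].
by apply: norm_Rintegral_le => //; exact: measurable_funB.
Qed.

Lemma Rintegral_sum (I : Type) (s : seq I) (f : I -> T -> R) (M : I -> R) :
  (forall i, measurable_fun setT (f i)) -> (forall i x, `|f i x| <= M i) ->
  \int[P]_x (\sum_(i <- s) f i x) = \sum_(i <- s) \int[P]_x f i x.
Proof.
move=> mf fM.
have bnd t x : `|\sum_(i <- t) f i x| <= \sum_(i <- t) M i.
  by apply: (le_trans (ler_norm_sum _ _ _)); apply: ler_sum => i _.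
have msum t : measurable_fun setT (fun x => \sum_(i <- t) f i x).
  elim: t => [|i t IH]; first by under eq_fun do rewrite big_nil; exact: measurable_cst.
  by under eq_fun do rewrite big_cons; exact: measurable_funD.
elim: s => [|i s IH].
  by under eq_Rintegral do rewrite big_nil; rewrite big_nil Rintegral_cst// mul0r.
under eq_Rintegral do rewrite big_cons.
rewrite big_cons -IH RintegralD//.
  exact: bounded_integrable (fM i).
exact: bounded_integrable (bnd s).
Qed.

Lemma Rintegral_bool (A : T -> bool) : measurable [set x | A x] ->
  \int[P]_x ((A x)%:R : R) = fine (P [set x | A x]).
Proof.
move=> mA; rewrite -[RHS]mul1r -Rintegral_cst// [in RHS]Rintegral_mkcond.
apply: eq_Rintegral => x _; rewrite patchE.
by case: ifP => [/set_mem/= ->//|/negP Ax]; case E : (A x) => //; exfalso; apply: Ax; rewrite inE.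
Qed.

Lemma measurable_fun_nat_of_bool (A : T -> bool) : measurable [set x | A x] ->
  measurable_fun setT (fun x => (A x)%:R : R).
Proof.
move=> mA; have -> : (fun x => (A x)%:R : R) = \1_[set x | A x].
  by apply/funext => x; rewrite indicE; congr (nat_of_bool _)%:R; apply/idP/idP; rewrite inE.
exact: measurable_indic.
Qed.

End BoundedIntegrals.

Lemma sum_prefix (R : realType) n (x : nat -> bool) (g : seq bool -> R) :
  \sum_(w : n.-tuple bool) g w * (prefix x n == w)%:R = g (prefix x n).
Proof.
have sx : size (prefix x n) == n by rewrite size_prefix.
rewrite (bigD1 (Tuple sx))//= eqxx mulr1 big1 ?addr0// => w wx.
by rewrite -[_ == _]/(val (Tuple sx) == val w) val_eqE eq_sym (negbTE wx) mulr0.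
Qed.

Section TreeLimit.
Context {R : realType} {S : Type} (s0 : S) {J : countType} (f : J -> S -> R).
Hypothesis f01 : forall i s, 0 <= f i s <= 1.
Context {I : Type} (F : set_system I) (FU : UltraFilter F) (p : I -> seq (R * S)).
Hypothesis mp : forall i, mixture (p i).

(** Bit [(i, a, b)] records whether feature [i] lies below the rational [a / (b + 1)], so proximity
    of all features becomes agreement on prefixes. *)
Let code (s : S) : nat -> bool := fun n =>
  if unpickle n is Some (i, a, b) then f i s < (a : nat)%:R / (b : nat).+1%:R else false.

Let norm_f i s : `|f i s| <= 1.
Proof. by have /andP[? ?] := f01 i s; rewrite ger0_norm. Qed.

(** If two values of feature [i] differed by more than [e], a point of the grid of mesh
    [1 / (b + 1)], itself at most [e], would separate them. The prefix is taken long enough to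
    contain the bits of all grid points up to 1. *)
Let feature_continuous i e : 0 < e -> exists n, forall s s',
  prefix (code s) n = prefix (code s') n -> `|f i s - f i s'| <= e.
Proof.
move=> e0; pose b := Num.trunc e^-1.
have be : (b.+1%:R^-1 : R) <= e.
  by rewrite -[leRHS]invrK lef_pV2 ?posrE ?invr_gt0// ltW// truncnS_gt.
pose n := \max_(a < b.+2) (pickle (i, a : nat, b)).+1.
exists n => s s' ss'.
wlog sle : s s' ss' / f i s <= f i s'.
  by move=> H; have [/H|/ltW/H] := leP (f i s) (f i s'); [exact|rewrite distrC; apply].
rewrite distrC ger0_norm ?subr_ge0//; apply: le_trans be; rewrite leNgt; apply/negP => lt.
have b0 : 0 < (b.+1%:R : R) by rewrite ltr0n.
pose a := (Num.trunc (f i s * b.+1%:R)).+1.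
have /andP[f0 f1] := f01 i s; have /andP[f'0 f'1] := f01 i s'.
have /andP[al ag] := truncn_itv (mulr_ge0 f0 (ltW b0)).
have fa : f i s < a%:R / b.+1%:R by rewrite ltr_pdivlMr.
have af : a%:R / b.+1%:R < f i s'.
  apply: (@le_lt_trans _ _ (f i s + b.+1%:R^-1)); last by rewrite -ltrBrDl.
  by rewrite ler_pdivrMr// mulrDl mulVf ?gt_eqF// /a -[X in X <= _]natr1 lerD2r.
have ab : (a < b.+2)%N.
  rewrite -(ltr_nat R) -(ltr_pM2r (_ : 0 < b.+1%:R^-1)) ?invr_gt0//.
  apply: (lt_le_trans af); apply: (le_trans f'1).
  by rewrite ler_pdivlMr// mul1r ler_nat.
have an : (pickle (i, a, b) < n)%N.
  exact: (@leq_bigmax _ (fun a : 'I_b.+2 => (pickle (i, a : nat, b)).+1) (Ordinal ab)).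
have := prefix_eq ss' an; rewrite /code pickleK fa => /esym/idP.
by rewrite ltNge (ltW af).
Qed.

Let has_prefix s w : R := (prefix (code s) (size w) == w)%:R.

Let q w : R := lim ((fun j => mean (p j) (has_prefix^~ w)) @ F).

Let cvg_q w : (fun j => mean (p j) (has_prefix^~ w)) @ F --> q w.
Proof.
apply: (bounded_ultra_cvg (M := 1)) => j.
by apply: norm_mean_le => // s; rewrite /has_prefix; case: eqP; rewrite ?normr1 ?normr0.
Qed.

Let tree_q : tree_mass q.
Proof.
split=> [|w|w].
- apply/cvg_lim; first exact: Rhausdorff.
  rewrite (_ : (fun _ => _) = cst 1); first exact: cvg_cst.
  by apply/funext => j; rewrite -(mean_cst 1 (mp j)); exact: eq_mean.
- apply: (cvgr_to_ge (@cvg_q w)); apply: nearW => j.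
  rewrite -(mean_cst 0 (mp j)); apply: le_mean => // s; exact: ler0n.
- apply/cvg_lim; first exact: Rhausdorff.
  rewrite (_ : (fun _ => _) = (fun j => mean (p j) (has_prefix^~ (false :: w)) +
    mean (p j) (has_prefix^~ (true :: w)))); first exact: cvgD.
  apply/funext => j; rewrite -meanD; apply: eq_mean => s.
  rewrite /has_prefix/= !eqseq_cons -natrD; congr (_%:R).
  by case: (code s (size w)); case: eqP.
Qed.

Let repr w : S :=
  if pselect (exists s, prefix (code s) (size w) = w) is left h then projT1 (cid h) else s0.

Let prefix_repr s n : prefix (code (repr (prefix (code s) n))) n = prefix (code s) n.
Proof.
rewrite /repr; case: pselect => [h|]; last by case; exists s; rewrite size_prefix.
by case: cid => s' /=; rewrite size_prefix.
Qed.

(** Random numbers outside [[0, 1[] are sent to 0 because the convergence below is claimed for every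
    [t]. *)
Let Z (t : R) : cantor := sample q (if 0 <= t < 1 then t else 0).

Let measurable_Z : measurable_fun [set: R] Z.
Proof.
apply: (measurableT_comp (measurable_sample1 q)); apply: measurable_fun_if => //.
by apply: measurable_and; exact: measurable_fun_ler || exact: measurable_fun_ltr.
Qed.

(** A word that no strategy produces has limit mass 0, hence an empty sampling interval: it is never
    visited, for any [t]. The default [s0] in [repr] is thus never reached along a sampled path. *)
Let prefix_Z t n : prefix (code (repr (prefix (Z t) n))) n = prefix (Z t) n.
Proof.
set w := prefix (Z t) n.
suff [s <-] : exists s, prefix (code s) n = w by exact: prefix_repr.
apply: contrapT => nos.
have wn : size w = n by rewrite size_prefix.
have qw0 : q w = 0.
  apply/cvg_lim; first exact: Rhausdorff.
  rewrite (_ : (fun _ => _) = cst 0); first exact: cvg_cst.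
  apply/funext => j; rewrite -(mean_cst 0 (mp j)); apply: eq_mean => s.
  by rewrite /has_prefix wn; case: eqP => // sw; exfalso; apply: nos; exists s.
pose t' := if 0 <= t < 1 then t else 0.
have t'01 : 0 <= t' < 1 by rewrite /t'; case: ifP => //; rewrite lexx ltr01.
have := prefix_sampleP w tree_q t'01.
by rewrite wn eqxx qw0 addr0 => /esym /andP[/le_lt_trans h /h]; rewrite ltxx.
Qed.

Let unif_Z w : unif [set t | prefix (Z t) (size w) = w] = (q w)%:E.
Proof.
rewrite -unif_sample// unif_setI01; last exact: measurable_prefix measurable_Z.
rewrite [RHS]unif_setI01; last exact: (measurable_prefix _ _ (measurable_sample1 q)).
by congr (unif _); apply/seteqP; split=> t [] /= + t01; move: (t01); rewrite in_itv/= /Z => ->.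
Qed.

Let strat n t := repr (prefix (Z t) n).

Let strat_cauchy i e : 0 < e -> exists n0, forall t m n, (n0 <= m)%N -> (n0 <= n)%N ->
  `|f i (strat m t) - f i (strat n t)| <= e.
Proof.
move=> /(feature_continuous i)[n0 H]; exists n0 => t m n mn0 nn0; apply: H.
have E k : (n0 <= k)%N -> prefix (code (strat k t)) n0 = prefix (Z t) n0.
  by move=> kn0; apply: prefix_le kn0 _; rewrite prefix_Z.
by rewrite !E.
Qed.

Let l i t : R := lim ((fun n => f i (strat n t)) @ \oo).

Let cvg_l i t : (fun n => f i (strat n t)) @ \oo --> l i t.
Proof.
apply: cauchy_cvg; apply: cauchy_exP => e e0.
have [n0 H] := strat_cauchy i (divr_gt0 e0 (ltr0n _ 2)).
exists (f i (strat n0 t)); exists n0 => // n /= nn0; rewrite -ball_normE/=.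
apply: (le_lt_trans (H t n0 n (leqnn _) nn0)).
by rewrite ltr_pdivrMr// mulr2n mulrDr mulr1 ltrDl.
Qed.

Let measurable_strat i n : measurable_fun [set: R] (fun t => f i (strat n t)).
Proof.
under eq_fun do rewrite /strat -(sum_prefix _ _ (fun w => f i (repr w))).
apply: measurable_sum => w; apply: measurable_funM => //.
apply: measurable_fun_nat_of_bool.
rewrite (_ : [set _ | _] = [set t | prefix (Z t) n = w]); first exact: measurable_prefix measurable_Z.
by apply/seteqP; split=> t /eqP.
Qed.

Let l01 i t : 0 <= l i t <= 1.
Proof.
apply/andP; split.
  by apply: (cvgr_to_ge (@cvg_l i t)); apply: nearW => n; case/andP: (f01 i (strat n t)).
by apply: (cvgr_to_le (@cvg_l i t)); apply: nearW => n; case/andP: (f01 i (strat n t)).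
Qed.

Let measurable_l i : measurable_fun [set: R] (l i).
Proof. by apply: measurable_fun_cvg (measurable_strat i) _ => t _; exact: cvg_l. Qed.

Let integral_strat i n : \int[unif]_t f i (strat n t) =
  \sum_(w : n.-tuple bool) f i (repr w) * q w.
Proof.
under eq_Rintegral do rewrite /strat -(sum_prefix _ _ (fun w => f i (repr w))).
have mA (w : n.-tuple bool) : measurable [set t | prefix (Z t) n == w].
  rewrite (_ : [set _ | _] = [set t | prefix (Z t) n = w]); first exact: measurable_prefix measurable_Z.
  by apply/seteqP; split=> t /eqP.
rewrite (@Rintegral_sum _ _ _ _ _ _ _ (fun=> 1)); last 2 first.
- by move=> w; apply: measurable_funM => //; exact: measurable_fun_nat_of_bool.
- move=> w t; rewrite normrM mulr_ile1//.
  by case: eqP; rewrite ?normr1 ?normr0.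
apply: eq_bigr => w _; rewrite RintegralZl//; last first.
  apply: (bounded_integrable (M := 1)); first exact: measurable_fun_nat_of_bool.
  by move=> t; case: eqP; rewrite ?normr1 ?normr0.
rewrite Rintegral_bool//; congr (_ * _).
have := unif_Z w; rewrite size_tuple => E.
rewrite -[RHS]/(fine (q w)%:E) -E; congr (fine (unif _)).
by apply/seteqP; split=> t /eqP.
Qed.

(** The limit of the mixtures lives on a completion of [S] that is seen only through the features.
    The nodes of the branch [X t] are represented by genuine elements of [S] whose features form
    Cauchy sequences for every [t]; pointwise convergence lets products of features pass to the
    limit later. *)
Lemma tree_limit : exists (r : seq bool -> S) (X : R -> cantor) (g : J -> R -> R),
  [/\ measurable_fun [set: R] X,
      forall i, measurable_fun [set: R] (g i),
      forall i t, 0 <= g i t <= 1,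
      forall i t, (fun n => f i (r (prefix (X t) n))) @ \oo --> g i t &
      forall i, (fun j => mean (p j) (f i)) @ F --> \int[unif]_t g i t].
Proof.
exists repr, Z, l; split=> // i.
apply/cvgrPdist_le => e e0.
have e30 : 0 < e / 3 by rewrite divr_gt0.
have [n0 Hc] := strat_cauchy i e30.
have [n1 Hf] := feature_continuous i e30.
(* At depth [n] a feature depends on finitely many words, whose mean masses converge to [q] by
   definition. Replacing features by those of depth-[n] representatives costs at most [e / 3],
   uniformly in the strategies and in [t]. *)
pose n := maxn n0 n1.
have near_l : `|\int[unif]_t l i t - \int[unif]_t f i (strat n t)| <= e / 3.
  rewrite -[leRHS]mulr1 -[X in _ * X]/(fine 1%E) -(probability_setT (unif : probability R R)).
  apply: (dist_Rintegral_le (Mf := 1) (Mg := 1)) => //.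
    by move=> t; have /andP[? ?] := l01 i t; rewrite ger0_norm.
  move=> t; have H : (fun m => `|f i (strat m t) - f i (strat n t)|) @ \oo -->
      `|l i t - f i (strat n t)|.
    by apply: cvg_norm; apply: cvgB; [exact: cvg_l|exact: cvg_cst].
  apply: (cvgr_to_le H); exists n0 => // m /= mn0; apply: Hc => //.
  exact: leq_maxl.
have near_mean j : `|mean (p j) (f i) - mean (p j) (fun s => f i (repr (prefix (code s) n)))| <= e / 3.
  rewrite -meanB; apply: norm_mean_le => // s; apply: Hf.
  by apply: (prefix_le (leq_maxr n0 n1)); rewrite prefix_repr.
have cvg_n : (fun j => mean (p j) (fun s => f i (repr (prefix (code s) n)))) @ F -->
    \int[unif]_t f i (strat n t).
  rewrite integral_strat.
  have E j : mean (p j) (fun s => f i (repr (prefix (code s) n))) =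
      \sum_(w : n.-tuple bool) f i (repr w) * mean (p j) (has_prefix^~ w).
    under [RHS]eq_bigr do rewrite -meanZ.
    rewrite -mean_sum; apply: eq_mean => s; rewrite -(sum_prefix _ _ (fun w => f i (repr w))).
    by apply: eq_bigr => w _; rewrite /has_prefix size_tuple.
  under eq_fun do rewrite E.
  apply: cvg_big => [|w _]; first exact: add_continuous.
  by apply: cvgMr; exact: cvg_q.
move/cvgrPdist_le : cvg_n => /(_ _ e30); apply: filterS => j Hj.
have := near_mean j; move: near_l Hj.
set a := \int[unif]_t _; set b := \int[unif]_t _; set c := mean _ _; set dd := mean _ _.
rewrite !ler_norml => /andP[? ?] /andP[? ?] /andP[? ?]; apply/andP; split; lra.
Qed.

End TreeLimit.

(** * Sampling weak limits of strategies *)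

Section ProductSections.
Context {d1 d2} {T1 : measurableType d1} {T2 : measurableType d2} {R : realType}.
Variables (m1 : {finite_measure set T1 -> \bar R}) (m2 : {finite_measure set T2 -> \bar R}).
Local Open Scope ereal_scope.

Lemma measurable_setX2 (D : set (T1 * T2)) (y : T2) : measurable D ->
  measurable [set x | D (x, y)].
Proof. by move=> /(measurable_ysection y); rewrite ysectionE. Qed.

Lemma product_measure_sectionE (D : set (T1 * T2)) :
  (m1 \x m2) D = \int[m1]_x m2 [set y | D (x, y)].
Proof. by apply: eq_integral => x _ /=; rewrite xsectionE. Qed.

Lemma measurable_fun_section1 (D : set (T1 * T2)) : measurable D ->
  measurable_fun [set: T1] (fun x => m2 [set y | D (x, y)]).
Proof.
move=> mD; have := measurable_fun_xsection m2 mD; apply: eq_measurable_fun => x _ /=.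
by rewrite xsectionE.
Qed.

Lemma measurable_fun_section2 (D : set (T1 * T2)) : measurable D ->
  measurable_fun [set: T2] (fun y => m1 [set x | D (x, y)]).
Proof.
move=> mD; have := measurable_fun_ysection m1 mD; apply: eq_measurable_fun => x _ /=.
by rewrite ysectionE.
Qed.

Lemma product_measure_sectionE2 (D : set (T1 * T2)) : measurable D ->
  (m1 \x m2) D = \int[m2]_y m1 [set x | D (x, y)].
Proof.
move=> mD; rewrite -{1}(setIT D) -integral_indic//.
have mi : measurable_fun setT (fun z : T1 * T2 => (\1_D z)%:E : \bar R).
  by apply/measurable_EFinP; exact: measurable_indic.
rewrite fubini_tonelli2//; apply: eq_integral => y _.
rewrite /fubini_G/= -(setIT [set x | D (x, y)]) -integral_indic//; exact: measurable_setX2.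
Qed.

End ProductSections.

Lemma bounded_cvg_Rintegral d (T : measurableType d) (R : realType)
    (P : {finite_measure set T -> \bar R}) (D : set T) (f : nat -> T -> R) (g : T -> R) (M : R) :
  measurable D -> (forall n, measurable_fun setT (f n)) -> (forall n x, `|f n x| <= M) ->
  (forall x, (fun n => f n x) @ \oo --> g x) ->
  (fun n => \int[P]_(x in D) f n x) @ \oo --> \int[P]_(x in D) g x.
Proof.
move=> mD mf fM fg.
have mg : measurable_fun setT g by exact: (measurable_fun_cvg mf (fun x _ => fg x)).
have gM x : `|g x| <= M.
  by apply: (cvgr_to_le (cvg_norm (fg x))); apply: nearW => n; exact: fM.
have intg : P.-integrable D (EFin \o g).
  by apply: integrableS (bounded_integrable mg gM).
apply: fine_cvg; rewrite fineK ?integrable_fin_num//.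
apply: (@dominated_cvg _ _ _ _ _ _ _ (EFin \o g) (cst M%:E)) => //.
- by move=> n; apply/measurable_EFinP; exact: measurable_funTS.
- by move=> x _; apply: cvg_EFin; [exact: nearW|exact: fg].
- by apply: (integrableS measurableT) => //; apply: (bounded_integrable (M := `|M|)).
- by move=> n x _; rewrite /= lee_fin.
Qed.

Lemma ae_forall_countable d (T : measurableType d) (R : realType)
    (m : {measure set T -> \bar R}) (I : countType) (P : I -> T -> Prop) :
  (forall i, {ae m, forall x, P i x}) -> {ae m, forall x, forall i, P i x}.
Proof.
move=> aeP.
have : {ae m, forall x, forall n, if unpickle n is Some i then P i x else True}.
  apply: ae_foralln => n; case: (unpickle n) => [i|]; first exact: aeP.
  exact: nearW.
by apply: filterS => x H i; have := H (pickle i); rewrite pickleK.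
Qed.

Section RandomizedLimit.
Context {d} {Y : measurableType d} {R : realType} (Q : probability Y R).
Variables (s : nat -> Y * R -> cantor).
Hypothesis ms : forall n, measurable_fun [set: Y * R] (s n).

Let QP : probability (Y * R)%type R := (Q \x unif)%E.

Let E n w : set (Y * R) := s n @^-1` cylinder w.

Let mE n w : measurable (E n w).
Proof.
rewrite -[X in measurable X]setTI; apply: ms => //; exact: measurable_cylinder.
Qed.

Let limit_density (U : set_system nat) w : UltraFilter U ->
  exists rho : Y * R -> \bar R,
    [/\ forall p, (0 <= rho p)%E, forall p, rho p \is a fin_num,
        QP.-integrable setT rho &
        forall B, measurable B -> (fun n => fine (QP (B `&` E n w))) @ U -->
          fine (\int[QP]_(p in B) rho p)%E].
Proof.
move=> FU.
have mBE n B : measurable B -> measurable (B `&` E n w) by move=> mB; exact: measurableI.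
have [||n A B mA mB AB|L HL] := @dominated_ultralimit _ _ _ _ U FU QP
    (fun n B => fine (QP (B `&` E n w))).
- by move=> n B mB; exact: fine_ge0.
- move=> n B mB; apply: fine_le; [exact: fin_num_measure (mBE _ _ mB)|exact: fin_num_measure mB|].
  by apply: le_measure; rewrite ?inE//; exact: mBE.
- rewrite setIUl measureU.
  + by rewrite fineD ?fin_num_measure//; exact: mBE.
  + exact: mBE.
  + exact: mBE.
  + by rewrite setIACA AB set0I.
have Lac : L `<< QP.
  apply/null_content_dominatesP => A mA A0; apply/eqP; rewrite -measure_le0 -A0.
  by have [] := HL A mA.
have [rho [rho0 rhofin rhoint rhoE]] := radon_nikodym_sigma_finite Lac.
exists rho; split=> // B mB; rewrite -rhoE//.
by have [] := HL B mB.
Qed.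

(** For each word, the graph measures on [Y * R] have a limit dominated by the product of [Q] and
    [unif]. Taking densities there, rather than for each [t] separately, makes the kernel jointly
    measurable; the price is an identity for almost every [t] only, checked by integrating both
    sides over arbitrary sets of [t]. *)
Lemma randomized_limit : exists2 kappa : Y * R -> R -> cantor,
  measurable_fun [set: (Y * R) * R] (fun q => kappa q.1 q.2) &
  forall (A : set Y) w (g : R -> R), measurable A ->
    (forall t, (fun n => fine (Q (A `&` [set y | cylinder w (s n (y, t))]))) @ \oo --> g t) ->
    {ae unif, forall t,
      (\int[unif]_x Q (A `&` [set y | cylinder w (kappa (y, t) x)]))%E = (g t)%:E}.
Proof.
have [U [FU oU]] := @ultraFilterLemma nat \oo _.
have [rho rhoP] := choice (fun w => limit_density w FU).
have rho0 w p : (0 <= rho w p)%E by have [] := rhoP w.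
have rhofin w p : rho w p \is a fin_num by have [] := rhoP w.
have rhoint w : QP.-integrable setT (rho w) by have [] := rhoP w.
have rhom w : measurable_fun setT (rho w) by exact: measurable_int (rhoint w).
have rhoB w B : measurable B -> (\int[QP]_(p in B) rho w p)%E \is a fin_num.
  by move=> mB; apply: integrable_fin_num => //; exact: integrableS (rhoint w).
have rhoL w B : measurable B -> (fun n => fine (QP (B `&` E n w))) @ U -->
    fine (\int[QP]_(p in B) rho w p)%E by have [_ _ _] := rhoP w; apply.
have rho_nil : ae_eq QP setT (rho [::]) (cst 1%E).
  apply: integral_ae_eq => // B _ mB; rewrite integral_cst// mul1e.
  rewrite -[LHS]fineK ?rhoB// -[RHS]fineK ?fin_num_measure//; congr (_%:E).
  apply: (cvg_unique (@Rhausdorff R) (rhoL _ _ mB)).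
  rewrite (_ : (fun _ => _) = cst (fine (QP B))); first exact: cvg_cst.
  by apply/funext => n; rewrite /E cylinder0 preimage_setT setIT.
have rho_cons w : ae_eq QP setT (rho w) (fun p => rho (false :: w) p + rho (true :: w) p)%E.
  apply: integral_ae_eq => //; first exact: emeasurable_funD.
  move=> B _ mB; rewrite ge0_integralD//; try exact: measurable_funTS.
  rewrite -(fineK (rhoB w B mB)) -(fineK (rhoB (false :: w) B mB)) -(fineK (rhoB (true :: w) B mB)).
  rewrite -EFinD; congr (_%:E).
  apply: (cvg_unique (@Rhausdorff R) (rhoL _ _ mB)).
  rewrite (_ : (fun _ => _) = (fun n => fine (QP (B `&` E n (false :: w))) +
      fine (QP (B `&` E n (true :: w))))); first by apply: cvgD; exact: rhoL.
  apply/funext => n; rewrite /E cylinder_cons preimage_setU setIUr measureU.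
  + by rewrite fineD// fin_num_measure//; apply: measurableI => //; exact: mE.
  + by apply: measurableI => //; exact: mE.
  + by apply: measurableI => //; exact: mE.
  + by rewrite setIACA setIid -(preimage_setI (s n)) cylinder_cons0 preimage_set0 setI0.
pose q (p : Y * R) w := fine (rho w p).
have mq w : measurable_fun setT (q^~ w) by exact: measurableT_comp (rhom w).
(* There are countably many words, so all tree relations hold at once off a null set. On that null
   set [sample] is arbitrary but still measurable. *)
have tq : {ae QP, forall p, tree_mass (q p)}.
  have := ae_forall_countable rho_cons; move: rho_nil; apply: filterS2 => p nilp consp.
  split=> [|w|w]; rewrite /q.
  - by rewrite nilp.
  - by rewrite fine_ge0.
  - by rewrite consp// fineD.
exists (fun p => sample (q p)); first exact: measurable_sample mq.
move=> A w g mA Ag.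
have mQ n : measurable_fun [set: R]
    (fun t => fine (Q (A `&` [set y | cylinder w (s n (y, t))]))).
  apply: (measurableT_comp (@fine_measurable _ setT measurableT)).
  apply: (@measurable_fun_section2 _ _ _ _ _ Q [set p | A p.1 /\ E n w p]).
  apply: (@measurableI _ _ (fst @^-1` A)) => //.
  by rewrite -[X in measurable X]setTI; exact: measurable_fst.
have Q1 n t : `|fine (Q (A `&` [set y | cylinder w (s n (y, t))]))| <= 1.
  have mAt : measurable (A `&` [set y | cylinder w (s n (y, t))]).
    by apply: measurableI => //; exact: (measurable_setX2 _ (mE n w)).
  by rewrite ger0_norm ?fine_ge0// -lee_fin fineK ?fin_num_measure// probability_le1.
have mg : measurable_fun [set: R] g by exact: (measurable_fun_cvg mQ (fun x _ => Ag x)).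
have g1 t : `|g t| <= 1.
  by apply: (cvgr_to_le (cvg_norm (Ag t))); apply: nearW => n.
pose C : set ((Y * R) * R) := [set z | A z.1.1 /\ cylinder w (sample (q z.1) z.2)].
have mC : measurable C.
  apply: (@measurableI _ _ ((fun z : (Y * R) * R => z.1.1) @^-1` A)).
    rewrite -[X in measurable X]setTI.
    exact: (measurableT_comp measurable_fst measurable_fst).
  have := measurable_sample mq measurableT (measurable_cylinder w); rewrite setTI; exact.
pose CT (T : set R) : set ((Y * R) * R) := C `&` [set z | T z.1.2].
have mCT T : measurable T -> measurable (CT T).
  move=> mT; apply: measurableI => //.
  rewrite -[X in measurable X]setTI.
  exact: (measurableT_comp measurable_snd measurable_fst).
pose CT' T : set (Y * (R * R)) := [set z | CT T ((z.1, z.2.1), z.2.2)].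
have mCT' T : measurable T -> measurable (CT' T).
  move=> mT; rewrite -[X in measurable X]setTI.
  suff H : measurable_fun [set: Y * (R * R)] (fun z : Y * (R * R) => ((z.1, z.2.1), z.2.2)).
    by apply: H => //; exact: mCT.
  apply: measurable_fun_pair.
    apply: measurable_fun_pair; first exact: measurable_fst.
    exact: (measurableT_comp measurable_fst measurable_snd).
  exact: (measurableT_comp measurable_snd measurable_snd).
pose h t := (\int[unif]_x Q (A `&` [set y | cylinder w (sample (q (y, t)) x)]))%E.
pose UU : probability (R * R)%type R := (unif \x unif)%E.
pose hT T t := (\int[unif]_x Q [set y | CT' T (y, (t, x))])%E.
have mhT T : measurable T -> measurable_fun [set: R] (hT T).
  move=> mT; apply: (@measurable_fun_fubini_tonelli_F _ _ _ _ _ unif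
    (fun tx : R * R => Q [set y | CT' T (y, tx)])) => //.
  exact: (@measurable_fun_section2 _ _ _ _ _ Q _ (mCT' _ mT)).
have hTE T t : T t -> hT T t = h t.
  move=> Tt; apply: eq_integral => x _; congr (Q _).
  by apply/seteqP; split=> y /=; [move=> [] []|].
have hT0 T t : ~ T t -> hT T t = 0%E.
  move=> Tt; rewrite /hT (eq_integral (cst 0%E)) ?integral0// => x _.
  by rewrite (_ : [set _ | _] = set0) ?measure0//; apply/seteqP; split=> // y [].
have mh : measurable_fun [set: R] h.
  by apply: eq_measurable_fun (mhT _ measurableT) => t _; rewrite hTE.
(* After reassociating the triple, the sampling variable is integrated first; by [unif_sample] it
   contributes exactly the mass [rho w]. *)
have int_h T : measurable T -> (\int[unif]_(t in T) h t =
    \int[QP]_(p in [set p | A p.1 /\ T p.2]) rho w p)%E.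
  move=> mT; have mAT : measurable [set p : Y * R | A p.1 /\ T p.2].
    exact: measurableX.
  transitivity (\int[unif]_t hT T t)%E.
    rewrite integral_mkcond; apply: eq_integral => t _; rewrite patchE.
    case: ifP => [/set_mem Tt|/negP Tt]; first by rewrite hTE.
    by rewrite hT0// => Tt'; apply: Tt; rewrite inE.
  transitivity ((Q \x UU) (CT' T))%E.
    rewrite [RHS](product_measure_sectionE2 Q UU (mCT' _ mT)).
    rewrite fubini_tonelli1//.
    exact: (@measurable_fun_section2 _ _ _ _ _ Q _ (mCT' _ mT)).
  transitivity (\int[QP]_p unif [set x | CT T (p, x)])%E.
    rewrite [LHS](product_measure_sectionE Q UU).
    have mCTp := @measurable_fun_section1 _ _ _ _ _ unif _ (mCT _ mT).
    have FT := @fubini_tonelli1 _ _ _ _ _ Q unif _ mCTp (fun p => measure_ge0 _ _).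
    apply: etrans (esym FT).
    by apply: eq_integral => y _; exact: (product_measure_sectionE unif unif).
  rewrite [RHS]integral_mkcond; apply: ge0_ae_eq_integral => //.
  - exact: (@measurable_fun_section1 _ _ _ _ _ unif _ (mCT _ mT)).
  - by apply/(measurable_restrictT _ mAT); exact: measurable_funTS.
  - by move=> p _; rewrite patchE; case: ifP.
  move: tq; apply: filterS => p tp _; rewrite patchE.
  case: ifP => [/set_mem[Ap Tp]|/negP nAT]; last first.
    rewrite (_ : [set _ | _] = set0) ?measure0//; apply/seteqP; split=> // x [[Ap _] Tp].
    by apply: nAT; rewrite inE.
  rewrite -[RHS]fineK// -(unif_sample w tp); congr (unif _).
  by apply/seteqP; split=> x //= [] [].
(* The same integral is the [U]-limit of the graph measures by definition of [rho], and their
   ordinary limit by dominated convergence; [U] refines [\oo], so the two agree. *)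
have int_g T : measurable T -> (\int[unif]_(t in T) (g t)%:E =
    \int[QP]_(p in [set p | A p.1 /\ T p.2]) rho w p)%E.
  move=> mT; have mAT : measurable [set p : Y * R | A p.1 /\ T p.2].
    exact: measurableX.
  have intg : unif.-integrable T (EFin \o g).
    by apply: integrableS (bounded_integrable mg g1).
  rewrite -[LHS]fineK ?integrable_fin_num// -[RHS]fineK ?rhoB//; congr (_%:E).
  apply: (cvg_unique (@Rhausdorff R) _ (rhoL _ _ mAT)).
  suff H : (fun n => fine (QP ([set p | A p.1 /\ T p.2] `&` E n w))) @ \oo -->
      fine (\int[unif]_(t in T) (g t)%:E)%E by move=> B /H /oU.
  rewrite (_ : (fun n => _) = (fun n => \int[unif]_(t in T)
      fine (Q (A `&` [set y | cylinder w (s n (y, t))])))).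
    exact: (bounded_cvg_Rintegral (P := unif) mT mQ Q1 Ag).
  apply/funext => n; congr fine.
  rewrite [LHS](product_measure_sectionE2 Q unif); last exact: measurableI.
  rewrite [RHS]integral_mkcond; apply: eq_integral => t _; rewrite patchE.
  case: ifP => [/set_mem Tt|/negP Tt].
    rewrite fineK; last first.
      rewrite fin_num_measure//; apply: measurableI => //.
      exact: (measurable_setX2 _ (mE n w)).
    by congr (Q _); apply/seteqP; split=> y /=; [case=> -[]|case].
  rewrite (_ : [set _ | _] = set0) ?measure0//; apply/seteqP; split=> // y /= [[_ Tt'] _].
  by apply: Tt; rewrite inE.
have : ae_eq unif setT (EFin \o g) h.
  apply: integral_ae_eq => //; first exact: bounded_integrable mg g1.
  by move=> T _ mT; rewrite int_h// int_g.
by apply: filterS => t /(_ Logic.I)/esym.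
Qed.

End RandomizedLimit.

(** * Product spaces *)

Definition countably_generated {d} (T : measurableType d) :=
  exists E : nat -> set T, @measurable d T = <<s range E >>.

(** Indexing finite intersections by lists keeps the family countable. The empty list gives the
    whole space and concatenation gives intersection, hence a pi-system. *)
Definition meets {T : Type} (E : nat -> set T) (l : seq nat) : set T :=
  foldr (fun n A => E n `&` A) setT l.

Section PiSystem.
Context {d} {T : measurableType d} (E : nat -> set T).
Hypothesis mE : @measurable d T = <<s range E >>.

Lemma measurable_meets l : measurable (meets E l).
Proof.
elim: l => //= n l IH; apply: measurableI => //.
by rewrite mE; apply: sub_sigma_algebra; exists n.
Qed.

Lemma meets_cat l l' : meets E (l ++ l') = meets E l `&` meets E l'.
Proof. by elim: l => [|n l IH] /=; rewrite ?setTI// IH setIA. Qed.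

Lemma meets1 n : meets E [:: n] = E n.
Proof. exact: setIT. Qed.

End PiSystem.

Section Boxes.
Context {N : nat} {dY : 'I_N -> measure_display} {Y : forall k, measurableType (dY k)}.

Definition box (A : forall k, set (Y k)) : set (dprodM Y) := [set y | forall k, A k (y k)].

Lemma boxE (A : forall k, set (Y k)) :
  box A = \bigcap_(k in setT) ((fun y : dprodM Y => y k) @^-1` A k).
Proof. by apply/seteqP; split=> y Ay k; [move=> _; exact: Ay|exact: (Ay k)]. Qed.

Lemma boxI (A B : forall k, set (Y k)) : box A `&` box B = box (fun k => A k `&` B k).
Proof.
by apply/seteqP; split=> y; [move=> [Ay By] k; split|move=> AB; split=> k; case: (AB k)].
Qed.

Lemma measurable_box (A : forall k, set (Y k)) :
  (forall k, measurable (A k)) -> measurable (box A).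
Proof.
move=> mA; rewrite boxE -[X in measurable X]setCK setC_bigcap; apply: measurableC.
apply: countable_bigcupT_measurable => [|k]; first exact: countableP.
apply: measurableC; rewrite -[X in measurable X]setTI; exact: measurable_dproj.
Qed.

Lemma measurable_dprodE (E : forall k, nat -> set (Y k)) :
  (forall k, @measurable _ (Y k) = <<s range (E k) >>) ->
  @measurable _ (dprodM Y) =
    <<s range (fun e : 'I_N -> seq nat => box (fun k => meets (E k) (e k))) >>.
Proof.
move=> mE; set S := range _; apply/seteqP; split=> B.
  apply: smallest_sub; first exact: smallest_sigma_algebra.
  move=> _ [i [A [+ ->]]]; rewrite mE.
  pose C := [set A : set (Y i) | <<s S >> ((fun y : dprodM Y => y i) @^-1` A)].
  suff : <<s range (E i) >> `<=` C by move=> H /H.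
  apply: smallest_sub.
    split=> [|A' CA'|F CF]; rewrite /C/=.
    - by rewrite preimage_set0; exact: sigma_algebra0.
    - by rewrite setTD preimage_setC -setTD; exact: sigma_algebraCD.
    - by rewrite preimage_bigcup; exact: sigma_algebra_bigcup.
  move=> _ [n _ <-]; rewrite /C/=; apply: sub_sigma_algebra.
  exists (fun k => if k == i then [:: n] else [::]) => //.
  apply/seteqP; split=> y.
    by move=> /(_ i); rewrite eqxx meets1.
  by move=> /= yn k; have [->|//] := eqVneq k i; rewrite meets1.
apply: smallest_sub; first exact: sigma_algebra_measurable.
by move=> _ [e _ <-]; apply: measurable_box => k; exact: measurable_meets.
Qed.

Lemma dprod_measure_unique (R : realType) (E : forall k, nat -> set (Y k))
    (m1 m2 : {measure set (dprodM Y) -> \bar R}) :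
  (forall k, @measurable _ (Y k) = <<s range (E k) >>) -> (m1 setT < +oo)%E ->
  (forall e : 'I_N -> seq nat,
    m1 (box (fun k => meets (E k) (e k))) = m2 (box (fun k => meets (E k) (e k)))) ->
  forall B, measurable B -> m1 B = m2 B.
Proof.
move=> mE moo m12 B mB.
apply: (measure_unique _ (fun=> box (fun k => meets (E k) [::])) (measurable_dprodE mE)) => //.
- move=> _ _ [e _ <-] [e' _ <-]; exists (fun k => e k ++ e' k) => //.
  rewrite boxI; congr box.
  by apply: functional_extensionality_dep => k; rewrite meets_cat.
- by apply/seteqP; split=> // y _; exists 0%N.
- by move=> _ [e _ <-].
- by move=> _; apply: le_lt_trans moo; apply: le_measure; rewrite ?inE//;
    apply: measurable_box => k; exact: measurable_meets (mE k) _.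
Qed.

End Boxes.

(** * Limits of team mixtures *)

Section TeamLimit.
Context {R : realType} {N : nat} {dY : 'I_N -> measure_display}
  {Y : forall k, measurableType (dY k)}.

Record strategy := Strategy {
  act : forall k, Y k -> cantor;
  measurable_act : forall k, measurable_fun [set: Y k] (@act k) }.
Arguments act : clear implicits.
Arguments measurable_act : clear implicits.

Definition plays (s : forall k, Y k -> cantor) (w : 'I_N -> seq bool) : set (dprodM Y) :=
  box (fun k => s k @^-1` cylinder (w k)).

Lemma measurable_act_cylinder (s : strategy) k w : measurable (act s k @^-1` cylinder w).
Proof.
rewrite -[X in measurable X]setTI.
by apply: measurable_act => //; exact: measurable_cylinder.
Qed.

Lemma measurable_plays (s : strategy) w : measurable (plays (act s) w).
Proof. by apply: measurable_box => k; exact: measurable_act_cylinder. Qed.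

(* A randomized team strategy: [kappa k y z] is the action of player [k] after
   observing [y] and the common random number [z]. *)
Definition measurable_team (kappa : forall k, Y k -> R -> cantor) :=
  forall k, measurable_fun [set: Y k * R] (fun p => kappa k p.1 p.2).

Lemma measurable_team_plays (kappa : forall k, Y k -> R -> cantor) w :
  measurable_team kappa ->
  measurable [set q : dprodM Y * R | plays (fun k y => kappa k y q.2) w q.1].
Proof.
move=> mk; rewrite (_ : [set _ | _] = \bigcap_(k in setT)
    [set q : dprodM Y * R | cylinder (w k) (kappa k (q.1 k) q.2)]); last first.
  by apply/seteqP; split=> q H k; [move=> _; exact: H|exact: (H k)].
rewrite -[X in measurable X]setCK setC_bigcap; apply: measurableC.
apply: countable_bigcupT_measurable => [|k]; first exact: countableP.
apply: measurableC.
have H : measurable_fun [set: dprodM Y * R] (fun q : dprodM Y * R => kappa k (q.1 k) q.2).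
  apply: (measurableT_comp (mk k)
    (g := fun q : dprodM Y * R => (q.1 k, q.2))).
  apply: measurable_fun_pair; last exact: measurable_snd.
  exact: (measurableT_comp (@measurable_dproj _ _ Y k) (@measurable_fst _ _ (dprodM Y) R)).
by have := H measurableT _ (measurable_cylinder (w k)); rewrite setTI.
Qed.

Context (Q : forall k, probability (Y k) R) (nu : probability (dprodM Y) R).
Hypothesis nuE : forall A : (forall k, set (Y k)), (forall k, measurable (A k)) ->
  nu (box A) = (\prod_(k < N) Q k (A k))%E.
Context (I : Type) (F : set_system I) (FU : UltraFilter F) (p : I -> seq (R * strategy)).
Hypothesis mp : forall i, mixture (p i).

Let nu_box A : (forall k, measurable (A k)) ->
  fine (nu (box A)) = \prod_(k < N) fine (Q k (A k)).
Proof.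
move=> mA; rewrite nuE// (eq_bigr (fun k => (fine (Q k (A k)))%:E)) ?prodEFin// => k _.
by rewrite fineK// fin_num_measure.
Qed.

(** At a fixed depth only countably many strategies occur, and each is selected on a measurable set
    of random numbers. *)
Lemma measurable_tree_strategy (r : seq bool -> strategy) (X : R -> cantor) n k :
  measurable_fun [set: R] X ->
  measurable_fun [set: Y k * R] (fun q => act (r (prefix (X q.2) n)) k q.1).
Proof.
move=> mX; apply: measurable_fun_dprod => i; apply: (measurable_fun_bool true).
rewrite setTI (_ : _ @^-1` _ = \bigcup_v
  ([set q : Y k * R | prefix (X q.2) n = v] `&` [set q | act (r v) k q.1 i = true])).
  apply: countable_bigcupT_measurable => [|v]; first exact: countableP.
  apply: measurableI.
    apply: measurable_prefix; exact: (measurableT_comp mX measurable_snd).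
  rewrite -[X in measurable X]setTI.
  have H : measurable_fun [set: Y k * R] (fun q => act (r v) k q.1 i).
    exact: (measurableT_comp (@measurable_dproj _ _ (fun _ : nat => (bool : measurableType _)) i)
      (measurableT_comp (measurable_act (r v) k) (@measurable_fst _ _ (Y k) R))).
  exact: (H measurableT [set true]).
by apply/seteqP; split=> q /= => [H|[v _ [<-]]//]; exists (prefix (X q.2) n).
Qed.

(** Independence under [nu] turns the mass of a box with prescribed actions into a product of
    moments of single players. Along a branch these moments converge separately, each player
    realizes its limit with its own private uniform variable, and [indep] reassembles the
    product. *)
Lemma team_limit_product (cY : forall k, countably_generated (Y k)) :
  exists2 kappa : forall k, Y k -> R -> cantor, measurable_team kappa &
  forall w B, measurable B ->
    (fun j => mean (p j) (fun s => fine (nu (B `&` plays (act s) w)))) @ F -->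
    fine ((nu \x unif)%E [set q | B q.1 /\ plays (fun k y => kappa k y q.2) w q.1]).
Proof.
pose E k := projT1 (cid (cY k)).
have mE k : @measurable _ (Y k) = <<s range (E k) >> by rewrite /E; case: cid.
pose M k e w (s : strategy) := fine (Q k (meets (E k) e `&` act s k @^-1` cylinder w)).
have mMs k e w s : measurable (meets (E k) e `&` act s k @^-1` cylinder w).
  by apply: measurableI; [exact: measurable_meets (mE k) _|exact: measurable_act_cylinder].
have M01 k e w s : 0 <= M k e w s <= 1.
  by rewrite fine_ge0//= -lee_fin fineK ?fin_num_measure// probability_le1.
(* Two kinds of features: moments of one player, which determine its Young measure on each branch,
   and their products over the team, whose averages are the quantities to be computed. Both families
   are countable because the [Y k] are countably generated. *)
pose J : countType := ({ffun 'I_N -> seq nat * seq bool} + 'I_N * seq nat * seq bool)%type.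
pose f (i : J) (s : strategy) : R := match i with
  | inl phi => \prod_(k < N) M k (phi k).1 (phi k).2 s
  | inr (k, e, w) => M k e w s end.
have f01 i s : 0 <= f i s <= 1.
  case: i => [phi|[[k e] w]] /=; last exact: M01.
  rewrite prodr_ge0 => [|k _]; last by case/andP: (M01 k (phi k).1 (phi k).2 s).
  by apply: prodr_ile1 => k _; exact: M01.
pose s0 : strategy := Strategy (fun k => measurable_cst (point : cantor)).
have [r [X [g [mX mg g01 cvg_g mean_g]]]] := tree_limit s0 f01 FU mp.
have kappaP k := randomized_limit (Q k) (fun n => measurable_tree_strategy r n (k := k) mX).
pose kappa0 k := s2val (cid2 (kappaP k)).
have mkappa0 k : measurable_fun [set: (Y k * R) * R] (fun q => kappa0 k q.1 q.2).
  by rewrite /kappa0; case: cid2.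
have lim_kappa0 k e w : {ae unif, forall t, (\int[unif]_x Q k (meets (E k) e `&`
    [set y | cylinder w (kappa0 k (y, t) x)]))%E = (g (inr (k, e, w)) t)%:E}.
  rewrite /kappa0; case: cid2 => K /= mK; apply; first exact: measurable_meets (mE k) _.
  by move=> t; exact: (cvg_g (inr (k, e, w)) t).
have [tau [xi [mtau mxi indep]]] := @independent_uniforms R.
pose kappa k y z := kappa0 k (y, tau N z) (xi k z).
have mkappa : measurable_team kappa.
  move=> k; apply: (measurableT_comp (mkappa0 k)
    (g := fun p : Y k * R => ((p.1, tau N p.2), xi k p.2))).
  apply: measurable_fun_pair; last exact: (measurableT_comp (mxi k) measurable_snd).
  apply: measurable_fun_pair; first exact: measurable_fst.
  exact: (measurableT_comp (mtau N) measurable_snd).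
exists kappa => // w.
have mplays := measurable_team_plays w mkappa.
(* By domination by [nu], the limit in [B] is itself a measure, so it suffices to identify it on the
   pi-system of boxes. *)
pose m j B := mean (p j) (fun s => fine (nu (B `&` plays (act s) w))).
have mBs B s : measurable B -> measurable (B `&` plays (act s) w).
  by move=> mB; apply: measurableI => //; exact: measurable_plays.
have [|||L HL] := @dominated_ultralimit _ _ _ _ F FU nu m.
- move=> j B mB; rewrite -(mean_cst 0 (mp j)); apply: le_mean => // s.
  exact: fine_ge0.
- move=> j B mB; rewrite -(mean_cst (fine (nu B)) (mp j)); apply: le_mean => // s.
  apply: fine_le; [exact: fin_num_measure (mBs _ _ mB)|exact: fin_num_measure|].
  by apply: le_measure; rewrite ?inE//; exact: mBs.
- move=> j A B mA mB AB; rewrite /m -meanD; apply: eq_mean => s.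
  rewrite setIUl measureU.
  + by rewrite fineD// fin_num_measure//; exact: mBs.
  + exact: mBs.
  + exact: mBs.
  + by rewrite setIACA AB set0I.
pose L' := image_measure (mrestr (nu \x unif)%E mplays) (@measurable_fst _ _ (dprodM Y) R).
have L'E B : L' B = (nu \x unif)%E [set q | B q.1 /\ plays (fun k y => kappa k y q.2) w q.1].
  by [].
suff LL' : forall B, measurable B -> L B = L' B.
  by move=> B mB; have [H _] := HL B mB; rewrite -L'E -LL'.
apply: (dprod_measure_unique mE); first by rewrite ltey_eq fin_num_measure.
move=> e.
have mbox : measurable (box (fun k => meets (E k) (e k))).
  by apply: measurable_box => k; exact: measurable_meets (mE k) _.
pose phi : {ffun 'I_N -> seq nat * seq bool} := [ffun k => (e k, w k)].
have [HLb _] := HL _ mbox.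
rewrite -[LHS]fineK ?fin_num_measure//.
have -> : fine (L (box (fun k => meets (E k) (e k)))) = \int[unif]_t g (inl phi) t.
  apply: (cvg_unique (@Rhausdorff R) HLb).
  rewrite (_ : m^~ _ = fun j => mean (p j) (f (inl phi))); first exact: mean_g.
  apply/funext => j; apply: eq_mean => s; rewrite boxI nu_box//= /M.
  by apply: eq_bigr => k _; rewrite ffunE.
(* The point of convergence for every [t]: on each branch the limit of the product is the product of
   the limits. *)
have gphi t : g (inl phi) t = \prod_(k < N) g (inr (k, e k, w k)) t.
  apply: (cvg_unique (@Rhausdorff R) (cvg_g (inl phi) t)).
  rewrite (_ : (fun _ => _) = (fun n => \prod_(k < N) f (inr (k, e k, w k)) (r (prefix (X t) n)))).
    apply: cvg_big => [|k _]; first exact: mul_continuous.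
    exact: cvg_g.
  by apply/funext => n /=; apply: eq_bigr => k _; rewrite ffunE.
have g1 i t : `|g i t| <= 1 by have /andP[? ?] := g01 i t; rewrite ger0_norm.
rewrite -(integral_EFin (mg _) (g1 _)) L'E.
pose mm k t x := Q k (meets (E k) (e k) `&` [set y | cylinder (w k) (kappa0 k (y, t) x)]).
have mmm k : measurable_fun [set: R * R] (fun q => mm k q.1 q.2).
  have mD : measurable [set z : Y k * (R * R) | meets (E k) (e k) z.1 /\
      cylinder (w k) (kappa0 k (z.1, z.2.1) z.2.2)].
    apply: (@measurableI _ _ (fst @^-1` meets (E k) (e k))).
      rewrite -[X in measurable X]setTI; apply: measurable_fst => //.
      exact: measurable_meets (mE k) _.
    have H : measurable_fun [set: Y k * (R * R)] (fun z => kappa0 k (z.1, z.2.1) z.2.2).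
      apply: (measurableT_comp (mkappa0 k)
        (g := fun z : Y k * (R * R) => ((z.1, z.2.1), z.2.2))).
      apply: measurable_fun_pair; last exact: (measurableT_comp measurable_snd measurable_snd).
      apply: measurable_fun_pair; first exact: measurable_fst.
      exact: (measurableT_comp measurable_fst measurable_snd).
    by have := H measurableT _ (measurable_cylinder (w k)); rewrite setTI.
  have := @measurable_fun_section2 _ _ _ _ _ (Q k) _ mD.
  by apply: eq_measurable_fun => -[t x] _.
(* [indep] expects factors indexed by all natural numbers, so the family is continued by 1 beyond
   the team. *)
pose ext (i : nat) t x := if insub i is Some k then mm k t x else 1%E.
have mext i : measurable_fun [set: R * R] (fun q => ext i q.1 q.2).
  by rewrite /ext; case: insub => [k|]; [exact: mmm|exact: measurable_cst].
have ext0 i t x : (0 <= ext i t x)%E by rewrite /ext; case: insub.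
have extE (k : 'I_N) t x : ext k t x = mm k t x by rewrite /ext valK.
rewrite (product_measure_sectionE2 nu unif); last first.
  apply: (@measurableI _ _ (fst @^-1` box (fun k => meets (E k) (e k)))) => //.
  by rewrite -[X in measurable X]setTI; exact: measurable_fst.
transitivity (\int[unif]_t \prod_(k < N) \int[unif]_x ext k t x)%E.
  apply: ge0_ae_eq_integral => //.
  - by apply/measurable_EFinP; exact: mg.
  - apply: emeasurable_prod => k.
    exact: (measurable_fun_fubini_tonelli_F (m2 := unif) _ (mext k)).
  - by move=> t _; rewrite lee_fin; case/andP: (g01 (inl phi) t).
  - by move=> t _; apply: prode_ge0 => k _; exact: integral_ge0.
  have := ae_forall_countable (fun k => lim_kappa0 k (e k) (w k)).
  apply: filterS => t Ht _; rewrite gphi -prodEFin; apply: eq_bigr => k _.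
  by rewrite -Ht; apply: eq_integral => x _; rewrite extE.
rewrite -indep//; apply: eq_integral => z _.
rewrite [RHS](_ : _ = nu (box (fun k => meets (E k) (e k) `&`
  [set y | cylinder (w k) (kappa k y z)]))); last by rewrite -boxI.
rewrite nuE; first by apply: eq_bigr => k _; rewrite extE.
move=> k; apply: measurableI; first exact: measurable_meets (mE k) _.
have mk : measurable_fun [set: Y k] (fun y => kappa k y z).
  exact: (measurableT_comp (mkappa k)
    (measurable_fun_pair (@measurable_id _ (Y k) setT) (measurable_cst z))).
by have := mk measurableT _ (measurable_cylinder (w k)); rewrite setTI.
Qed.

End TeamLimit.
Arguments act {N dY Y} s k y.
Arguments measurable_act {N dY Y} s k.

Import HBSimple.

(** * Densities, image measures and approximation of dominated measures *)

Section Density.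
Context {d} {T : measurableType d} {R : realType} (m : {finite_measure set T -> \bar R}).
Context (g : T -> R) (mg : measurable_fun setT g) (g0 : forall x, 0 <= g x)
  (M : R) (gM : forall x, g x <= M).

Definition density_measure (A : set T) : \bar R := (\int[m]_(x in A) (g x)%:E)%E.

Let density0 : density_measure set0 = 0%E. Proof. exact: integral_set0. Qed.

Let density_ge0 A : (0 <= density_measure A)%E.
Proof. by apply: integral_ge0 => x _; rewrite lee_fin. Qed.

Let density_sigma_additive : semi_sigma_additive density_measure.
Proof.
move=> /= F mF tF mUF; rewrite /density_measure; apply: cvg_toP.
  apply: ereal_nondecreasing_is_cvgn => k n kn.
  apply: lee_sum_nneg_natr => // i _ _.
  by apply: integral_ge0 => /= x Fkx; rewrite lee_fin.
rewrite ge0_integral_bigcup//=.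
- by apply/measurable_EFinP; exact: measurable_funTS.
- by move=> x _; rewrite lee_fin.
Qed.

HB.instance Definition _ := isMeasure.Build _ _ _ density_measure
  density0 density_ge0 density_sigma_additive.

Let density_fin : fin_num_fun density_measure.
Proof.
move=> A mA; apply: integrable_fin_num => //; apply: integrableS (bounded_integrable mg _) => //.
by move=> x; rewrite ger0_norm//; exact: gM.
Qed.

HB.instance Definition _ := @Measure_isFinite.Build _ _ _ density_measure density_fin.

Lemma weighted_measure : exists L : {finite_measure set T -> \bar R},
  forall A, L A = (\int[m]_(x in A) (g x)%:E)%E.
Proof. by exists density_measure. Qed.

End Density.

Section FromMeasure.
Context {d} {T : measurableType d} {R : realType} (m : {measure set T -> \bar R}).

Let copy (A : set T) : \bar R := m A.

HB.instance Definition _ := isMeasure.Build _ _ _ copy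
  (measure0 m) (measure_ge0 m) (@measure_semi_sigma_additive _ _ _ m).

Lemma probability_of_measure : m setT = 1%E ->
  exists P : probability T R, forall A, P A = m A.
Proof.
move=> m1; pose mixin := @Measure_isProbability.Build _ _ _ copy m1.
by pose P : probability T R := HB.pack copy mixin; exists P.
Qed.

End FromMeasure.

Section FiniteImage.
Context {d1 d2} {T1 : measurableType d1} {T2 : measurableType d2} {R : realType}
  (m : {finite_measure set T1 -> \bar R}) (f : T1 -> T2) (mf : measurable_fun setT f).

Let image (A : set T2) : \bar R := image_measure m mf A.

HB.instance Definition _ := isMeasure.Build _ _ _ image
  (measure0 _) (measure_ge0 _) (@measure_semi_sigma_additive _ _ _ (image_measure m mf)).

Let image_fin : fin_num_fun image.
Proof.
move=> A mA; rewrite /image /= /pushforward fin_num_measure//.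
by rewrite -[X in measurable X]setTI; exact: mf.
Qed.

HB.instance Definition _ := @Measure_isFinite.Build _ _ _ image image_fin.

Lemma finite_image_measure : exists L : {finite_measure set T2 -> \bar R},
  forall A, L A = m (f @^-1` A).
Proof. by exists image. Qed.

End FiniteImage.

(** The density of [theta] is approximated in L1 by a simple function, with level sets [A i] and
    values [c i]. The error is uniform in [B], so it survives averaging over strategies. *)
Lemma dominated_approximation d (T : measurableType d) (R : realType)
    (theta nu : {finite_measure set T -> \bar R}) (e : R) : theta `<< nu -> 0 < e ->
  exists (n : nat) (c : 'I_n -> R) (A : 'I_n -> set T), (forall i, measurable (A i)) /\
    forall B, measurable B ->
      `|fine (theta B) - \sum_(i < n) c i * fine (nu (B `&` A i))| <= e.
Proof.
move=> tn e0; have [f [f0 ffin intf fE]] := radon_nikodym_sigma_finite tn.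
have [h [inth _ hf]] := approximation_sfun_integrable measurableT intf.
have mf : measurable_fun setT f := measurable_int _ intf.
have intd n : nu.-integrable setT (fun z => f z - (h n z)%:E)%E.
  exact: (integrableB measurableT intf (inth n)).
have [n Hn] : exists n, (\int[nu]_z `|f z - (h n z)%:E| <= e%:E)%E.
  have hf' : (fun n => fine (\int[nu]_z `|f z - (h n z)%:E|)%E) @ \oo --> (0 : R).
    exact: (@fine_cvg _ _ _ _ _ 0 hf).
  move/cvgrPdist_le : hf' => /(_ _ e0) [n _ /(_ n (leqnn n))].
  rewrite sub0r normrN /= => H; exists n.
  have fin : (\int[nu]_z `|f z - (h n z)%:E|)%E \is a fin_num.
    by apply: integrable_fin_num => //; exact: integrable_abse.
  by rewrite -(fineK fin) lee_fin; apply: le_trans H; exact: ler_norm.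
pose l := fset_set (h n @` setT).
exists #|` l|, (fun i => l`_i), (fun i => h n @^-1` [set l`_i]); split.
  by move=> i; exact: measurable_sfunP.
move=> B mB.
have mBA i : measurable (B `&` h n @^-1` [set l`_i]).
  by apply: measurableI => //; exact: measurable_sfunP.
have intB : nu.-integrable B f by exact: integrableS intf.
have inthB : nu.-integrable B (EFin \o h n) by apply: integrableS (inth n).
have -> : \sum_(i < #|` l|) l`_i * fine (nu (B `&` h n @^-1` [set l`_i])) =
    fine (\int[nu]_(x in B) (h n x)%:E)%E.
  rewrite -[RHS]/(\int[nu]_(x in B) h n x) Rintegral_mkcond.
  transitivity (\int[nu]_x \sum_(i < #|` l|) l`_i * \1_(B `&` h n @^-1` [set l`_i]) x).
    rewrite (@Rintegral_sum _ _ _ nu _ _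
      (fun (i : 'I_#|` l|) x => l`_i * \1_(B `&` h n @^-1` [set l`_i]) x) (fun i => `|l`_i|)).
    - apply: eq_bigr => i _; rewrite RintegralZl//; last first.
        apply: (bounded_integrable (M := 1)); first exact: measurable_indic.
        by move=> x; rewrite indicE; case: (_ \in _); rewrite ?normr1 ?normr0.
      by rewrite /Rintegral integral_indic// setIT.
    - by move=> i; apply: measurable_funM => //; exact: measurable_indic.
    - move=> i x; rewrite normrM ler_piMr//.
      by rewrite indicE; case: (_ \in _); rewrite ?normr1 ?normr0.
  apply: eq_Rintegral => x _; rewrite patchE.
  case: ifP => [/set_mem Bx|/negP nBx].
    rewrite [RHS]fimfunEord; apply: eq_bigr => i _; congr (_ * _).
    by rewrite !indicE in_setI (mem_set Bx).
  rewrite big1// => i _; rewrite indicE in_setI.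
  have -> : (x \in B) = false by apply/negP.
  by rewrite mulr0.
have intdB : nu.-integrable B (fun z => f z - (h n z)%:E)%E by exact: integrableS (intd n).
have dfin : (\int[nu]_(x in B) (f x - (h n x)%:E))%E \is a fin_num by exact: integrable_fin_num.
rewrite fE// -fineB ?integrable_fin_num// -(integralB mB intB inthB) -fine_abse//.
rewrite -lee_fin fineK ?abse_fin_num//; apply: le_trans Hn.
apply: (le_trans (le_abse_integral _ mB (measurable_int _ intdB))).
by apply: ge0_subset_integral => //; apply/measurableT_comp => //; exact: measurable_int (intd n).
Qed.

(** * Convergence of expected costs against a fixed opponent *)

Definition truncate (l : nat) (x : cantor) : cantor := fun i => if (i < l)%N then x i else false.

Lemma prefix_truncate l n x : (n <= l)%N -> prefix (truncate l x) n = prefix x n.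
Proof.
by move=> nl; apply: eq_prefix => i iltn; rewrite /truncate (leq_trans iltn nl).
Qed.

Lemma extend_prefixE l x : extend (prefix x l) = truncate l x.
Proof.
apply/funext => i; rewrite /truncate; case: ltnP => li; first exact: extend_prefix.
by rewrite /extend nth_default// size_rev size_prefix.
Qed.

Section TeamLimitIntegral.
Context {R : realType} {N : nat} {dY : 'I_N -> measure_display}
  {Y : forall k, measurableType (dY k)}.
Local Notation strategy := (@strategy N dY Y).
Context (nu : probability (dprodM Y) R).
Context (I : Type) (F : set_system I) (FU : UltraFilter F) (p : I -> seq (R * strategy)).
Hypothesis mp : forall i, mixture (p i).
Context (kappa : forall k, Y k -> R -> cantor).
Arguments kappa : clear implicits.
Hypothesis mkappa : measurable_team kappa.
Hypothesis limit_nu : forall w B, measurable B ->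
  (fun j => mean (p j) (fun s => fine (nu (B `&` plays (act s) w)))) @ F -->
  fine ((nu \x unif)%E [set q | B q.1 /\ plays (fun k y => kappa k y q.2) w q.1]).

Local Notation kappa_at z := (fun k y => kappa k y z).

Let measurable_kappa_plays w z : measurable (plays (kappa_at z) w).
Proof. exact: (measurable_setX2 z (measurable_team_plays w mkappa)). Qed.

Let measurable_fun_kappa_plays (m : {finite_measure set (dprodM Y) -> \bar R}) w B :
  measurable B -> measurable_fun [set: R] (fun z => fine (m (B `&` plays (kappa_at z) w))).
Proof.
move=> mB; apply: (measurableT_comp (@fine_measurable _ setT measurableT)).
apply: (@measurable_fun_section2 _ _ _ _ _ m
  [set q : dprodM Y * R | B q.1 /\ plays (kappa_at q.2) w q.1]).
apply: (@measurableI _ _ (fst @^-1` B)); last exact: measurable_team_plays.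
by rewrite -[X in measurable X]setTI; exact: measurable_fst.
Qed.

Let fine_bound (m : {finite_measure set (dprodM Y) -> \bar R}) A : measurable A ->
  `|fine (m A)| <= fine (m setT).
Proof.
move=> mA; rewrite ger0_norm ?fine_ge0//.
by apply: fine_le; rewrite ?fin_num_measure//; apply: le_measure; rewrite ?inE.
Qed.

(** A finite combination of restrictions of [nu] replaces [theta] up to [e / 3], uniformly over pure
    strategies and random numbers; for that combination the limit is known. *)
Lemma team_limit_dominated (theta : {finite_measure set (dprodM Y) -> \bar R}) w :
  theta `<< nu ->
  (fun j => mean (p j) (fun s => fine (theta (plays (act s) w)))) @ F -->
  \int[unif]_z fine (theta (plays (kappa_at z) w)).
Proof.
move=> tn; apply/cvgrPdist_le => e e0.
have e30 : 0 < e / 3 by rewrite divr_gt0.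
have [n [c [A [mA HA']]]] := dominated_approximation tn e30.
have HA B : measurable B -> `|fine (theta B) - \sum_(i < n) c i * fine (nu (A i `&` B))| <= e / 3.
  by move=> mB; under eq_bigr do rewrite setIC; exact: HA'.
pose b i (s : forall k, Y k -> cantor) := c i * fine (nu (A i `&` plays s w)).
have lim_b : (fun j => mean (p j) (fun s => \sum_(i < n) b i (act s))) @ F -->
    \int[unif]_z \sum_(i < n) b i (kappa_at z).
  have mb i : measurable_fun [set: R] (fun z => fine (nu (A i `&` plays (kappa_at z) w))).
    exact: measurable_fun_kappa_plays.
  have bb i z : `|fine (nu (A i `&` plays (kappa_at z) w))| <= fine (nu setT).
    by apply: fine_bound; exact: measurableI.
  rewrite (@Rintegral_sum _ _ _ unif _ _ (fun i z => b i (kappa_at z))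
    (fun i => `|c i| * fine (nu setT))); last 2 first.
  - by move=> i; exact: measurable_funM.
  - by move=> i z; rewrite normrM ler_wpM2l.
  under eq_fun do rewrite mean_sum.
  apply: cvg_big => [|i _]; first exact: add_continuous.
  rewrite RintegralZl//; last exact: bounded_integrable (mb i) (bb i).
  under eq_fun do rewrite meanZ; apply: cvgMr.
  have := @limit_nu w _ (mA i).
  rewrite (product_measure_sectionE2 nu unif); last first.
    apply: (@measurableI _ _ (fst @^-1` A i)); last exact: measurable_team_plays.
    by rewrite -[X in measurable X]setTI; exact: measurable_fst.
  suff -> : (\int[unif]_z nu [set y | A i y /\ plays (kappa_at z) w y])%E =
    (\int[unif]_z (fine (nu (A i `&` plays (kappa_at z) w)))%:E)%E by [].
  apply: eq_integral => z _; rewrite fineK// fin_num_measure//; exact: measurableI.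
have near_mean j : `|mean (p j) (fun s => fine (theta (plays (act s) w))) -
    mean (p j) (fun s => \sum_(i < n) b i (act s))| <= e / 3.
  by rewrite -meanB; apply: norm_mean_le => // s; apply: HA; exact: measurable_plays.
have near_int : `|\int[unif]_z fine (theta (plays (kappa_at z) w)) -
    \int[unif]_z \sum_(i < n) b i (kappa_at z)| <= e / 3.
  rewrite -[leRHS]mulr1 -[X in _ * X]/(fine 1%E) -(probability_setT (unif : probability R R)).
  apply: (dist_Rintegral_le (Mf := fine (theta setT))
    (Mg := \sum_(i < n) `|c i| * fine (nu setT))).
  - by have := measurable_fun_kappa_plays theta w measurableT; under eq_fun do rewrite setTI.
  - apply: measurable_sum => i; apply: measurable_funM => //.
    exact: measurable_fun_kappa_plays.
  - by move=> z; exact: fine_bound.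
  - move=> z; apply: (le_trans (ler_norm_sum _ _ _)); apply: ler_sum => i _.
    by rewrite normrM ler_wpM2l//; apply: fine_bound; exact: measurableI.
  - by move=> z; exact: HA.
move/cvgrPdist_le : lim_b => /(_ _ e30); apply: filterS => j.
move: (near_mean j) near_int.
set x := mean _ _; set y := mean _ _; set x' := \int[unif]_z _; set y' := \int[unif]_z _.
rewrite !ler_norml => /andP[? ?] /andP[? ?] /andP[? ?]; apply/andP; split; lra.
Qed.

Local Notation profile := (dprodM (fun _ : 'I_N => (cantor : measurableType _))).

Context {dX : measure_display} {X : measurableType dX} (mu : probability X R).
Context (obs : X -> dprodM Y) (mobs : measurable_fun [set: X] obs).
Hypothesis mu_nu : forall A, measurable A -> nu A = 0%E -> mu (obs @^-1` A) = 0%E.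
Context (G : X -> profile -> R) (M : R).
Hypothesis mG : measurable_fun [set: X * profile] (fun q => G q.1 q.2).
Hypothesis G0 : forall x u, 0 <= G x u.
Hypothesis GM : forall x u, G x u <= M.
Hypothesis contG : forall x e, 0 < e -> exists n, forall u u' : profile,
  (forall k, prefix (u k) n = prefix (u' k) n) -> `|G x u - G x u'| <= e.

Let normG x u : `|G x u| <= M. Proof. by rewrite ger0_norm. Qed.

Let measurable_G (u : X -> profile) : measurable_fun [set: X] u ->
  measurable_fun [set: X] (fun x => G x (u x)).
Proof.
by move=> mu'; exact: (measurableT_comp mG (measurable_fun_pair (@measurable_id _ X setT) mu')).
Qed.

Let trunc l (u : profile) : profile := fun k => truncate l (u k).

Let word_profile (W : {ffun 'I_N -> seq bool}) : profile := fun k => extend (W k).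

Let truncE l (u : profile) : trunc l u = word_profile [ffun k => prefix (u k) l].
Proof.
by apply: functional_extensionality_dep => k; rewrite /word_profile ffunE extend_prefixE.
Qed.

Let measurable_trunc dZ (Z : measurableType dZ) l (u : Z -> profile) :
  measurable_fun [set: Z] u -> measurable_fun [set: Z] (fun x => trunc l (u x)).
Proof.
move=> mu'; apply: measurable_fun_dprod => k; apply: measurable_fun_dprod => i.
rewrite /trunc /truncate; case: (i < l)%N => //.
have muk : measurable_fun [set: Z] (fun x => u x k).
  exact: (measurableT_comp (@measurable_dproj _ _ (fun _ : 'I_N => (cantor : measurableType _)) k) mu').
exact: (measurableT_comp (@measurable_dproj _ _ (fun _ : nat => (bool : measurableType _)) i) muk).
Qed.

(* Continuity in the actions is uniform over strategies up to a set of small measure. *)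
Let uniform_truncation e : 0 < e -> exists l, forall u : X -> profile,
  measurable_fun [set: X] u ->
  `|\int[mu]_x G x (u x) - \int[mu]_x G x (trunc l (u x))| <= e.
Proof.
move=> e0.
have M0 : 0 <= M by apply: le_trans (GM point point).
(* The total error is [d + d] on the good set plus at most [M] on a bad set of mass at most [d],
   that is [(2 + M) * d = e]. *)
pose d := e / (2 + M).
have d0 : 0 < d by rewrite divr_gt0// ltr_wpDr.
pose agree l (W W' : {ffun 'I_N -> seq bool}) :=
  forall k, prefix (extend (W k)) l = prefix (extend (W' k)) l.
(* Continuity is tested only on profiles given by finite words, so that [B l] is a countable
   intersection of measurable sets. Passing from words to arbitrary profiles costs a second [d] in
   [close]. *)
pose B l := [set x | forall W W', agree l W W' ->
  `|G x (word_profile W) - G x (word_profile W')| <= d].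
have mB l : measurable (B l).
  rewrite (_ : B l = \bigcap_(V in setT) [set x | agree l V.1 V.2 ->
      `|G x (word_profile V.1) - G x (word_profile V.2)| <= d]); last first.
    by apply/seteqP; split=> x Bx; [move=> [W W'] _; exact: Bx|move=> W W'; exact: (Bx (W, W'))].
  rewrite -[X in measurable X]setCK setC_bigcap; apply: measurableC.
  apply: countable_bigcupT_measurable => [|V]; first exact: countableP.
  apply: measurableC; have [a|na] := pselect (agree l V.1 V.2); last first.
    by rewrite (_ : [set _ | _] = setT)//; apply/seteqP; split=> // x _ /na.
  rewrite (_ : [set _ | _] =
    (fun x => `|G x (word_profile V.1) - G x (word_profile V.2)| <= d) @^-1` [set true]).
    rewrite -[X in measurable X]setTI.
    apply: (measurable_fun_ler (D := setT)) => //; apply: measurableT_comp => //.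
    by apply: measurable_funB; apply: measurable_G; exact: measurable_cst.
  by apply/seteqP; split=> x /=; [move=> /(_ a)|].
have ndB : nondecreasing_seq B.
  move=> l l' ll'; apply/subsetPset => x Bx W W' a; apply: Bx => k.
  exact: prefix_le ll' (a k).
have UB : \bigcup_l B l = setT.
  apply/seteqP; split=> // x _; have [n Hn] := contG x d0.
  by exists n => // W W' a; apply: Hn.
have [l Bl] : exists l, fine (mu (~` B l)) <= d.
  have H : fine \o (mu \o B) @ \oo --> fine (mu setT).
    apply: fine_cvg; rewrite fineK ?fin_num_measure// -UB.
    apply: nondecreasing_cvg_mu => //; rewrite UB; exact: measurableT.
  have /cvgrPdist_le /(_ _ d0) [l _ /(_ l (leqnn l)) /=] := H.
  move=> Hl; exists l; apply: le_trans Hl; rewrite probability_setC//.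
  rewrite probability_setT fineB ?fin_num_measure//; exact: ler_norm.
exists l => u mu'.
have mut := measurable_trunc l mu'.
have close x : B l x -> `|G x (u x) - G x (trunc l (u x))| <= d + d.
  move=> Blx; have [n0 Hn0] := contG x d0; pose n := maxn l n0.
  rewrite -[X in X - _](subrK (G x (trunc n (u x)))) -addrA.
  apply: (le_trans (ler_normD _ _)); apply: lerD.
    by apply: Hn0 => k; rewrite prefix_truncate// leq_maxr.
  rewrite !truncE; apply: Blx => k; rewrite !ffunE !extend_prefixE.
  by rewrite !prefix_truncate// leq_maxl.
pose h x := (d + d) + M * \1_(~` B l) x.
have mh : measurable_fun [set: X] h.
  apply: measurable_funD => //; apply: measurable_funM => //.
  by apply: measurable_indic; exact: measurableC.
have h1 x : `|\1_(~` B l) x| <= 1 :> R.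
  by rewrite indicE; case: (_ \in _); rewrite ?normr1 ?normr0.
have intu : mu.-integrable setT (EFin \o (fun x => G x (u x))).
  by apply: (bounded_integrable (M := M)) => //; exact: measurable_G.
have intt : mu.-integrable setT (EFin \o (fun x => G x (trunc l (u x)))).
  by apply: (bounded_integrable (M := M)) => //; exact: measurable_G.
rewrite -RintegralB//.
have mdiff : measurable_fun [set: X] (fun x => G x (u x) - G x (trunc l (u x))).
  by apply: measurable_funB; exact: measurable_G.
have diffM x : `|G x (u x) - G x (trunc l (u x))| <= M.
  rewrite ler_norml; apply/andP; split.
    by rewrite lerNl opprB lerBlDr (le_trans (GM _ _))// lerDl.
  by rewrite lerBlDr (le_trans (GM _ _))// lerDl.
apply: (le_trans (le_normr_Rintegral _ (bounded_integrable mdiff diffM))) => //.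
apply: (@le_trans _ _ (\int[mu]_x h x)).
  apply: le_Rintegral => //.
  - apply: (bounded_integrable (M := M)); first exact: measurableT_comp.
    by move=> x; rewrite normr_id.
  - apply: (bounded_integrable (M := d + d + M)) => // x.
    rewrite /h ger0_norm; last by rewrite addr_ge0 ?mulr_ge0 ?addr_ge0 ?(ltW d0).
    by rewrite lerD2l ler_piMr//.
  - move=> x _; rewrite /h indicE; case: (boolP (x \in ~` B l)) => [_|].
      by rewrite mulr1 (le_trans (diffM x))// lerDr addr_ge0 ?(ltW d0).
    by rewrite notin_setE => /contrapT/close; rewrite mulr0 addr0.
rewrite RintegralD//; last 2 first.
- by apply: (bounded_integrable (M := `|d + d|)).
- apply: (bounded_integrable (M := M)).
    by apply: measurable_funM => //; apply: measurable_indic; exact: measurableC.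
  by move=> x; rewrite normrM ger0_norm// ler_piMr.
have muT : fine (mu setT) = 1 by rewrite probability_setT.
rewrite Rintegral_cst// [X in _ * X + _]muT mulr1 RintegralZl//; last first.
  by apply: (bounded_integrable (M := 1)) => //; apply: measurable_indic; exact: measurableC.
rewrite /Rintegral integral_indic//; last exact: measurableC.
rewrite setIT (_ : e = (d + d) + M * d); first by rewrite lerD2l ler_wpM2l.
by rewrite -mulr2n -mulr_natl -mulrDl /d mulrC divfK// gt_eqF// ltr_wpDr.
Qed.

(** Truncated actions take finitely many values. For each value [W] the cost becomes a weight on
    [mu], and [theta W] is the image of the weighted measure under [obs]; it is dominated by [nu]
    because the law of the measurements is. *)
Let integral_trunc l : exists theta : {ffun 'I_N -> l.-tuple bool} ->
    {finite_measure set (dprodM Y) -> \bar R},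
  (forall W, theta W `<< nu) /\ forall s : forall k, Y k -> cantor,
    (forall w, measurable (plays s w)) ->
    \int[mu]_x G x (trunc l (fun k => s k (obs x k))) =
    \sum_W fine (theta W (plays s (fun k => tval (W k)))).
Proof.
pose pt (W : {ffun 'I_N -> l.-tuple bool}) : profile := fun k => extend (tval (W k)).
have mGpt W : measurable_fun setT (G^~ (pt W)) by exact: measurable_G (measurable_cst _).
have mobsA A : measurable A -> measurable (obs @^-1` A).
  by move=> mA; rewrite -[X in measurable X]setTI; exact: mobs.
have /choice[theta thetaE] W : exists L : {finite_measure set (dprodM Y) -> \bar R},
    forall A, L A = (\int[mu]_(x in obs @^-1` A) (G x (pt W))%:E)%E.
  have [L0 L0E] := weighted_measure mu (mGpt W) (fun x => G0 x _) (fun x => GM x _).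
  have [L LE] := finite_image_measure L0 mobs.
  by exists L => A; rewrite LE L0E.
exists theta; split=> [W|s ms].
  apply/null_content_dominatesP => A mA A0; rewrite thetaE.
  apply: null_set_integral => //; [exact: mobsA| |exact: mu_nu].
  by apply/measurable_EFinP; exact: measurable_funTS.
pose ind (W : {ffun 'I_N -> l.-tuple bool}) x : R := \1_(obs @^-1` plays s (fun k => tval (W k))) x.
have mind W : measurable_fun setT (ind W) by apply: measurable_indic; exact: mobsA.
transitivity (\int[mu]_x \sum_W G x (pt W) * ind W x).
  apply: eq_Rintegral => x _.
  have sz k : size (prefix (s k (obs x k)) l) == l by rewrite size_prefix.
  rewrite (bigD1 [ffun k => Tuple (sz k)])//= big1 ?addr0.
    rewrite /ind indicE mem_set ?mulr1.
      by congr G; apply: functional_extensionality_dep => k; rewrite /pt ffunE/= extend_prefixE.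
    by move=> k; rewrite /preimage/= ffunE /cylinder/= size_prefix.
  move=> W WE; rewrite /ind indicE memNset ?mulr0// => /= H; move/negP: WE; apply.
  apply/eqP/ffunP => k; rewrite ffunE; apply/val_inj => /=.
  by have := H k; rewrite /preimage/= /cylinder/= size_tuple => ->.
rewrite (@Rintegral_sum _ _ _ mu _ _ (fun W x => G x (pt W) * ind W x) (fun=> M)).
- apply: eq_bigr => W _; rewrite thetaE -[RHS]/(\int[mu]_(x in obs @^-1` _) G x (pt W)).
  rewrite [RHS]Rintegral_mkcond; apply: eq_Rintegral => x _.
  by rewrite patchE /ind indicE; case: (_ \in _); rewrite ?mulr1 ?mulr0.
- by move=> W; exact: measurable_funM.
- move=> W x; rewrite normrM /ind indicE.
  by case: (_ \in _); rewrite ?normr1 ?normr0 ?mulr1// mulr0; exact: le_trans (GM x point).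
Qed.

(** Truncation costs at most [e / 3] for the mixtures and for the limit alike; the truncated cost is
    a finite sum of masses of dominated measures. *)
Lemma team_limit_integral :
  (fun j => mean (p j) (fun s => \int[mu]_x G x (fun k => act s k (obs x k)))) @ F -->
  \int[unif]_z \int[mu]_x G x (fun k => kappa k (obs x k) z).
Proof.
apply/cvgrPdist_le => e e0.
have e30 : 0 < e / 3 by rewrite divr_gt0.
have [l Hl] := uniform_truncation e30.
have [theta [theta_nu thetaE]] := integral_trunc l.
have mobsk k : measurable_fun [set: X] (fun x => obs x k).
  exact: (measurableT_comp (@measurable_dproj _ _ Y k) mobs).
have mact s : measurable_fun [set: X] (fun x => (fun k => act s k (obs x k)) : profile).
  by apply: measurable_fun_dprod => k; exact: (measurableT_comp (measurable_act s k) (mobsk k)).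
have mkap : measurable_fun [set: R * X]
    (fun q => (fun k => kappa k (obs q.2 k) q.1) : profile).
  apply: measurable_fun_dprod => k.
  exact: (measurableT_comp (@mkappa k) (measurable_fun_pair
    (measurableT_comp (mobsk k) (@measurable_snd _ _ R X)) (@measurable_fst _ _ R X))).
have mkapz z : measurable_fun [set: X] (fun x => (fun k => kappa k (obs x k) z) : profile).
  exact: (measurableT_comp mkap (measurable_fun_pair (measurable_cst z) (@measurable_id _ X setT))).
have lim_l : (fun j => mean (p j)
      (fun s => \int[mu]_x G x (trunc l (fun k => act s k (obs x k))))) @ F -->
    \int[unif]_z \int[mu]_x G x (trunc l (fun k => kappa k (obs x k) z)).
  have E1 j : mean (p j) (fun s => \int[mu]_x G x (trunc l (fun k => act s k (obs x k)))) =
      \sum_W mean (p j) (fun s => fine (theta W (plays (act s) (fun k => tval (W k))))).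
    rewrite -mean_sum; apply: eq_mean => s; rewrite thetaE// => w.
    exact: measurable_plays.
  have E2 z : \int[mu]_x G x (trunc l (fun k => kappa k (obs x k) z)) =
      \sum_W fine (theta W (plays (kappa_at z) (fun k => tval (W k)))).
    by rewrite -thetaE.
  under eq_fun do rewrite E1; under eq_Rintegral do rewrite E2.
  rewrite (@Rintegral_sum _ _ _ unif _ _
    (fun W z => fine (theta W (plays (kappa_at z) (fun k => tval (W k)))))
    (fun W => fine (theta W setT))).
  - apply: cvg_big => [|W _]; first exact: add_continuous.
    exact: team_limit_dominated.
  - move=> W; have := measurable_fun_kappa_plays (theta W) (fun k => tval (W k)) measurableT.
    by under eq_fun do rewrite setTI.
  - by move=> W z; exact: fine_bound.
have muT : fine (mu setT) = 1 by rewrite probability_setT.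
have near_mean j : `|mean (p j) (fun s => \int[mu]_x G x (fun k => act s k (obs x k))) -
    mean (p j) (fun s => \int[mu]_x G x (trunc l (fun k => act s k (obs x k))))| <= e / 3.
  by rewrite -meanB; apply: norm_mean_le => // s; exact: Hl (mact s).
have mI (u : R -> X -> profile) : measurable_fun [set: R * X] (fun q => u q.1 q.2) ->
    measurable_fun [set: R] (fun z => \int[mu]_x G x (u z x)).
  move=> mu'; apply: (measurableT_comp (@fine_measurable _ setT measurableT)).
  apply: (@measurable_fun_fubini_tonelli_F _ _ _ _ _ mu
    (fun q : R * X => (G q.2 (u q.1 q.2))%:E)) => [|q]; last by rewrite lee_fin.
  apply/measurable_EFinP.
  exact: (measurableT_comp mG (measurable_fun_pair (@measurable_snd _ _ R X) mu')).
have bI (u : X -> profile) : measurable_fun [set: X] u -> `|\int[mu]_x G x (u x)| <= M.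
  move=> mu'; rewrite -[leRHS]mulr1 -muT; apply: norm_Rintegral_le => //.
  exact: measurable_G.
have near_int : `|\int[unif]_z \int[mu]_x G x (fun k => kappa k (obs x k) z) -
    \int[unif]_z \int[mu]_x G x (trunc l (fun k => kappa k (obs x k) z))| <= e / 3.
  rewrite -[leRHS]mulr1 -[X in _ * X]/(fine 1%E) -(probability_setT (unif : probability R R)).
  apply: (dist_Rintegral_le (Mf := M) (Mg := M)).
  - exact: mI mkap.
  - apply: (mI (fun z x => trunc l (fun k => kappa k (obs x k) z))).
    exact: (measurable_trunc l mkap).
  - by move=> z; exact: bI (mkapz z).
  - by move=> z; exact: bI (measurable_trunc l (mkapz z)).
  - by move=> z; exact: Hl (mkapz z).
move/cvgrPdist_le : lim_l => /(_ _ e30); apply: filterS => j.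
move: (near_mean j) near_int.
set x := mean _ _; set y := mean _ _; set x' := \int[unif]_z _; set y' := \int[unif]_z _.
rewrite !ler_norml => /andP[? ?] /andP[? ?] /andP[? ?]; apply/andP; split; lra.
Qed.

End TeamLimitIntegral.

(** * Compact spaces as images of the Cantor space *)

Lemma cvg_pointwise {I : Type} {K : I -> topologicalType} {T : Type}
    (F : set_system T) (FF : Filter F) (f : T -> prod_topology K) (x : prod_topology K) :
  (forall i, (fun t => f t i) @ F --> x i) -> f @ F --> x.
Proof.
move=> H; apply/cvg_sup => i U [? /= [[W oW <-]]] /= Wx /filterS; apply.
by apply: (H i); exact: open_nbhs_nbhs.
Qed.

Lemma nbhs_cantor (x : cantor_space) (A : set cantor_space) :
  nbhs x A -> exists n, cylinder (prefix x n) `<=` A.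
Proof.
pose F : set_system cantor_space := filter_from setT (fun n => cylinder (prefix x n)).
have FF : Filter F.
  apply: filter_from_filter; first by exists 0%N.
  move=> m n _ _; exists (maxn m n) => // y /=; rewrite /cylinder/= !size_prefix => xy.
  by split; apply: prefix_le xy; rewrite ?leq_maxl ?leq_maxr.
suff H : F --> x by move=> /H [n _ xA]; exists n.
apply: (@cvg_pointwise _ _ _ F FF id x) => i B xB.
exists i.+1 => // y; rewrite /cylinder/= size_prefix => -[yx _].
by rewrite /preimage/= yx; exact: nbhs_singleton.
Qed.

Lemma closed_cylinder w : @closed cantor_space (cylinder w).
Proof.
elim: w => [|b w IH]; first by rewrite cylinder0; exact: closedT.
rewrite (_ : cylinder _ = (fun x : cantor => x (size w)) @^-1` [set b] `&` cylinder w).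
  apply: closedI => //; apply: (@closed_comp _ _ _ _ _ (_ : closed [set b])).
    by move=> x _; exact: (@proj_continuous _ (fun=> bool) (size w)).
  exact: discrete_closed.
by apply/seteqP; split=> x; rewrite /cylinder/= => -[-> ->].
Qed.

Section Parametrization.
Context {R : realType} (U : pseudoPMetricType R).
Hypotheses (hU : hausdorff_space U) (cU : compact [set: U]).

Lemma measurable_continuous_cantor (h : cantor_space -> U) : continuous h ->
  measurable_fun [set: cantor] (h : cantor -> borel U).
Proof.
move=> ch; apply: (@measurability _ _ cantor (borel U) setT h (@open U)) => // _ [W oW <-].
rewrite setTI (_ : h @^-1` W = \bigcup_w (if `[< cylinder w `<=` h @^-1` W >] then cylinder w else set0)).
  apply: countable_bigcupT_measurable => [|w]; first exact: countableP.
  by case: asboolP => _; [exact: measurable_cylinder|exact: measurable0].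
apply/seteqP; split=> x.
  move=> hx; have [n xn] : exists n, cylinder (prefix x n) `<=` h @^-1` W.
    by apply: nbhs_cantor; apply: ch; exact: open_nbhs_nbhs.
  by exists (prefix x n) => //; case: asboolP => // _; rewrite /cylinder/= size_prefix.
by case=> w _; case: asboolP => // H; exact: H.
Qed.

(* The section selects the leftmost point of each fibre. *)
Fixpoint leftmost (h : cantor_space -> U) (u : U) (n : nat) : seq bool :=
  if n is m.+1 then
    let w := leftmost h u m in ~~ `[< (h @` cylinder (false :: w)) u >] :: w
  else [::].

(** Images of cylinders are compact, hence closed, so each bit of [sel] is decided by Borel
    conditions. Every cylinder around [sel u] meets the fibre of [u], and the fibre is closed, so it
    contains [sel u]. *)
Lemma compact_parametrization : exists (h : cantor_space -> U) (sel : borel U -> cantor),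
  [/\ continuous h, measurable_fun [set: borel U] sel & forall u, h (sel u) = u].
Proof.
have [h ch] := cantor_surj cU hU.
pose sel u : cantor := fun n => head false (leftmost h u n.+1).
have prefix_sel u n : prefix (sel u) n = leftmost h u n by elim: n => //= n ->.
have closed_image w : closed (h @` cylinder w).
  apply: compact_closed => //; apply: (@continuous_compact cantor_space U h (cylinder w)).
    exact: continuous_subspaceT.
  exact: (subclosed_compact (@closed_cylinder w) cantor_space_compact).
exists h, sel; split=> //.
- apply: measurable_fun_dprod => n; apply: (measurable_fun_bool true).
  rewrite setTI (_ : _ @^-1` _ = \bigcup_w [set u | leftmost h u n.+1 = true :: w]); last first.
    apply/seteqP; split=> [u /= un|u [w _ /=]].
      by exists (leftmost h u n) => //=; rewrite -un.
    by rewrite /sel/= => -[-> _].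
  apply: countable_bigcupT_measurable => [|w]; first exact: countableP.
  elim: {n w}n.+1 (true :: w) => [|n IH] w.
    case: w => [|b w]; first by rewrite (_ : [set _ | _] = setT)//; apply/seteqP; split.
    by rewrite (_ : [set _ | _] = set0)//; apply/seteqP; split.
  case: w => [|b w]; first by rewrite (_ : [set _ | _] = set0)//; apply/seteqP; split.
  have mim : measurable (h @` cylinder (false :: w) : set (borel U)).
    rewrite -[X in measurable X]setCK; apply: measurableC; apply: sub_sigma_algebra.
    exact: closed_openC.
  rewrite (_ : [set _ | _] = [set u | leftmost h u n = w] `&`
    (if b then ~` (h @` cylinder (false :: w)) else h @` cylinder (false :: w))).
    by apply: measurableI => //; case: b => //; exact: measurableC.
  apply/seteqP; split=> u /=.
    by move=> [<- ->]; case: asboolP.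
  by move=> [-> H]; congr cons; case: b H; case: asboolP.
- move=> u.
  have inv n : (h @` cylinder (leftmost h u n)) u.
    elim: n => [|n IH] /=; first by rewrite cylinder0; have [x _ <-] := @surj _ _ _ _ h u Logic.I; exists x.
    case: asboolP => //= nf; move: IH => [x]; rewrite cylinder_cons => -[xf|xt] hx.
      by exfalso; apply: nf; exists x.
    by exists x.
  have cl : closed (h @^-1` [set u] : set cantor_space).
    apply: closed_comp => [x _|]; first exact: ch.
    exact: (accessible_closed_set1 (hausdorff_accessible hU)).
  suff : (h @^-1` [set u]) (sel u) by [].
  apply: cl => A /nbhs_cantor [n An].
  have [x xc hx] := inv n; exists x; split=> //; apply: An.
  by rewrite prefix_sel.
Qed.

End Parametrization.

(** A separable metric space has a countable base, which is pulled back along [f]; injectivity makes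
    each measurable set the preimage of its Borel image. *)
Lemma standard_borel_countably_generated (R : realType) d (T : measurableType d) :
  standard_borel R T -> countably_generated T.
Proof.
move=> [M [f [_ [D [Dc Dd]] finj fpre fimg]]].
have /countable_injP[iota iota_inj] := Dc.
(* The base set with index [(i, n)] is the interior of the ball of radius [1 / (n + 1)] around the
   point of [D] numbered [i], and is empty if there is none; the interior is taken to have an open
   set. *)
pose V (i n : nat) : set M := \bigcup_(d in [set d | D d /\ iota d = i]) (ball d (n.+1%:R^-1))^°.
have oV i n : open (V i n) by apply: bigcup_open => a _; exact: open_interior.
pose up (k : nat) : nat * nat := odflt (0%N, 0%N) (@unpickle (nat * nat)%type k).
have base (W : set M) : open W ->
    W = \bigcup_(k in [set: nat]) (if `[< V (up k).1 (up k).2 `<=` W >] then V (up k).1 (up k).2 else set0).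
  move=> oW; apply/seteqP; split=> [x Wx|x [k _]]; last first.
    by case: asboolP => // H; exact: H.
  have /nbhs_ballP[e /= e0 eW] : nbhs x W by exact: open_nbhs_nbhs.
  have [n ne] : exists n, n.+1%:R^-1 < e / 2.
    have e20 : 0 < e / 2 by rewrite divr_gt0.
    have [n _ /(_ n (leqnn n))] := near_infty_natSinv_lt (PosNum e20).
    by exists n.
  pose dl : R := n.+1%:R^-1 / 2.
  have dl0 : 0 < dl by rewrite divr_gt0// invr_gt0 ltr0n.
  have dlE : n.+1%:R^-1 = dl + dl by rewrite /dl -splitr.
  have [a [Da xa]] : D `&` ball x dl !=set0.
    have : closure D x by rewrite Dd.
    by apply; exact: nbhsx_ballx.
  exists (pickle (iota a, n)) => //; rewrite /up pickleK/=.
  have VW : V (iota a) n `<=` W.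
    move=> y [a' [Da' iE] /interior_subset ay]; apply: eW.
    have E : a' = a.
      by apply: iota_inj => //; rewrite inE.
    rewrite E in ay; have := ball_triangle xa ay; apply: le_ball.
    rewrite dlE in ne *; move: ne; rewrite ltr_pdivlMr// => ne.
    by apply: le_trans (ltW ne); rewrite mulr_natr mulr2n; lra.
  case: asboolP => // _; exists a => //; rewrite /interior.
  apply: (@filterS _ _ _ (ball x dl)); last exact: nbhsx_ballx.
  move=> y xy; rewrite dlE; apply: ball_triangle xy; exact: ball_sym.
pose E (k : nat) := f @^-1` V (up k).1 (up k).2.
exists E; apply/seteqP; split=> A; last first.
  apply: smallest_sub; first exact: sigma_algebra_measurable.
  move=> _ [k _ <-]; apply: fpre; apply: sub_sigma_algebra.
  exact: oV.
move=> mA; pose C := [set B : set M | <<s range E >> (f @^-1` B)].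
have : <<s @open M >> `<=` C.
  apply: smallest_sub.
    split=> [|B CB|F CF]; rewrite /C/=.
    - by rewrite preimage_set0; exact: sigma_algebra0.
    - by rewrite setTD preimage_setC -setTD; exact: sigma_algebraCD.
    - by rewrite preimage_bigcup; exact: sigma_algebra_bigcup.
  move=> W /base ->; rewrite /C/= preimage_bigcup; apply: sigma_algebra_bigcup => k.
  case: asboolP => _; last first.
    by rewrite preimage_set0; exact: sigma_algebra0.
  by apply: sub_sigma_algebra; exists k.
move=> /(_ _ (fimg _ mA)); rewrite /C/=; congr (<<s _ >> _).
by apply/seteqP; split=> x /=; [case=> y Ay /finj <-|exists x].
Qed.

(** * The game on the Cantor space *)

Section CantorGame.
Context {R : realType} {d0 : measure_display} {O : measurableType d0} {N1 N2 : nat}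
  {dY1 : 'I_N1 -> measure_display} {Y1 : forall j, measurableType (dY1 j)}
  {dY2 : 'I_N2 -> measure_display} {Y2 : forall j, measurableType (dY2 j)}.
Local Notation profile1 := (dprodM (fun _ : 'I_N1 => (cantor : measurableType _))).
Local Notation profile2 := (dprodM (fun _ : 'I_N2 => (cantor : measurableType _))).
Local Notation strategy1 := (@strategy N1 dY1 Y1).
Local Notation strategy2 := (@strategy N2 dY2 Y2).
Context (mu : probability (O * (dprodM Y1 * dprodM Y2))%type R)
  (C : O -> profile1 -> profile2 -> R) (M : R).
Hypothesis mC : measurable_fun [set: O * (profile1 * profile2)] (fun q => C q.1 q.2.1 q.2.2).
Hypothesis C0 : forall w u1 u2, 0 <= C w u1 u2.
Hypothesis CM : forall w u1 u2, C w u1 u2 <= M.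
Hypothesis contC : forall w e, 0 < e -> exists n, forall u1 u1' u2 u2',
  (forall k, prefix (u1 k) n = prefix (u1' k) n) ->
  (forall k, prefix (u2 k) n = prefix (u2' k) n) -> `|C w u1 u2 - C w u1' u2'| <= e.
Hypotheses (cY1 : forall k, countably_generated (Y1 k))
  (cY2 : forall k, countably_generated (Y2 k)).
Context (Q1 : forall k, probability (Y1 k) R) (nu1 : probability (dprodM Y1) R).
Context (Q2 : forall k, probability (Y2 k) R) (nu2 : probability (dprodM Y2) R).
Hypothesis nu1E : forall A : (forall k, set (Y1 k)), (forall k, measurable (A k)) ->
  nu1 (box A) = (\prod_(k < N1) Q1 k (A k))%E.
Hypothesis nu2E : forall A : (forall k, set (Y2 k)), (forall k, measurable (A k)) ->
  nu2 (box A) = (\prod_(k < N2) Q2 k (A k))%E.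
Hypothesis mu_nu1 : forall A, measurable A -> nu1 A = 0%E -> mu [set x | A x.2.1] = 0%E.
Hypothesis mu_nu2 : forall A, measurable A -> nu2 A = 0%E -> mu [set x | A x.2.2] = 0%E.

Definition cantor_payoff (a1 : forall k, Y1 k -> cantor) (a2 : forall k, Y2 k -> cantor) : R :=
  \int[mu]_x C x.1 (fun k => a1 k (x.2.1 k)) (fun k => a2 k (x.2.2 k)).

Local Notation X := (O * (dprodM Y1 * dprodM Y2))%type.

Let measurable_obs1 : measurable_fun [set: X] (fun x : X => x.2.1).
Proof. exact: (measurableT_comp measurable_fst measurable_snd). Qed.

Let measurable_obs2 : measurable_fun [set: X] (fun x : X => x.2.2).
Proof. exact: (measurableT_comp measurable_snd measurable_snd). Qed.

Let measurable_profile1 (s : strategy1) :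
  measurable_fun [set: X] (fun x : X => (fun k => act s k (x.2.1 k)) : profile1).
Proof.
apply: measurable_fun_dprod => k.
exact: (measurableT_comp (measurable_act s k)
  (measurableT_comp (@measurable_dproj _ _ Y1 k) measurable_obs1)).
Qed.

Let measurable_profile2 (s : strategy2) :
  measurable_fun [set: X] (fun x : X => (fun k => act s k (x.2.2 k)) : profile2).
Proof.
apply: measurable_fun_dprod => k.
exact: (measurableT_comp (measurable_act s k)
  (measurableT_comp (@measurable_dproj _ _ Y2 k) measurable_obs2)).
Qed.

(** The pure opponent and its measurements are absorbed into the integrand, [x] comprising the state
    and all measurements. Both [kappa] and [G] are chosen before [s2], so one limit policy serves
    against every opponent. *)
Lemma cantor_payoff_limit1 (I : Type) (F : set_system I) (p : I -> seq (R * strategy1)) :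
  ProperFilter F -> (forall i, mixture (p i)) ->
  exists kappa : forall k, Y1 k -> R -> cantor, measurable_team kappa /\
    exists G : set_system I, [/\ ProperFilter G, F `<=` G & forall s2 : strategy2,
      (fun j => mean (p j) (fun s => cantor_payoff (act s) (act s2))) @ G -->
      \int[unif]_z cantor_payoff (fun k y => kappa k y z) (act s2)].
Proof.
move=> FF mp; have [G [GU FG]] := ultraFilterLemma FF.
have [kappa mk limk] := team_limit_product nu1E GU mp cY1.
exists kappa; split=> //; exists G; split=> [|//|s2]; first exact: ultra_proper.
apply: (@team_limit_integral _ _ _ _ nu1 _ _ GU _ mp kappa mk limk _ _ mu _ measurable_obs1
  mu_nu1 (fun x u => C x.1 u (fun k => act s2 k (x.2.2 k))) M) => //.
- exact: (measurableT_comp mC (measurable_fun_pair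
    (measurableT_comp measurable_fst (@measurable_fst _ _ X profile1))
    (measurable_fun_pair (@measurable_snd _ _ X profile1)
      (measurableT_comp (measurable_profile2 s2) (@measurable_fst _ _ X profile1))))).
- move=> x e e0; have [n Hn] := contC x.1 e0; exists n => u u' uu'.
  exact: Hn.
Qed.

Lemma cantor_payoff_limit2 (I : Type) (F : set_system I) (p : I -> seq (R * strategy2)) :
  ProperFilter F -> (forall i, mixture (p i)) ->
  exists kappa : forall k, Y2 k -> R -> cantor, measurable_team kappa /\
    exists G : set_system I, [/\ ProperFilter G, F `<=` G & forall s1 : strategy1,
      (fun j => mean (p j) (fun s => cantor_payoff (act s1) (act s))) @ G -->
      \int[unif]_z cantor_payoff (act s1) (fun k y => kappa k y z)].
Proof.
move=> FF mp; have [G [GU FG]] := ultraFilterLemma FF.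
have [kappa mk limk] := team_limit_product nu2E GU mp cY2.
exists kappa; split=> //; exists G; split=> [|//|s1]; first exact: ultra_proper.
apply: (@team_limit_integral _ _ _ _ nu2 _ _ GU _ mp kappa mk limk _ _ mu _ measurable_obs2
  mu_nu2 (fun x u => C x.1 (fun k => act s1 k (x.2.1 k)) u) M) => //.
- exact: (measurableT_comp mC (measurable_fun_pair
    (measurableT_comp measurable_fst (@measurable_fst _ _ X profile2))
    (measurable_fun_pair
      (measurableT_comp (measurable_profile1 s1) (@measurable_fst _ _ X profile2))
      (@measurable_snd _ _ X profile2)))).
- move=> x e e0; have [n Hn] := contC x.1 e0; exists n => u u' uu'.
  exact: Hn.
Qed.

Let J (s1 : strategy1) (s2 : strategy2) := cantor_payoff (act s1) (act s2).

Let J_ge0 s1 s2 : 0 <= J s1 s2.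
Proof. by apply: Rintegral_ge0. Qed.

Let J_leM s1 s2 : `|J s1 s2| <= M.
Proof.
have muT : fine (mu setT) = 1 by rewrite probability_setT.
rewrite -[leRHS]mulr1 -muT; apply: norm_Rintegral_le => [|x]; last by rewrite ger0_norm.
exact: (measurableT_comp mC (measurable_fun_pair (@measurable_fst _ _ O _)
  (measurable_fun_pair (measurable_profile1 s1) (measurable_profile2 s2)))).
Qed.

Let strategy1_pt : strategy1 := Strategy (fun k => measurable_cst (point : cantor)).
Let strategy2_pt : strategy2 := Strategy (fun k => measurable_cst (point : cantor)).

(** The margin [e] is built in so that the infimum of the guaranteed levels is itself guaranteed. *)
Let guarantees (v : R) := forall n (b : 'I_n -> strategy2) e, 0 < e ->
  exists2 p : seq (R * strategy1), mixture p & forall j, mean p (J^~ (b j)) <= v + e.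

Let not_guarantees v : ~ guarantees v ->
  exists2 q : seq (R * strategy2), mixture q & forall s1, v <= mean q (J s1).
Proof.
move=> ng; apply: contrapT => nq; apply: ng => n b e e0.
by have [//|/nq] := finite_alternative strategy1_pt b v J_leM e0.
Qed.

(** At the infimum [v] Team 1 still guarantees [v], while every level below [v] fails and, by the
    finite alternative, is secured by Team 2. The two limits therefore produce the same number. *)
Lemma cantor_saddle : exists (kappa1 : forall k, Y1 k -> R -> cantor)
    (kappa2 : forall k, Y2 k -> R -> cantor) (v : R),
  [/\ measurable_team kappa1, measurable_team kappa2,
    forall s2 : strategy2,
      \int[unif]_z cantor_payoff (fun k y => kappa1 k y z) (act s2) <= v &
    forall s1 : strategy1,
      v <= \int[unif]_z cantor_payoff (act s1) (fun k y => kappa2 k y z)].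
Proof.
pose v := inf [set v | guarantees v].
have hi : has_inf [set v | guarantees v].
  split.
    exists M => n b e e0; exists [:: (1, strategy1_pt)]; first exact: mixture1.
    move=> j; rewrite mean1; apply: (@le_trans _ _ M); last by rewrite lerDl ltW.
    exact: le_trans (ler_norm _) (J_leM _ _).
  exists 0 => v' gv'; apply/ler_addgt0Pr => e e0.
  have [p mp /(_ ord0)] := gv' 1%N (fun=> strategy2_pt) e e0.
  by apply: le_trans; rewrite -(mean_cst 0 mp); apply: le_mean.
have gv : guarantees v.
  move=> n b e e0; have e20 : 0 < e / 2 by rewrite divr_gt0.
  have [v' gv' v'lt] := inf_adherent e20 hi.
  have [p mp Hp] := gv' n b _ e20; exists p => // j.
  apply: (le_trans (Hp j)); rewrite [e in leRHS]splitr addrA lerD2r.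
  exact: ltW.
have ngv v' : v' < v -> ~ guarantees v'.
  move=> v'v gv'; have : v <= v' by apply: ge_inf => //; case: hi.
  by rewrite leNgt v'v.
have inv0 m : 0 < (m.+1%:R^-1 : R) by rewrite invr_gt0 ltr0n.
have small e : 0 < e -> exists m, (m.+1%:R^-1 : R) <= e.
  move=> e0; have [m _ /(_ m (leqnn m)) /= /ltW] := near_infty_natSinv_lt (PosNum e0).
  by exists m.
have [kappa1 [mk1 H1]] : exists kappa : forall k, Y1 k -> R -> cantor, measurable_team kappa /\
    forall s2 : strategy2, \int[unif]_z cantor_payoff (fun k y => kappa k y z) (act s2) <= v.
  (* Team 1 has a mixture only against finitely many opponents, so its mixtures are indexed by a
     finite list of them and a precision. *)
  have Hp (i : seq strategy2 * nat) : exists p : seq (R * strategy1), mixture p /\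
      forall s, List.In s i.1 -> mean p (J^~ s) <= v + i.2.+1%:R^-1.
    have [p mp Hp] := gv (size i.1) (fun j => nth strategy2_pt i.1 j) _ (inv0 i.2).
    exists p; split=> // s sl.
    have [j jl <-] : exists2 j, (j < size i.1)%N & nth strategy2_pt i.1 j = s.
      elim: (i.1) sl => //= a l IH [->|/IH [j jl <-]]; first by exists 0%N.
      by exists j.+1.
    exact: (Hp (Ordinal jl)).
  have [p /all_and2[mp pv]] := choice Hp.
  (* The filter of larger lists and better precisions: each fixed opponent eventually belongs to the
     list. *)
  pose F : set_system (seq strategy2 * nat) := filter_from setT
    (fun a => [set b | List.incl a.1 b.1 /\ (a.2 <= b.2)%N]).
  have FF : ProperFilter F.
    apply: filter_from_proper; last by move=> a _; exists a; split=> //; exact: List.incl_refl.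
    apply: filter_from_filter; first by exists ([::], 0%N).
    move=> [l m] [l' m'] _ _; exists (l ++ l', maxn m m') => // -[b n] /= [lb].
    rewrite geq_max => /andP[mn m'n]; split; split=> //= s sl; apply: lb.
      by apply: List.in_or_app; left.
    by apply: List.in_or_app; right.
  have [kappa [mk [G [GP FG lim]]]] := cantor_payoff_limit1 FF mp.
  exists kappa; split=> // s2; apply/ler_addgt0Pr => e /small[m me].
  apply: (cvgr_to_le (lim s2)); apply: FG; exists ([:: s2], m) => // -[l n] /= [s2l mn].
  apply: (le_trans (pv (l, n) s2 _)); first by apply: s2l; left.
  rewrite lerD2l (le_trans _ me)// lef_pV2 ?posrE ?ltr0n// ler_nat ltnS.
  exact: mn.
have [kappa2 [mk2 H2]] : exists kappa : forall k, Y2 k -> R -> cantor, measurable_team kappa /\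
    forall s1 : strategy1, v <= \int[unif]_z cantor_payoff (act s1) (fun k y => kappa k y z).
  (* The mixtures of Team 2 are good against all pure strategies, so a sequence of precisions is
     enough. *)
  have Hq (n : nat) : exists q : seq (R * strategy2), mixture q /\
      forall s1, v - n.+1%:R^-1 <= mean q (J s1).
    have [|q mq vq] := not_guarantees (v := v - n.+1%:R^-1); last by exists q.
    by apply: ngv; rewrite ltrBlDr ltrDl.
  have [q /all_and2[mq vq]] := choice Hq.
  have [kappa [mk [G [GP FG lim]]]] := cantor_payoff_limit2 (F := \oo) _ mq.
  exists kappa; split=> // s1; apply/ler_addgt0Pr => e /small[m me].
  rewrite -lerBlDr; apply: (cvgr_to_ge (lim s1)); apply: FG; exists m => // n /= mn.
  apply: (le_trans _ (vq n s1)); rewrite lerD2l lerN2 (le_trans _ me)//.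
  by rewrite lef_pV2 ?posrE ?ltr0n// ler_nat ltnS.
by exists kappa1, kappa2, v.
Qed.

End CantorGame.

(** * Uniform continuity of the cost in Cantor coordinates *)

Section UniformContinuity.

Lemma ultra_cantor_limit (U : set_system nat) (x : nat -> cantor) : UltraFilter U ->
  exists v : cantor, forall n, U [set m | prefix (x m) n = prefix v n].
Proof.
move=> FU; pose v : cantor := fun i => `[< U [set m | x m i = true] >].
exists v; elim=> [|n IH]; first by apply: filterE.
have vn : U [set m | x m n = v n].
  rewrite /v; case: asboolP => // nU.
  have [//|H] := in_ultra_setVsetC [set m | x m n = true] FU.
  by apply: filterS H => m /= /negP/negbTE.
by apply: filterS2 vn IH => m /= -> ->.
Qed.

Lemma cvg_prefix_cantor (K : topologicalType) (h : cantor_space -> K) (U : set_system nat)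
    (x : nat -> cantor) (v : cantor) : Filter U -> continuous h ->
  (forall n, U [set m | prefix (x m) n = prefix v n]) ->
  (fun m => h (x m)) @ U --> h v.
Proof.
move=> FU ch xv A /ch /nbhs_cantor [n An].
apply: (@filterS _ U _ [set m | prefix (x m) n = prefix v n] _ _ (xv n)) => m xm.
by apply: (An (x m)); rewrite /cylinder/= size_prefix.
Qed.

(** Compactness by contradiction: profiles that agree on longer and longer prefixes have, coordinate
    by coordinate, the same limit along an ultrafilter. Continuity of [f] there forces their values
    together. *)
Lemma cantor_uniformly_continuous (R : realType) (I1 I2 : choiceType)
    (K1 : I1 -> topologicalType) (K2 : I2 -> topologicalType)
    (h1 : forall i, cantor_space -> K1 i) (h2 : forall i, cantor_space -> K2 i)
    (f : prod_topology K1 * prod_topology K2 -> R) (e : R) :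
  (forall i, continuous (h1 i)) -> (forall i, continuous (h2 i)) -> continuous f -> 0 < e ->
  exists n, forall (u1 u1' : I1 -> cantor) (u2 u2' : I2 -> cantor),
    (forall i, prefix (u1 i) n = prefix (u1' i) n) ->
    (forall i, prefix (u2 i) n = prefix (u2' i) n) ->
    `|f (fun i => h1 i (u1 i), fun i => h2 i (u2 i)) -
      f (fun i => h1 i (u1' i), fun i => h2 i (u2' i))| <= e.
Proof.
move=> ch1 ch2 cf e0; apply: contrapT => no.
pose agree n (q : ((I1 -> cantor) * (I2 -> cantor)) * ((I1 -> cantor) * (I2 -> cantor))) :=
  (forall i, prefix (q.1.1 i) n = prefix (q.2.1 i) n) /\
  (forall i, prefix (q.1.2 i) n = prefix (q.2.2 i) n).
pose val (a : (I1 -> cantor) * (I2 -> cantor)) : R :=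
  f (fun i => h1 i (a.1 i), fun i => h2 i (a.2 i)).
have /choice[q qP] n : exists q, agree n q /\ ~ (`|val q.1 - val q.2| <= e).
  apply: contrapT => nq; apply: no; exists n => u1 u1' u2 u2' a1 a2.
  by apply: contrapT => H; apply: nq; exists ((u1, u2), (u1', u2')).
have [U [FU oU]] := @ultraFilterLemma nat \oo _.
have /choice[v1 v1P] i := ultra_cantor_limit (fun m => (q m).1.1 i) FU.
have /choice[v2 v2P] i := ultra_cantor_limit (fun m => (q m).1.2 i) FU.
have large n : U [set m | (n <= m)%N] by apply: oU; exists n.
have v1P' i n : U [set m | prefix ((q m).2.1 i) n = prefix (v1 i) n].
  apply: filterS2 (v1P i n) (large n) => m /= <- nm.
  by have [[a _] _] := qP m; apply/esym; exact: prefix_le nm (a i).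
have v2P' i n : U [set m | prefix ((q m).2.2 i) n = prefix (v2 i) n].
  apply: filterS2 (v2P i n) (large n) => m /= <- nm.
  by have [[_ a] _] := qP m; apply/esym; exact: prefix_le nm (a i).
pose l : R := val (v1, v2).
have lim (a : nat -> (I1 -> cantor) * (I2 -> cantor)) :
    (forall i n, U [set m | prefix ((a m).1 i) n = prefix (v1 i) n]) ->
    (forall i n, U [set m | prefix ((a m).2 i) n = prefix (v2 i) n]) ->
    (fun m => val (a m)) @ U --> l.
  move=> a1 a2; apply: (@continuous_cvg _ _ _ U _
    (fun m => ((fun i => h1 i ((a m).1 i)) : prod_topology K1,
               (fun i => h2 i ((a m).2 i)) : prod_topology K2)) f _ (cf _)).
  apply: (@cvg_pair _ _ _ U (nbhs ((fun i => h1 i (v1 i)) : prod_topology K1))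
    (nbhs ((fun i => h2 i (v2 i)) : prod_topology K2))).
    by apply: cvg_pointwise => i; exact: cvg_prefix_cantor.
  by apply: cvg_pointwise => i; exact: cvg_prefix_cantor.
have e20 : 0 < e / 2 by rewrite divr_gt0.
have /cvgrPdist_le /(_ _ e20) L1 := lim (fun m => (q m).1) v1P v2P.
have /cvgrPdist_le /(_ _ e20) L2 := lim (fun m => (q m).2) v1P' v2P'.
have [m [/= A1 A2]] := filter_ex (filterI L1 L2).
have [_] := qP m; apply.
rewrite -(subrK l (val (q m).1)) -addrA (le_trans (ler_normD _ _))// [e]splitr lerD//.
by rewrite distrC.
Qed.

End UniformContinuity.

(** * Policies and expected costs *)

Section TripleIntegrals.
Context {d1 d2 d3} {T1 : measurableType d1} {T2 : measurableType d2} {T3 : measurableType d3}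
  {R : realType} (P1 : probability T1 R) (P2 : probability T2 R) (P3 : probability T3 R).
Context (f : (T1 * T2) * T3 -> \bar R) (f0 : forall q, (0 <= f q)%E) (mf : measurable_fun setT f).

Let P12 : probability (T1 * T2)%type R := (P1 \x P2)%E.

Let mF : measurable_fun [set: T1 * T2] (fubini_F P3 f).
Proof. exact: measurable_fun_fubini_tonelli_F. Qed.

Let F0 q : (0 <= fubini_F P3 f q)%E. Proof. exact: integral_ge0. Qed.

Let intE : (\int[(P1 \x P2) \x P3]_q f q = \int[P1 \x P2]_q fubini_F P3 f q)%E.
Proof. exact: (@fubini_tonelli1 _ _ _ _ _ P12 P3 f mf f0). Qed.

(** Reduction to pure opponents: the opponent's random number [b] is integrated last, so a bound for
    each of its values passes to the whole integral. *)
Lemma triple_integral_le (v : R) : 0 <= v ->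
  (forall b, \int[P1]_a \int[P3]_x f ((a, b), x) <= v%:E)%E ->
  (\int[(P1 \x P2) \x P3]_q f q <= v%:E)%E.
Proof.
move=> v0 fv; rewrite intE fubini_tonelli2//.
rewrite -[leRHS]mule1 -(probability_setT P2) -integral_cst//.
apply: ge0_le_integral => //.
- by move=> b _; exact: integral_ge0.
- exact: measurable_fun_fubini_tonelli_G.
- by move=> b _; exact: fv.
Qed.

Lemma triple_integral_ge (v : R) :
  (forall a, v%:E <= \int[P2]_b \int[P3]_x f ((a, b), x))%E ->
  (v%:E <= \int[(P1 \x P2) \x P3]_q f q)%E.
Proof.
move=> fv; have [v0|/ltW v0] := leP 0 v; last first.
  by apply: (@le_trans _ _ 0%E); [rewrite lee_fin|exact: integral_ge0].
rewrite intE fubini_tonelli1//.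
rewrite -[leLHS]mule1 -(probability_setT P1) -integral_cst//.
apply: ge0_le_integral => //.
- exact: measurable_fun_fubini_tonelli_F.
- by move=> a _; exact: fv.
Qed.

End TripleIntegrals.

Lemma iterated_EFin d1 d2 (T1 : measurableType d1) (T2 : measurableType d2) (R : realType)
    (P1 : probability T1 R) (P2 : probability T2 R) (f : T1 * T2 -> R) (M : R) :
  measurable_fun setT f -> (forall q, 0 <= f q) -> (forall q, f q <= M) ->
  (\int[P1]_a \int[P2]_x (f (a, x))%:E)%E = (\int[P1]_a \int[P2]_x f (a, x))%:E.
Proof.
move=> mf f0 fM.
have fN q : `|f q| <= M by rewrite ger0_norm.
have mfa a : measurable_fun setT (fun x => f (a, x)).
  exact: (measurableT_comp mf (measurable_fun_pair (measurable_cst a) (@measurable_id _ T2 setT))).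
have P2T : fine (P2 setT) = 1 by rewrite probability_setT.
under eq_integral do rewrite (integral_EFin (mfa _) (fun x => fN (_, x))).
apply: (integral_EFin (M := M)) => [|a].
  apply: (measurableT_comp (@fine_measurable _ setT measurableT)).
  apply: (@measurable_fun_fubini_tonelli_F _ _ _ _ _ P2 (fun q : T1 * T2 => (f q)%:E)) => [|q].
    exact/measurable_EFinP.
  by rewrite lee_fin.
by rewrite -[leRHS]mulr1 -P2T; apply: norm_Rintegral_le.
Qed.

(** Adding [M] makes the cost nonnegative, so that Tonelli applies throughout. *)
Lemma shift_expectation d (T : measurableType d) (R : realType) (P : probability T R)
    (f : T -> R) (M : R) : measurable_fun setT f -> (forall x, `|f x| <= M) ->
  (\int[P]_x (f x)%:E = \int[P]_x (f x + M)%:E - M%:E)%E.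
Proof.
move=> mf fM.
have PT : fine (P setT) = 1 by rewrite probability_setT.
have intf := bounded_integrable (P := P) mf fM.
have intM : P.-integrable setT (EFin \o (cst M : T -> R)).
  by apply: (bounded_integrable (M := `|M|)).
rewrite (integral_EFin mf fM) (@integral_EFin _ _ _ P _ (M + `|M|)); last 2 first.
- exact: measurable_funD.
- by move=> x; apply: (le_trans (ler_normD _ _)); rewrite lerD2r.
by rewrite RintegralD// Rintegral_cst// [X in _ * X]PT mulr1 -EFinB addrK.
Qed.

(** The state is projected out of the dominating measure: its marginal on the measurements is still
    a product, has mass 1 as the box with full sides shows, and its null sets lift to null sets of
    the original. *)
Lemma product_marginal (R : realType) (N : nat) (dY : 'I_N -> measure_display)
    (Y : forall j, measurableType (dY j)) d0 (O : measurableType d0)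
    dX (X : measurableType dX) (mu : probability X R) (pr : X -> O * dprodM Y) :
  (exists (mu0 : probability O R) (Q : forall j, probability (Y j) R)
      (nu : {measure set (O * dprodM Y)%type -> \bar R}),
      is_product_measure nu mu0 (fun j => Q j) /\ pushforward mu pr `<< nu) ->
  exists (Q : forall j, probability (Y j) R) (nu : probability (dprodM Y) R),
    (forall A : (forall k, set (Y k)), (forall k, measurable (A k)) ->
      nu (box A) = (\prod_(k < N) Q k (A k))%E) /\
    forall A, measurable A -> nu A = 0%E -> mu [set x | A (pr x).2] = 0%E.
Proof.
move=> [mu0 [Q [nu [nuE ac]]]].
pose m := image_measure nu (@measurable_snd _ _ O (dprodM Y)).
have mbox A : (forall k, measurable (A k)) -> m (box A) = (\prod_(k < N) Q k (A k))%E.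
  move=> mA; have := nuE setT A measurableT mA; rewrite probability_setT mul1e => <-.
  congr (nu _); by apply/seteqP; split=> q /=; [split|case].
have m1 : m setT = 1%E.
  rewrite (_ : setT = box (fun k : 'I_N => @setT (Y k))); last by apply/seteqP; split.
  by rewrite mbox// big1// => k _; exact: probability_setT.
have [P PE] := probability_of_measure m1.
exists Q, P; split=> [A mA|A mA]; rewrite PE; first exact: mbox.
move=> A0; have /null_content_dominatesP dom := ac.
apply: (dom (snd @^-1` A)) => //.
by rewrite -[X in measurable X]setTI; exact: measurable_snd.
Qed.

Section Policies.
Context {R : realType} {N : nat} {dY : 'I_N -> measure_display}
  {Y : forall j, measurableType (dY j)}.

Let diagonal (t : R) : Wsp R N := fun=> t.

Let measurable_diagonal : measurable_fun [set: R] diagonal.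
Proof. by apply: measurable_fun_dprod => k; exact: measurable_id. Qed.

(** A policy draws a point of the cube seen by all players. The law of the diagonal point, with the
    same uniform [t] in each coordinate, is used; player [k] reads coordinate [k], so that all share
    [t]. *)
Lemma cantor_policy (U : 'I_N -> ptopologicalType) (h : forall k, cantor_space -> U k)
    (kappa : forall k, Y k -> R -> cantor) :
  (forall k, measurable_fun [set: cantor] (h k : cantor -> borel (U k))) ->
  measurable_team kappa ->
  exists g : @team_policy R N dY Y U,
    (forall k y t, @tp_gamma R N dY Y U g k y (fun=> t) = h k (kappa k y t)) /\
    forall f : Wsp R N -> \bar R, (forall z, 0 <= f z)%E -> measurable_fun setT f ->
      (\int[@tp_eta R N dY Y U g]_z f z = \int[unif]_t f (fun=> t))%E.
Proof.
move=> mh mk.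
have eta1 : image_measure unif measurable_diagonal setT = 1%E.
  by rewrite /= /pushforward preimage_setT probability_setT.
have [eta etaE] := probability_of_measure eta1.
have cube : eta (unit_cube R N) = 1%E.
  have mcube : measurable (unit_cube R N).
    rewrite (_ : unit_cube R N = @box N _ (fun _ => (R : measurableType _)) (fun=> `[0, 1]%classic)).
      by apply: measurable_box => k; exact: measurable_itv.
    by apply/seteqP; split=> z H k; have := H k; rewrite /= in_itv.
  have mpre : measurable (diagonal @^-1` unit_cube R N).
    by rewrite -[X in measurable X]setTI; exact: measurable_diagonal.
  rewrite etaE /= /pushforward unif_setI01//.
  rewrite (_ : _ `&` _ = `[0, 1[%classic); first by rewrite unif_itv// subr0.
  apply/seteqP; split=> t; first by case.
  by move=> t01; split=> // k; move: t01; rewrite /= in_itv/= => /andP[-> /ltW].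
pose gamma k (y : Y k) (z : Wsp R N) : U k := h k (kappa k y (z k)).
have mgamma k : measurable_fun [set: Y k * Wsp R N]
    (fun p => (gamma k p.1 p.2 : borel (U k))).
  apply: (measurableT_comp (mh k)).
  exact: (measurableT_comp (mk k) (measurable_fun_pair (@measurable_fst _ _ (Y k) (Wsp R N))
    (measurableT_comp (@measurable_dproj _ _ (fun _ : 'I_N => (R : measurableType _)) k)
      (@measurable_snd _ _ (Y k) (Wsp R N))))).
exists (@Build_team_policy R N dY Y U eta cube gamma mgamma); split=> // f f0 mf.
transitivity (\int[image_measure unif measurable_diagonal]_z f z)%E.
  by apply: eq_measure_integral => A mA _; exact: etaE.
by rewrite ge0_integral_pushforward.
Qed.

End Policies.

(** * Transfer of the saddle point from the Cantor space to the action spaces *)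

Unset Implicit Arguments.

Theorem theorem3
  (R : realType)
  (* state space *)
  (d0 : measure_display) (O : measurableType d0)
  (* numbers of players *)
  (N1 N2 : nat) (hN1 : (0 < N1)%N) (hN2 : (0 < N2)%N)
  (* measurement spaces *)
  (dY1 : 'I_N1 -> measure_display) (Y1 : forall j, measurableType (dY1 j))
  (dY2 : 'I_N2 -> measure_display) (Y2 : forall j, measurableType (dY2 j))
  (* action spaces: compact metrizable (hence compact Polish) spaces *)
  (U1 : 'I_N1 -> pseudoPMetricType R) (U2 : 'I_N2 -> pseudoPMetricType R)
  (* information structure and cost *)
  (mu : probability (O * (dprodM Y1 * dprodM Y2))%type R)
  (c : (O * (dprodM (fun j => borel (U1 j)) * dprodM (fun j => borel (U2 j))))%type -> R)
  (* standard Borel spaces *)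
  (sbO : standard_borel R O)
  (sbY1 : forall j, standard_borel R (Y1 j))
  (sbY2 : forall j, standard_borel R (Y2 j))
  (hU1 : forall j, hausdorff_space (U1 j) /\ compact [set: U1 j])
  (hU2 : forall j, hausdorff_space (U2 j) /\ compact [set: U2 j])
  (* (ii) absolute continuity of the team marginals w.r.t. product measures *)
  (ac1 : exists (mu01 : probability O R) (Q1 : forall j, probability (Y1 j) R)
           (nu1 : {measure set (O * dprodM Y1)%type -> \bar R}),
           is_product_measure nu1 mu01 (fun j => Q1 j) /\
           (pushforward mu (fun x : (O * (dprodM Y1 * dprodM Y2))%type =>
                                 (x.1, x.2.1)) `<< nu1))
  (ac2 : exists (mu02 : probability O R) (Q2 : forall j, probability (Y2 j) R)
           (nu2 : {measure set (O * dprodM Y2)%type -> \bar R}),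
           is_product_measure nu2 mu02 (fun j => Q2 j) /\
           (pushforward mu (fun x : (O * (dprodM Y1 * dprodM Y2))%type =>
                                 (x.1, x.2.2)) `<< nu2))
  (* (iii) cost: measurable, bounded, continuous in the actions *)
  (cmeas : measurable_fun [set: (O * (dprodM (fun j => borel (U1 j)) *
                                      dprodM (fun j => borel (U2 j))))%type] c)
  (cbnd : exists M : R, forall x, `|c x| <= M)
  (ccont : forall w : O,
     continuous (fun u : (prod_topology (fun j => U1 j : ptopologicalType) *
                          prod_topology (fun j => U2 j : ptopologicalType))%type =>
                   c (w, u))) :
  exists (g1s : @team_policy R N1 dY1 Y1 (fun j => U1 j))
         (g2s : @team_policy R N2 dY2 Y2 (fun j => U2 j)),
    ereal_inf [set game_value mu c g1 g2s | g1 in [set: @team_policy R N1 dY1 Y1 (fun j => U1 j)]]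
      = game_value mu c g1s g2s /\
    game_value mu c g1s g2s
      = ereal_sup [set game_value mu c g1s g2 | g2 in [set: @team_policy R N2 dY2 Y2 (fun j => U2 j)]].
Proof.
have [M cM] := cbnd.
have [Q1 [nu1 [nu1E mu_nu1]]] := product_marginal ac1.
have [Q2 [nu2 [nu2E mu_nu2]]] := product_marginal ac2.
have P1 k := cid (compact_parametrization (hU1 k).1 (hU1 k).2).
have P2 k := cid (compact_parametrization (hU2 k).1 (hU2 k).2).
pose h1 k := projT1 (P1 k); pose sel1 k := projT1 (cid (projT2 (P1 k))).
pose h2 k := projT1 (P2 k); pose sel2 k := projT1 (cid (projT2 (P2 k))).
have h1P k : [/\ continuous (h1 k), measurable_fun [set: borel (U1 k)] (sel1 k) &
    forall u, h1 k (sel1 k u) = u] by rewrite /sel1; case: cid.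
have h2P k : [/\ continuous (h2 k), measurable_fun [set: borel (U2 k)] (sel2 k) &
    forall u, h2 k (sel2 k u) = u] by rewrite /sel2; case: cid.
have ch1 k : continuous (h1 k) by have [] := h1P k.
have ch2 k : continuous (h2 k) by have [] := h2P k.
have msel1 k : measurable_fun [set: borel (U1 k)] (sel1 k) by have [] := h1P k.
have msel2 k : measurable_fun [set: borel (U2 k)] (sel2 k) by have [] := h2P k.
have hK1 k u : h1 k (sel1 k u) = u by have [_ _] := h1P k; apply.
have hK2 k u : h2 k (sel2 k u) = u by have [_ _] := h2P k; apply.
have mh1 k := measurable_continuous_cantor (ch1 k).
have mh2 k := measurable_continuous_cantor (ch2 k).
pose profile1 := dprodM (fun _ : 'I_N1 => (cantor : measurableType _)).
pose profile2 := dprodM (fun _ : 'I_N2 => (cantor : measurableType _)).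
(* The cost in Cantor coordinates, shifted by [M] into the interval from 0 to [M + M]. *)
pose C (w : O) (u1 : profile1) (u2 : profile2) : R :=
  c (w, ((fun k => h1 k (u1 k)), (fun k => h2 k (u2 k)))) + M.
have C0 w u1 u2 : 0 <= C w u1 u2.
  rewrite /C -lerBlDr sub0r.
  by have := cM (w, ((fun k => h1 k (u1 k)), (fun k => h2 k (u2 k)))); rewrite ler_norml => /andP[].
have CM w u1 u2 : C w u1 u2 <= M + M.
  by rewrite /C lerD2r; exact: le_trans (ler_norm _) (cM _).
have mC : measurable_fun [set: O * (profile1 * profile2)] (fun q => C q.1 q.2.1 q.2.2).
  apply: measurable_funD; last exact: measurable_cst.
  have mp1 : measurable_fun [set: O * (profile1 * profile2)]
      (fun q => ((fun k => h1 k (q.2.1 k)) : dprodM (fun j => borel (U1 j)))).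
    apply: measurable_fun_dprod => k.
    exact: (measurableT_comp (mh1 k) (measurableT_comp
      (@measurable_dproj _ _ (fun _ : 'I_N1 => (cantor : measurableType _)) k)
      (measurableT_comp measurable_fst (@measurable_snd _ _ O (profile1 * profile2)%type)))).
  have mp2 : measurable_fun [set: O * (profile1 * profile2)]
      (fun q => ((fun k => h2 k (q.2.2 k)) : dprodM (fun j => borel (U2 j)))).
    apply: measurable_fun_dprod => k.
    exact: (measurableT_comp (mh2 k) (measurableT_comp
      (@measurable_dproj _ _ (fun _ : 'I_N2 => (cantor : measurableType _)) k)
      (measurableT_comp measurable_snd (@measurable_snd _ _ O (profile1 * profile2)%type)))).
  exact: (measurableT_comp cmeas (measurable_fun_pair (@measurable_fst _ _ O _)
    (measurable_fun_pair mp1 mp2))).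
have contC w e : 0 < e -> exists n, forall u1 u1' u2 u2',
    (forall k, prefix (u1 k) n = prefix (u1' k) n) ->
    (forall k, prefix (u2 k) n = prefix (u2' k) n) -> `|C w u1 u2 - C w u1' u2'| <= e.
  move=> e0; have [n Hn] := cantor_uniformly_continuous ch1 ch2 (ccont w) e0.
  exists n => u1 u1' u2 u2' a1 a2; rewrite /C opprD addrACA subrr addr0.
  exact: Hn.
have [kappa1 [kappa2 [v [mk1 mk2 sad1 sad2]]]] := cantor_saddle mC C0 CM contC
  (fun k => standard_borel_countably_generated (sbY1 k))
  (fun k => standard_borel_countably_generated (sbY2 k)) nu1E nu2E mu_nu1 mu_nu2.
have [g1s [g1sE eta1E]] := @cantor_policy R N1 dY1 Y1 (fun j => U1 j) h1 kappa1 mh1 mk1.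
have [g2s [g2sE eta2E]] := @cantor_policy R N2 dY2 Y2 (fun j => U2 j) h2 kappa2 mh2 mk2.
pose policy1 := @team_policy R N1 dY1 Y1 (fun j => U1 j).
pose policy2 := @team_policy R N2 dY2 Y2 (fun j => U2 j).
pose gam1 (g : policy1) k y z := @tp_gamma R N1 dY1 Y1 (fun j => U1 j) g k y z.
pose gam2 (g : policy2) k y z := @tp_gamma R N2 dY2 Y2 (fun j => U2 j) g k y z.
pose X := (O * (dprodM Y1 * dprodM Y2))%type.
pose W1 := Wsp R N1; pose W2 := Wsp R N2.
pose cost (g1 : policy1) (g2 : policy2) (p : (W1 * W2) * X) : R :=
  c (p.2.1, ((fun k => gam1 g1 k (p.2.2.1 k) p.1.1) : dprodM (fun j => borel (U1 j)),
             (fun k => gam2 g2 k (p.2.2.2 k) p.1.2) : dprodM (fun j => borel (U2 j)))).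
have mcost g1 g2 : measurable_fun [set: (W1 * W2) * X] (cost g1 g2).
  have mx : measurable_fun [set: (W1 * W2) * X] (fun p => p.2 : X) by exact: measurable_snd.
  have mz : measurable_fun [set: (W1 * W2) * X] (fun p => p.1 : (W1 * W2)%type).
    exact: measurable_fst.
  have mp1 : measurable_fun [set: (W1 * W2) * X]
      (fun p => (fun k => gam1 g1 k (p.2.2.1 k) p.1.1) : dprodM (fun j => borel (U1 j))).
    apply: measurable_fun_dprod => k.
    exact: (measurableT_comp (@tp_gamma_meas _ _ _ _ _ g1 k) (measurable_fun_pair
      (measurableT_comp (@measurable_dproj _ _ Y1 k)
        (measurableT_comp measurable_fst (measurableT_comp measurable_snd mx)))
      (measurableT_comp measurable_fst mz))).
  have mp2 : measurable_fun [set: (W1 * W2) * X]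
      (fun p => (fun k => gam2 g2 k (p.2.2.2 k) p.1.2) : dprodM (fun j => borel (U2 j))).
    apply: measurable_fun_dprod => k.
    exact: (measurableT_comp (@tp_gamma_meas _ _ _ _ _ g2 k) (measurable_fun_pair
      (measurableT_comp (@measurable_dproj _ _ Y2 k)
        (measurableT_comp measurable_snd (measurableT_comp measurable_snd mx)))
      (measurableT_comp measurable_snd mz))).
  exact: (measurableT_comp cmeas (measurable_fun_pair (measurableT_comp measurable_fst mx)
    (measurable_fun_pair mp1 mp2))).
pose F g1 g2 p := cost g1 g2 p + M.
have F0 g1 g2 p : 0 <= F g1 g2 p.
  have H : `|cost g1 g2 p| <= M by exact: cM.
  by rewrite /F -lerBlDr sub0r; move: H; rewrite ler_norml => /andP[].
have FM g1 g2 p : F g1 g2 p <= M + M.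
  by rewrite /F lerD2r; exact: le_trans (ler_norm _) (cM _).
have mF g1 g2 : measurable_fun [set: (W1 * W2) * X] (F g1 g2).
  by apply: measurable_funD => //; exact: mcost.
pose eta1 (g : policy1) := @tp_eta R N1 dY1 Y1 (fun j => U1 j) g.
pose eta2 (g : policy2) := @tp_eta R N2 dY2 Y2 (fun j => U2 j) g.
have valueE g1 g2 : game_value mu c g1 g2 =
    (\int[(eta1 g1 \x eta2 g2) \x mu]_p (F g1 g2 p)%:E - M%:E)%E.
  pose P12 : probability (W1 * W2)%type R := (eta1 g1 \x eta2 g2)%E.
  pose P : probability ((W1 * W2) * X)%type R := (P12 \x mu)%E.
  exact: (@shift_expectation _ _ R P (cost g1 g2) M (mcost g1 g2) (fun p => cM _)).
have mFE g1 g2 : measurable_fun setT (fun p => (F g1 g2 p)%:E).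
  by apply/measurable_EFinP; exact: mF.
have F0E g1 g2 p : (0 <= (F g1 g2 p)%:E)%E by rewrite lee_fin.
have v0 : 0 <= v.
  pose s2 : @strategy N2 dY2 Y2 := Strategy (fun k => measurable_cst (point : cantor)).
  apply: le_trans (sad1 s2); apply: Rintegral_ge0 => t _; apply: Rintegral_ge0 => x _.
  exact: C0.
have le_v g2 : (game_value mu c g1s g2 <= (v - M)%:E)%E.
  rewrite valueE EFinB leeD2r//; apply: triple_integral_le => // b.
  (* With its random number frozen at [b], the opponent's policy is pure; the Borel section lifts it
     to a Cantor strategy inducing the same actions, to which [sad1] applies. *)
  pose s2 k (y : Y2 k) : cantor := sel2 k (gam2 g2 k y b).
  have ms2 k : measurable_fun [set: Y2 k] (@s2 k).
    apply: (measurableT_comp (msel2 k)).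
    exact: (measurableT_comp (@tp_gamma_meas _ _ _ _ _ g2 k)
      (measurable_fun_pair (@measurable_id _ (Y2 k) setT) (measurable_cst b))).
  have mbx : measurable_fun [set: W1 * X] (fun q => (((q.1, b) : (W1 * W2)%type), q.2)).
    apply: measurable_fun_pair; last exact: measurable_snd.
    by apply: measurable_fun_pair => //; exact: measurable_fst.
  have mtx : measurable_fun [set: R * X] (fun q => (((fun=> q.1) : W1), q.2)).
    apply: measurable_fun_pair; last exact: measurable_snd.
    by apply: measurable_fun_dprod => k; exact: measurable_fst.
  rewrite eta1E; last 2 first.
  - by move=> a; exact: integral_ge0.
  - apply: (@measurable_fun_fubini_tonelli_F _ _ _ _ _ mu
      (fun q : W1 * X => (F g1s g2 ((q.1, b), q.2))%:E)) => [|q]; last exact: F0E.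
    by apply/measurable_EFinP; exact: (measurableT_comp (mF g1s g2) mbx).
  rewrite (@iterated_EFin _ _ _ _ _ _ _ (fun q : R * X => F g1s g2 (((fun=> q.1), b), q.2)) (M + M)) => //.
    rewrite lee_fin; apply: le_trans (sad1 (Strategy ms2)); rewrite le_eqVlt; apply/orP; left.
    apply/eqP; apply: eq_Rintegral => t _; apply: eq_Rintegral => x _.
    rewrite /F /cost /C /=; congr (c (_, (_, _)) + M); apply: functional_extensionality_dep => k.
      exact: g1sE.
    by rewrite /s2 hK2.
  exact: (measurableT_comp (mF g1s g2) (measurableT_comp mbx mtx)).
have ge_v g1 : ((v - M)%:E <= game_value mu c g1 g2s)%E.
  rewrite valueE EFinB leeD2r//; apply: triple_integral_ge => // a.
  pose s1 k (y : Y1 k) : cantor := sel1 k (gam1 g1 k y a).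
  have ms1 k : measurable_fun [set: Y1 k] (@s1 k).
    apply: (measurableT_comp (msel1 k)).
    exact: (measurableT_comp (@tp_gamma_meas _ _ _ _ _ g1 k)
      (measurable_fun_pair (@measurable_id _ (Y1 k) setT) (measurable_cst a))).
  have max : measurable_fun [set: W2 * X] (fun q => ((a, q.1) : (W1 * W2)%type, q.2)).
    apply: measurable_fun_pair; last exact: measurable_snd.
    by apply: measurable_fun_pair => //; exact: measurable_fst.
  have mtx : measurable_fun [set: R * X] (fun q => (((fun=> q.1) : W2), q.2)).
    apply: measurable_fun_pair; last exact: measurable_snd.
    by apply: measurable_fun_dprod => k; exact: measurable_fst.
  rewrite eta2E; last 2 first.
  - by move=> b; exact: integral_ge0.
  - apply: (@measurable_fun_fubini_tonelli_F _ _ _ _ _ mu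
      (fun q : W2 * X => (F g1 g2s ((a, q.1), q.2))%:E)) => [|q]; last exact: F0E.
    by apply/measurable_EFinP; exact: (measurableT_comp (mF g1 g2s) max).
  rewrite (@iterated_EFin _ _ _ _ _ _ _ (fun q : R * X => F g1 g2s ((a, fun=> q.1), q.2)) (M + M)) => //.
    rewrite lee_fin; apply: le_trans (sad2 (Strategy ms1)) _; rewrite le_eqVlt; apply/orP; left.
    apply/eqP; apply: eq_Rintegral => t _; apply: eq_Rintegral => x _.
    rewrite /F /cost /C /=; congr (c (_, (_, _)) + M); apply: functional_extensionality_dep => k.
      by rewrite /s1 hK1.
    by apply/esym; exact: g2sE.
  exact: (measurableT_comp (mF g1 g2s) (measurableT_comp max mtx)).
(* [le_v] taken at [g2s] and [ge_v] taken at [g1s] pin down the value; the same two bounds then give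
   the supremum and the infimum. *)
have eq_v : game_value mu c g1s g2s = (v - M)%:E.
  by apply/eqP; rewrite eq_le le_v ge_v.
exists g1s, g2s; rewrite eq_v; split.
  apply/eqP; rewrite eq_le; apply/andP; split.
    by apply: ereal_inf_lbound; exists g1s.
  by apply: le_ereal_inf_tmp => _ [g1 _ <-]; exact: ge_v.
apply/eqP; rewrite eq_le; apply/andP; split.
  by apply: ereal_sup_ubound; exists g2s.
by apply: ge_ereal_sup => _ [g2 _ <-]; exact: le_v.
Qed.
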